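(* Let $\underline\lambda$ be a Schubert problem on $G(a,b)$ with a composable partition $(\underline\mu,\underline\nu),\underline a,\underline b$, where $\underline\mu=(\mu^1,\dots,\mu^r)$, $\underline\nu=(\nu^1,\dots,\nu^s)$. Let $c,d$ be positive integers and let $\underline\rho=(\underline\alpha,\underline\beta,\underline\gamma)$ be a Schubert problem on $G(c,d)$ with $\underline\alpha=(\alpha^1,\dots,\alpha^r)$, $\underline\beta=(\beta^1,\dots,\beta^s)$, $\underline\gamma=(\gamma^1,\dots,\gamma^t)$. Then the composition $\underline\lambda\circ\underline\rho$ is a Schubert problem on $G(a+c,b+d)$ and \[\delta(\underline\lambda\circ\underline\rho)=\delta(\underline\lambda)\cdot\delta(\underline\rho).\]
   Context: Partitions are weakly decreasing finite sequences of positive integers (the empty/zero partition $\emptyset$ is allowed), $\lambda_i:=0$ beyond the length $\ell(\lambda)$, $|\lambda|=\sum\lambda_i$, $\subseteq$ is componentwise. $\Box_{a,b}$ is the partition with $a$ parts equal to $b$; $\mu+\nu$ has $k$-th part $\mu_k+\nu_k$; $(\mu,\nu)$ is the decreasing rearrangement of the concatenated parts of $\mu$ and $\nu$. $G(a,b)$ is the Grassmannian of $a$-planes in $\mathbb{C}^{a+b}$, with Schubert classes $\sigma_\lambda$ ($\lambda\subseteq\Box_{a,b}$) in its cohomology ring. A Schubert problem on $G(a,b)$ is a list $\underline\lambda=(\lambda^1,\dots,\lambda^r)$ of partitions $\lambda^i\subseteq\Box_{a,b}$ with $\sum_i|\lambda^i|=ab$; $\delta(\underline\lambda)$ is the coefficient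 of $\sigma_{\Box_{a,b}}$ in $\sigma_{\lambda^1}\cdots\sigma_{\lambda^r}$, equivalently the coefficient of the Schur function $S_{\Box_{a,b}}$ in $S_{\lambda^1}\cdots S_{\lambda^r}$ (this is the number of points in an intersection of Schubert varieties $\Omega_{\lambda^i}F^i_\bullet$ for general flags). A composable partition of a Schubert problem $\underline\lambda$ on $G(a,b)$ is a splitting of its list of conditions into two lists $\underline\mu=(\mu^1,\dots,\mu^r)$ and $\underline\nu=(\nu^1,\dots,\nu^s)$, together with nonnegative integers $\underline a=(a_1,\dots,a_r)$, $\underline b=(b_1,\dots,b_s)$ with $a_1+\dots+a_r=a$, $b_1+\dots+b_s=b$, $a_i\ge\ell(\mu^i)$ and $b_j\ge\nu^j_1$ for all $i,j$. Given this and a Schubert problem $\underline\rho=(\underline\alpha,\underline\beta,\underline\gamma)$ on $G(c,d)$ split into lists of lengths $r,s,t$ (entries may be $\emptyset$), the composition $\underline\lambda\circ\underline\rho$ is the list of partitions $(\Box_{a_1,d}+\mu^1,\alpha^1),\dots,(\Box_{a_r,d}+\mu^r,\alpha^r),\ (\Box_{c,b_1},\nu^1)+\beta^1,\dots,(\Box_{c,b_s},\nu^s)+\beta^s,\ \gamma^1,\dots,\gamma^t$. *)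

(* Defs.v *)
From HB Require Import structures.
From mathcomp Require Import all_boot all_order all_algebra.
From Stdlib Require Import ClassicalEpsilon.
Set Implicit Arguments. Unset Strict Implicit. Unset Printing Implicit Defensive.
Import Order.TTheory GRing.Theory Num.Theory.

(** * Partitions, represented as seq nat (weakly decreasing, positive parts).
    lambda_i := nth 0 lambda i (0 beyond the length). *)
Definition is_partition (l : seq nat) : bool :=
  sorted geq l && all (fun x => 0 < x) l.

Definition subp (l m : seq nat) : bool :=
  all (fun i => nth 0 l i <= nth 0 m i) (iota 0 (size l)).

Definition box (a b : nat) : seq nat := if b == 0 then [::] else nseq a b.

Definition padd (m n : seq nat) : seq nat :=
  [seq nth 0 m i + nth 0 n i | i <- iota 0 (maxn (size m) (size n))].

Definition pjoin (m n : seq nat) : seq nat := sort geq (m ++ n).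

Definition plen (l : seq nat) : nat := size l.
Definition pfirst (l : seq nat) : nat := nth 0 l 0.

Definition psize (l : seq nat) : nat := sumn l.

Definition schubert_problem (a b : nat) (ls : seq (seq nat)) : bool :=
  all (fun l => is_partition l && subp l (box a b)) ls
  && (sumn (map psize ls) == a * b).

(** * Schur polynomials in N variables, as coefficient functions on monomials
    (a monomial x^m is an exponent vector m : seq nat of size N). *)

Fixpoint seqs_below (len N : nat) : seq (seq nat) :=
  match len with
  | 0 => [:: [::]]
  | l.+1 => [seq x :: t | x <- iota 0 N, t <- seqs_below l N]
  end.

Fixpoint fillings (sh : seq nat) (N : nat) : seq (seq (seq nat)) :=
  match sh with
  | [::] => [:: [::]]
  | r :: sh' => [seq x :: t | x <- seqs_below r N, t <- fillings sh' N]
  end.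

Definition is_ssyt (T : seq (seq nat)) : bool :=
  all (sorted leq) T &&
  all (fun i => all (fun j => nth 0 (nth [::] T i) j < nth 0 (nth [::] T i.+1) j)
                    (iota 0 (size (nth [::] T i.+1))))
      (iota 0 (size T).-1).

Definition content (N : nat) (T : seq (seq nat)) : seq nat :=
  [seq count_mem i (flatten T) | i <- iota 0 N].

Definition kostka (N : nat) (l m : seq nat) : nat :=
  count (fun T => is_ssyt T && (content N T == m)) (fillings l N).

Definition poly := seq nat -> int.

Definition schur (N : nat) (l : seq nat) : poly := fun m => Posz (kostka N l m).

Fixpoint subvecs (m : seq nat) : seq (seq nat) :=
  match m with
  | [::] => [:: [::]]
  | x :: m' => [seq y :: t | y <- iota 0 x.+1, t <- subvecs m']
  end.

Definition vsub (m m1 : seq nat) : seq nat := [seq x.1 - x.2 | x <- zip m m1].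

Definition polymul (f g : poly) : poly :=
  fun m => (\sum_(m1 <- subvecs m) f m1 * g (vsub m m1))%R.

Definition poly1 : poly := fun m => if all (fun x => x == 0) m then 1%R else 0%R.

Definition polyprod (fs : seq poly) : poly := foldr polymul poly1 fs.

Fixpoint comps_f (fuel n : nat) : seq (seq nat) :=
  if n == 0 then [:: [::]] else
  match fuel with
  | 0 => [::]
  | f.+1 => flatten [seq [seq i :: t | t <- comps_f f (n - i)] | i <- iota 1 n]
  end.
Definition partitions_of (k : nat) : seq (seq nat) :=
  filter is_partition (comps_f k k).

Definition schur_expansion (N k : nat) (F : poly) (c : seq nat -> int) : Prop :=
  forall m, size m = N ->
    F m = (\sum_(nu <- partitions_of k) c nu * Posz (kostka N nu m))%R.

(** delta(ls) for a Schubert problem on G(a,b): coefficient of S_{Box_{a,b}}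
    in S_{l^1} ... S_{l^r}, computed with N = a*b >= degree variables
    (so the Schur polynomials of degree a*b are linearly independent). *)
Definition delta (a b : nat) (ls : seq (seq nat)) : int :=
  let N := a * b in
  epsilon (inhabits 0%R)
    (fun d => exists c, schur_expansion N (sumn (map psize ls))
                          (polyprod [seq schur N l | l <- ls]) c
                        /\ c (box a b) = d).

Definition compose (c d : nat) (as_ bs : seq nat) (mu nu alpha beta gamma : seq (seq nat))
  : seq (seq nat) :=
  [seq pjoin (padd (box x.1.1 d) x.1.2) x.2 | x <- zip (zip as_ mu) alpha]
  ++ [seq padd (pjoin (box c x.1.1) x.1.2) x.2 | x <- zip (zip bs nu) beta]
  ++ gamma.

Definition composable (a b : nat) (lam mu nu : seq (seq nat)) (as_ bs : seq nat) : Prop :=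
  perm_eq lam (mu ++ nu) /\
  size as_ = size mu /\ size bs = size nu /\
  sumn as_ = a /\ sumn bs = b /\
  (forall i, i < size mu -> plen (nth [::] mu i) <= nth 0 as_ i) /\
  (forall j, j < size nu -> pfirst (nth [::] nu j) <= nth 0 bs j).

(* Main.v *)
Require Import Defs.
From HB Require Import structures.
From mathcomp Require Import all_boot all_order all_algebra.
From mathcomp Require Import zify ring.
From Stdlib Require Import ClassicalEpsilon.

Set Implicit Arguments. Unset Strict Implicit. Unset Printing Implicit Defensive.
Import Order.TTheory GRing.Theory Num.Theory.

(** Schubert classes of the Grassmannian [G(M, M)], for [M] large, form a free abelian group
    on the partitions contained in the [M] by [M] square.  The operators adding horizontal
    strips commute, and the class of the empty partition generates the group under them;
    hence there is a unique commutative product for which they are multiplications (the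
    Pieri rule), and every identity between classes can be proved by induction along these
    operators.  In this way conjugation of partitions is a ring automorphism, coefficients
    in a box satisfy Poincaré duality, and the expansion into Schur polynomials is
    multiplicative.

    Split the variables into [x] ([d] of them) and [y].  The part of [s_l(x, y)] of highest
    degree in [x] is [s_top(x) s_rest(y)], where [top] is the first [d] rows of [l]; so the
    extremal coefficients of a product of Schubert classes factor.

    Apply duality in the [a + c] by [b + d] box to the product of the conditions built from
    [mu, alpha] and the product of those built from [nu, beta, gamma].  Dominance shows that
    only partitions [l] consisting of the [a] by [d] rectangle, a partition [m] to its right
    and a partition [k] below it contribute.  For these, both coefficients are extremal (for
    the columns of the first product and the rows of the second) and factor, and the sum
    over [m] and [k] is the product of the dual expressions of the two intersection
    numbers. *)

(** * Finite sums *)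

Lemma reindex_bij_in (R : Type) (idx : R) (op : Monoid.com_law idx) (I J : finType)
    (P : pred I) (Q : pred J) (f : I -> J) (g : J -> I) (F : I -> R) (G : J -> R) :
    (forall i, P i -> Q (f i) /\ g (f i) = i) ->
    (forall j, Q j -> P (g j) /\ f (g j) = j) ->
    (forall i, P i -> F i = G (f i)) ->
  \big[op/idx]_(i | P i) F i = \big[op/idx]_(j | Q j) G j.
Proof.
move=> fP gQ FG; rewrite (reindex_onto g f) => [|i /fP[] //].
have gP j : P (g j) && (f (g j) == j) = Q j.
  apply/andP/idP => [[/fP[Qfg _] /eqP fgj]|/gQ[Pg ->] //]; by rewrite fgj in Qfg.
by apply: eq_big => [j|j /andP[Pg /eqP fgj]]; rewrite ?gP // FG // fgj.
Qed.

Arguments reindex_bij_in {R idx op I J P Q} f g {F G}.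

Lemma leq_sum_ord n m (f : nat -> nat) :
  n <= m -> \sum_(i < n) f i <= \sum_(i < m) f i.
Proof.
by move=> le_nm; rewrite (big_ord_widen m f le_nm) [leqRHS](bigID (fun i : 'I_m => i < n)) leq_addr.
Qed.

Lemma leq_sum_support n m (f : nat -> nat) :
  (forall i, n <= i -> f i = 0) -> \sum_(i < m) f i <= \sum_(i < n) f i.
Proof.
move=> f0; have [/leq_sum_ord // | /ltnW le_nm] := leqP m n.
rewrite [leqRHS](big_ord_widen m f le_nm) (bigID (fun i : 'I_m => i < n)) /=.
by rewrite [X in _ + X]big1 ?addn0 // => i; rewrite -leqNgt => /f0.
Qed.

Lemma eq_sum_support n m (f : nat -> nat) :
  (forall i, n <= i -> f i = 0) -> (forall i, m <= i -> f i = 0) ->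
  \sum_(i < n) f i = \sum_(i < m) f i.
Proof. by move=> fn fm; apply/eqP; rewrite eqn_leq !leq_sum_support. Qed.

Lemma sum_ord_recl n (f : nat -> nat) :
  \sum_(i < n.+1) f i = f 0 + \sum_(i < n) f i.+1.
Proof. by rewrite big_ord_recl; congr (_ + _); apply: eq_bigr. Qed.

Lemma mul_sum_ord n k : n * k = \sum_(i < n) k.
Proof. by rewrite sum_nat_const card_ord. Qed.

Lemma eq_from_leq_sum (I : finType) (f g : I -> nat) :
  (forall i, f i <= g i) -> \sum_i f i = \sum_i g i -> f =1 g.
Proof.
move=> le_fg /eqP sum_eq i.
have [_] := @leqif_sum I xpredT _ f g (fun j _ => leqif_eq (le_fg j)).
by rewrite sum_eq => /esym/forallP/(_ i)/eqP.
Qed.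

Lemma leq_big_seq (I : eqType) (s : seq I) (f : I -> nat) i :
  i \in s -> f i <= \sum_(j <- s) f j.
Proof. by move=> s_i; rewrite (big_rem _ s_i) leq_addr. Qed.

Lemma sum_nat_distr (I : Type) (s : seq I) (f g : I -> nat) k :
  \sum_(i <- s) (f i + k * g i) = \sum_(i <- s) f i + k * \sum_(i <- s) g i.
Proof. by rewrite big_split big_distrr. Qed.

Lemma sum_ltn x n : \sum_(i < n) (i < x) = minn x n.
Proof.
elim: n => [|n IHn]; first by rewrite big_ord0 minn0.
by rewrite big_ord_recr /= IHn; lia.
Qed.

Lemma eq_ltn (x y : nat) : (forall i, (i < x) = (i < y)) -> x = y.
Proof. by move=> eq_xy; have := eq_xy x; have := eq_xy y; rewrite !ltnn; lia. Qed.

Lemma nonincr_leq (f : nat -> nat) :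
  (forall i, f i.+1 <= f i) -> {homo f : i j / i <= j >-> j <= i}.
Proof. by apply: homo_leq => // y x z xy yz; apply: leq_trans yz xy. Qed.

(** * Partitions in a square *)

Section Partitions.
Variable M : nat.

Record ptn := Ptn {
  ptn_val : {ffun 'I_M -> 'I_M.+1};
  _ : [forall i : 'I_M, forall j : 'I_M, (i <= j) ==> (ptn_val j <= ptn_val i)] }.

HB.instance Definition _ := [isSub for ptn_val].
HB.instance Definition _ := [Finite of ptn by <:].

Definition prow (l : ptn) (i : nat) : nat :=
  if insub i is Some j then nat_of_ord (ptn_val l j) else 0.
Coercion prow : ptn >-> Funclass.

Implicit Types l m n : ptn.

Lemma prow_out l i : M <= i -> l i = 0.
Proof. by move=> le_Mi; rewrite /prow insubN // -leqNgt. Qed.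

Lemma prow_max l i : l i <= M.
Proof. by rewrite /prow; case: insub => // j; rewrite -ltnS ltn_ord. Qed.

Lemma prow_leq l : {homo l : i j / i <= j >-> j <= i}.
Proof.
move=> i j le_ij; case: (leqP M j) => [/prow_out-> //|lt_jM].
have lt_iM: i < M by exact: leq_ltn_trans lt_jM.
rewrite /prow !insubT; case: l => f /= /forallP/(_ (Ordinal lt_iM)).
by move=> /forallP/(_ (Ordinal lt_jM))/implyP; exact.
Qed.

Lemma prowS l i : l i.+1 <= l i.
Proof. exact: prow_leq. Qed.

Lemma ptnP l m : (forall i, i < M -> l i = m i) -> l = m.
Proof.
move=> eq_lm; apply: val_inj; apply/ffunP => i; apply: val_inj => /=.
by have := eq_lm i (ltn_ord i); rewrite /prow valK.
Qed.

Fact ptn0_subproof (zero := [ffun=> ord0] : {ffun 'I_M -> 'I_M.+1}) :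
  [forall i : 'I_M, forall j : 'I_M, (i <= j) ==> (zero j <= zero i)].
Proof. by apply/forallP => i; apply/forallP => j; rewrite !ffunE implybT. Qed.

Definition ptn0 : ptn := Ptn ptn0_subproof.

Lemma ptn0E i : ptn0 i = 0.
Proof. by rewrite /prow; case: insub => //= j; rewrite ffunE. Qed.

(* Junk value [ptn0] when [f] is not a partition contained in the square. *)
Definition mkptn (f : nat -> nat) : ptn :=
  insubd ptn0 ([ffun i : 'I_M => inord (f i)] : {ffun 'I_M -> 'I_M.+1}).

Definition fits_square (f : nat -> nat) :=
  [/\ forall i, f i.+1 <= f i, f 0 <= M & f M = 0].

Lemma mkptnE (f : nat -> nat) : fits_square f -> mkptn f =1 f.
Proof.
case=> /nonincr_leq f_leq f0 fM i; case: (leqP M i) => [le_Mi|lt_iM].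
  by rewrite prow_out //; have := f_leq _ _ le_Mi; rewrite fM leqn0 => /eqP.
have f_lt k : f k < M.+1 by rewrite ltnS; apply: leq_trans f0; exact: f_leq.
rewrite /prow insubT /mkptn /insubd insubT /=.
  by apply/forallP => j; apply/forallP => k; apply/implyP => ?;
     rewrite !ffunE !inordK //; exact: f_leq.
by move=> ?; rewrite ffunE inordK.
Qed.

Definition weight l : nat := \sum_(i < M) l i.

Lemma weight_widen l k : M <= k -> weight l = \sum_(i < k) l i.
Proof. by move=> le_Mk; apply: eq_sum_support => i ?; apply: prow_out; lia. Qed.

Lemma weight0 : weight ptn0 = 0.
Proof. by rewrite /weight big1 // => i _; rewrite ptn0E. Qed.

Lemma leq_weight n m : (forall i, m i <= n i) -> weight m <= weight n.
Proof. by move=> le_mn; apply: leq_sum => i _. Qed.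

Lemma eq_from_weight m n : (forall i, m i <= n i) -> weight m = weight n -> m = n.
Proof.
move=> le_mn eq_mn; apply: ptnP => i lt_iM.
exact: (eq_from_leq_sum (fun j : 'I_M => le_mn j) eq_mn (Ordinal lt_iM)).
Qed.

Definition take_rows d l : ptn := mkptn (fun i => if i < d then l i else 0).
Definition drop_rows d l : ptn := mkptn (fun i => l (d + i)).
Definition head_weight d l : nat := \sum_(i < d) l i.

Lemma take_rowsE d l i : take_rows d l i = if i < d then l i else 0.
Proof.
apply: mkptnE; split=> [j||]; first by have := prowS l j; case: ifP; case: ifP; lia.
  by case: ifP => // _; exact: prow_max.
by rewrite prow_out ?if_same.
Qed.

Lemma drop_rowsE d l i : drop_rows d l i = l (d + i).
Proof.
apply: mkptnE; split=> [j||]; first by rewrite addnS prowS.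
  exact: prow_max.
by rewrite prow_out ?leq_addl.
Qed.

Lemma eq_take_rows d l m : (forall i, i < d -> l i = m i) -> take_rows d l = take_rows d m.
Proof.
move=> eq_lm; apply: ptnP => i _; rewrite (take_rowsE d l) (take_rowsE d m).
by case: ifP => // /eq_lm.
Qed.

Definition stack d l m : ptn := mkptn (fun i => if i < d then l i else m (i - d)).

Lemma stackE d l m : (forall i, i < d -> m 0 <= l i) -> m (M - d) = 0 ->
  forall i, stack d l m i = if i < d then l i else m (i - d).
Proof.
move=> le_ml m_out; apply: mkptnE; split=> [i||].
- case: (ltnP i d) => [lt_id|le_di]; last by rewrite ifN ?subSn ?prowS // -leqNgt ltnW.
  by case: ltnP => _; [exact: prowS | exact: leq_trans (prow_leq m (leq0n _)) (le_ml i lt_id)].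
- by case: ifP => _; exact: prow_max.
by case: ifP => // _; exact: prow_out.
Qed.

Lemma take_stack d l m : (forall i, i < d -> m 0 <= l i) -> m (M - d) = 0 ->
  take_rows d (stack d l m) = take_rows d l.
Proof.
by move=> le_ml m_out; apply: eq_take_rows => i lt_id; rewrite (stackE le_ml m_out) lt_id.
Qed.

Lemma drop_stack d l m : (forall i, i < d -> m 0 <= l i) -> m (M - d) = 0 ->
  drop_rows d (stack d l m) = m.
Proof.
move=> le_ml m_out; apply: ptnP => i _.
by rewrite drop_rowsE (stackE le_ml m_out) ltnNge leq_addr addKn.
Qed.

Lemma eq_from_rows d l n :
  take_rows d l = take_rows d n -> drop_rows d l = drop_rows d n -> l = n.
Proof.
move=> eq_take eq_drop; apply: ptnP => i _; case: (ltnP i d) => [lt_id|le_di].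
  by have := take_rowsE d l i; rewrite eq_take take_rowsE lt_id.
by rewrite -(subnKC le_di) -!drop_rowsE eq_drop.
Qed.

Lemma weight_short d l : l d = 0 -> weight l = head_weight d l.
Proof.
move=> short_l; apply: eq_sum_support => i; first exact: prow_out.
by move/(prow_leq l); lia.
Qed.

Lemma weight_take d l : weight (take_rows d l) = head_weight d l.
Proof.
rewrite (@weight_short d) ?take_rowsE ?ltnn //; apply: eq_bigr => i _.
by rewrite take_rowsE ltn_ord.
Qed.

Lemma weight_split d l : weight l = head_weight d l + weight (drop_rows d l).
Proof.
rewrite (@weight_widen l (d + M)) ?leq_addl // big_split_ord /=; congr (_ + _).
by apply: eq_bigr => i _; rewrite drop_rowsE.
Qed.

Lemma weight_recl l : weight l = l 0 + weight (drop_rows 1 l).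
Proof. by rewrite (weight_split 1) /head_weight big_ord1. Qed.

Lemma prow0_leq_weight l : l 0 <= weight l.
Proof. by rewrite weight_recl leq_addr. Qed.

Lemma prow0_eq0 l : l 0 = 0 -> l = ptn0.
Proof. by move=> l0; apply: ptnP => i _; rewrite ptn0E; have := prow_leq l (leq0n i); lia. Qed.

Lemma weight_eq0 l : weight l = 0 -> l = ptn0.
Proof. by move=> l0; apply: prow0_eq0; have := prow0_leq_weight l; lia. Qed.

(** * Horizontal and vertical strips *)

Definition hstrip n m : bool :=
  [forall i : 'I_M, (n i.+1 <= m i) && (m i <= n i)].
Definition vstrip n m : bool :=
  [forall i : 'I_M, (m i <= n i) && (n i <= (m i).+1)].

Lemma hstripP n m : reflect (forall i, n i.+1 <= m i <= n i) (hstrip n m).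
Proof.
apply: (iffP forallP) => [strip i|strip i]; last exact: strip.
case: (ltnP i M) => [lt_iM|le_Mi]; first exact: (strip (Ordinal lt_iM)).
by rewrite !prow_out // ltnW.
Qed.

Lemma vstripP n m : reflect (forall i, m i <= n i <= (m i).+1) (vstrip n m).
Proof.
apply: (iffP forallP) => [strip i|strip i]; last exact: strip.
case: (ltnP i M) => [lt_iM|le_Mi]; first exact: (strip (Ordinal lt_iM)).
by rewrite !prow_out.
Qed.

Lemma hstrip_sub n m : hstrip n m -> forall i, m i <= n i.
Proof. by move=> /hstripP strip i; case/andP: (strip i). Qed.

Lemma vstrip_sub n m : vstrip n m -> forall i, m i <= n i.
Proof. by move=> /vstripP strip i; case/andP: (strip i). Qed.

Lemma hstripxx n : hstrip n n.
Proof. by apply/hstripP => i; rewrite leqnn prowS. Qed.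

Lemma vstripxx n : vstrip n n.
Proof. by apply/vstripP => i; rewrite leqnn leqnSn. Qed.

Lemma hstrip_weight n m : hstrip n m -> weight m <= weight n.
Proof. by move/hstrip_sub/leq_weight. Qed.

Lemma vstrip_weight n m : vstrip n m -> weight m <= weight n.
Proof. by move/vstrip_sub/leq_weight. Qed.

Definition hstrip_by (k : nat) n m := hstrip n m && (weight n == weight m + k).
Definition vstrip_by (k : nat) n m := vstrip n m && (weight n == weight m + k).

Lemma hstrip_byP k n m :
  reflect (hstrip n m /\ weight n = weight m + k) (hstrip_by k n m).
Proof. by apply: (iffP andP) => -[strip /eqP weight_eq]. Qed.

Lemma vstrip_byP k n m :
  reflect (vstrip n m /\ weight n = weight m + k) (vstrip_by k n m).
Proof. by apply: (iffP andP) => -[strip /eqP weight_eq]. Qed.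

Lemma hstrip_by0 n m : hstrip_by 0 n m = (m == n).
Proof.
apply/hstrip_byP/eqP => [[strip]|->]; last by rewrite addn0; split; first exact: hstripxx.
by rewrite addn0 => /esym; apply/eq_from_weight/hstrip_sub.
Qed.

Lemma hstrip_drop1 l : hstrip l (drop_rows 1 l).
Proof. by apply/hstripP => i; rewrite drop_rowsE leqnn prowS. Qed.

Lemma hstrip_prow0 l m (k : nat) : hstrip l m -> weight l = weight m + k -> k <= l 0.
Proof.
move=> /hstripP strip weight_l; have : weight (drop_rows 1 l) <= weight m.
  by apply: leq_weight => i; rewrite drop_rowsE; case/andP: (strip i).
by have := weight_recl l; lia.
Qed.

Lemma hstrip_full l m : hstrip l m -> weight l = weight m + l 0 -> m = drop_rows 1 l.
Proof.
move=> /hstripP strip weight_l; apply/esym/eq_from_weight; last by have := weight_recl l; lia.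
by move=> i; rewrite drop_rowsE; case/andP: (strip i).
Qed.

(** * Conjugate partitions *)

Definition conj_fun l (j : nat) : nat := find (fun i => l i <= j) (iota 0 M).
Definition conj l : ptn := mkptn (conj_fun l).

Lemma ltn_conj_fun l i j : (i < conj_fun l j) = (j < l i).
Proof.
have le_M : conj_fun l j <= M by rewrite -[leqRHS](size_iota 0) find_size.
apply/idP/idP => [lt_i|lt_j].
  have lt_iM := leq_trans lt_i le_M.
  by have := before_find 0 lt_i; rewrite nth_iota // add0n ltnNge => ->.
have lt_iM : i < M.
  by rewrite ltnNge; apply/negP => /(prow_out l) li0; rewrite li0 in lt_j.
rewrite ltnNge; apply/negP => le_i.
have : has (fun i => l i <= j) (iota 0 M).
  by rewrite has_find size_iota; exact: leq_ltn_trans le_i lt_iM.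
move/(nth_find 0); rewrite nth_iota ?add0n; last exact: leq_ltn_trans le_i lt_iM.
by rewrite leqNgt (leq_trans lt_j) // prow_leq.
Qed.

Lemma ltn_conj l i j : (i < conj l j) = (j < l i).
Proof.
rewrite /conj mkptnE ?ltn_conj_fun //; split=> [k||].
- rewrite leqNgt ltn_conj_fun -leqNgt; apply: ltnW; rewrite ltnNge -ltn_conj_fun.
  by rewrite ltnn.
- by rewrite leqNgt ltn_conj_fun (prow_out l (leqnn M)).
- by apply/eqP; rewrite -leqn0 leqNgt ltn_conj_fun -leqNgt prow_max.
Qed.

Lemma leq_conj l i j : (conj l j <= i) = (l i <= j).
Proof. by rewrite leqNgt ltn_conj -leqNgt. Qed.

Lemma conjK : involutive conj.
Proof. by move=> l; apply: ptnP => i _; apply: eq_ltn => j; rewrite !ltn_conj. Qed.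

Lemma head_weight_conj l t : head_weight t (conj l) = \sum_(j < M) minn (l j) t.
Proof.
transitivity (\sum_(i < t) \sum_(j < M) (j < conj l i)).
  by apply: eq_bigr => i _; rewrite sum_ltn (minn_idPl (prow_max _ _)).
rewrite exchange_big /=; apply: eq_bigr => j _.
by rewrite -sum_ltn; apply: eq_bigr => i _; rewrite ltn_conj.
Qed.

Lemma weight_conj l : weight (conj l) = weight l.
Proof.
rewrite [LHS]head_weight_conj; apply: eq_bigr => j _; exact/minn_idPl/prow_max.
Qed.

Lemma conj0 : conj ptn0 = ptn0.
Proof. by apply: weight_eq0; rewrite weight_conj weight0. Qed.

Lemma conj_eq0 l e : (conj l e == 0) = (l 0 <= e).
Proof. by rewrite -leqn0 leq_conj. Qed.

Lemma hstrip_conj n m : hstrip (conj n) (conj m) = vstrip n m.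
Proof.
apply/hstripP/vstripP => strip i; apply/andP; split.
- by rewrite -leq_conj; have /andP[_ /leq_trans] := strip (n i); apply; rewrite leq_conj.
- by rewrite -leq_conj; have /andP[/leq_trans + _] := strip (m i); apply; rewrite leq_conj.
- rewrite leq_conj; have /andP[_ /leq_trans] := strip (conj m i); apply.
  by rewrite ltnS -leq_conj.
rewrite leq_conj; have /andP[/leq_trans + _] := strip (conj n i); apply.
by rewrite -leq_conj.
Qed.

Lemma hstrip_by_conj k n m : hstrip_by k (conj n) (conj m) = vstrip_by k n m.
Proof. by rewrite /hstrip_by hstrip_conj !weight_conj. Qed.

End Partitions.
Arguments ptn0 {M}.
Global Opaque mkptn take_rows drop_rows stack conj.

(** * Pieri operators *)

Section PieriOperators.
Variable M : nat.
Local Notation P := (ptn M).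
Implicit Types (l m n q : P).

(* The free abelian group on the Schubert classes of G(M, M), which becomes the cohomology
   ring below. *)
Definition schubert_ring : Type := {ffun P -> int}.
HB.instance Definition _ := GRing.Zmodule.copy schubert_ring {ffun P -> int}.
Local Notation R := schubert_ring.
Implicit Types (u v : R).

Definition sigma l : R := [ffun m => (m == l)%:R%R].

Definition hpieri (k : nat) u : R := [ffun n => (\sum_(m | hstrip_by k n m) u m)%R].
Definition vpieri (k : nat) u : R := [ffun n => (\sum_(m | vstrip_by k n m) u m)%R].
Definition hskew (k : nat) u : R := [ffun m => (\sum_(n | hstrip_by k n m) u n)%R].

Definition schubert_coef n u : int := u n.
Fact schubert_coef_is_zmod_morphism n : zmod_morphism (schubert_coef n).
Proof. by move=> u v; rewrite /schubert_coef !ffunE. Qed.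
HB.instance Definition _ n :=
  GRing.isZmodMorphism.Build R int (schubert_coef n) (schubert_coef_is_zmod_morphism n).

Lemma schubert_coefB u v n : ((u - v) n = u n - v n)%R.
Proof. exact: (raddfB (schubert_coef n)). Qed.

Lemma schubert_coefMz u (c : int) n : (u *~ c)%R n = (u n * c)%R.
Proof. by rewrite -mulrzz; exact: (raddfMz (schubert_coef n)). Qed.

Lemma schubert_coef_sum (I : Type) (s : seq I) (Q : pred I) (f : I -> R) n :
  ((\sum_(i <- s | Q i) f i) n = \sum_(i <- s | Q i) f i n)%R.
Proof. exact: (raddf_sum (schubert_coef n)). Qed.

Fact hpieri_is_zmod_morphism k : zmod_morphism (hpieri k).
Proof.
move=> u v; apply/ffunP => n; rewrite schubert_coefB !ffunE -sumrB.
by apply: eq_bigr => m _; rewrite schubert_coefB.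
Qed.
HB.instance Definition _ k :=
  GRing.isZmodMorphism.Build R R (hpieri k) (hpieri_is_zmod_morphism k).

Fact vpieri_is_zmod_morphism k : zmod_morphism (vpieri k).
Proof.
move=> u v; apply/ffunP => n; rewrite schubert_coefB !ffunE -sumrB.
by apply: eq_bigr => m _; rewrite schubert_coefB.
Qed.
HB.instance Definition _ k :=
  GRing.isZmodMorphism.Build R R (vpieri k) (vpieri_is_zmod_morphism k).

Lemma sigma_expand u : u = (\sum_l sigma l *~ u l)%R.
Proof.
apply/ffunP => n; rewrite schubert_coef_sum (bigD1 n) //= big1 ?addr0 => [|l ne_ln].
  by rewrite schubert_coefMz ffunE eqxx mul1r.
by rewrite schubert_coefMz ffunE eq_sym (negPf ne_ln) mul0r.
Qed.

Lemma sum_sigma (Q : pred P) n : ((\sum_(l | Q l) sigma l) n = (Q n)%:R)%R.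
Proof.
rewrite schubert_coef_sum big_mkcond (bigD1 n) //= big1 ?addr0 => [|l ne_ln].
  by rewrite ffunE eqxx; case: (Q n).
by rewrite ffunE eq_sym (negPf ne_ln) if_same.
Qed.

Lemma hpieri_sigma k m : (hpieri k (sigma m) = \sum_(n | hstrip_by k n m) sigma n)%R.
Proof.
apply/ffunP => n; rewrite sum_sigma ffunE; case: (boolP (hstrip_by k n m)) => strip.
  by rewrite (bigD1 m) //= ffunE eqxx big1 ?addr0 // => l /andP[_ ne]; rewrite ffunE (negPf ne).
rewrite big1 // => l strip_l; rewrite ffunE; case: eqP => // eq_lm.
by rewrite -eq_lm strip_l in strip.
Qed.

Lemma hpieri0 u : hpieri 0 u = u.
Proof. by apply/ffunP => n; rewrite ffunE (big_pred1 n) // => m; exact: hstrip_by0. Qed.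

(* The partitions between [n] and [q] form a product of intervals; reversing
   each interval exchanges the two strip sizes. *)
Definition interlace_lo n q (i : nat) : nat := maxn (q i) (n i.+1).
Definition interlace_hi n q (i : nat) : nat := if i is j.+1 then minn (q j) (n i) else n 0.
Definition reflect_ptn n q m : P :=
  mkptn M (fun i => interlace_lo n q i + interlace_hi n q i - m i).

Lemma interlaceP n q m :
  reflect (forall i, interlace_lo n q i <= m i <= interlace_hi n q i)
          (hstrip n m && hstrip m q).
Proof.
apply: (iffP andP) => [[/hstripP strip_nm /hstripP strip_mq] i|bounds].
  by rewrite /interlace_lo /interlace_hi; have := strip_nm i; have := strip_mq i;
     case: i => [|i]; last have := strip_mq i; lia.
split; apply/hstripP => i; have := bounds i; have := bounds i.+1;
  by rewrite /interlace_lo /interlace_hi; case: i => [|i]; lia.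
Qed.

Lemma interlace_hi_leq n q i : interlace_hi n q i <= n i.
Proof. by case: i => //= i; exact: geq_minr. Qed.

Lemma interlace_hi_out n q : interlace_hi n q M = 0.
Proof. by have := interlace_hi_leq n q M; rewrite (prow_out n (leqnn M)); lia. Qed.

Lemma sum_interlace n q :
  \sum_(i < M) (interlace_lo n q i + interlace_hi n q i) = weight n + weight q.
Proof.
have hi_widen : \sum_(i < M) interlace_hi n q i = \sum_(i < M.+1) interlace_hi n q i.
  by rewrite big_ord_recr /= interlace_hi_out addn0.
rewrite big_split /= hi_widen sum_ord_recl addnCA -big_split (@weight_widen _ n M.+1) //.
rewrite sum_ord_recl -addnA; congr (_ + _).
by rewrite /weight -big_split; apply: eq_bigr => i _; rewrite /interlace_lo /=; lia.
Qed.

Lemma reflect_ptnE n q m : hstrip n m -> hstrip m q ->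
  forall i, reflect_ptn n q m i = interlace_lo n q i + interlace_hi n q i - m i.
Proof.
move=> strip_nm strip_mq; have /interlaceP bounds : hstrip n m && hstrip m q by rewrite strip_nm.
apply: mkptnE; split=> [i||].
- have := bounds i; have := bounds i.+1; rewrite /interlace_hi /= /interlace_lo; lia.
- by have := bounds 0; rewrite /interlace_hi; have := prow_max n 0; lia.
by have := bounds M; rewrite interlace_hi_out; lia.
Qed.

Lemma reflect_ptn_hstrip n q m : hstrip n m -> hstrip m q ->
  hstrip n (reflect_ptn n q m) && hstrip (reflect_ptn n q m) q.
Proof.
move=> strip_nm strip_mq; have /interlaceP bounds : hstrip n m && hstrip m q by rewrite strip_nm.
by apply/interlaceP => i; rewrite reflect_ptnE //; have := bounds i; lia.
Qed.

Lemma weight_reflect_ptn n q m : hstrip n m -> hstrip m q ->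
  weight (reflect_ptn n q m) + weight m = weight n + weight q.
Proof.
move=> strip_nm strip_mq; have /interlaceP bounds : hstrip n m && hstrip m q by rewrite strip_nm.
rewrite -(sum_interlace n q) /weight -big_split /=; apply: eq_bigr => i _.
by rewrite reflect_ptnE //; have := bounds i; lia.
Qed.

Lemma reflect_ptnK n q m : hstrip n m -> hstrip m q ->
  reflect_ptn n q (reflect_ptn n q m) = m.
Proof.
move=> strip_nm strip_mq; have /interlaceP bounds : hstrip n m && hstrip m q by rewrite strip_nm.
have /andP[strip_nr rk] := reflect_ptn_hstrip strip_nm strip_mq.
by apply: ptnP => i _; rewrite !reflect_ptnE //; have := bounds i; lia.
Qed.

Lemma hpieriC i j u : hpieri i (hpieri j u) = hpieri j (hpieri i u).
Proof.
apply/ffunP => n; rewrite !ffunE.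
under eq_bigr => m _ do rewrite ffunE; under [RHS]eq_bigr => m _ do rewrite ffunE.
rewrite (exchange_big_dep xpredT) //= [RHS](exchange_big_dep xpredT) //=.
apply: eq_bigr => q _.
have reflectP i' j' m : hstrip_by i' n m && hstrip_by j' m q ->
    (hstrip_by j' n (reflect_ptn n q m) && hstrip_by i' (reflect_ptn n q m) q)
    /\ reflect_ptn n q (reflect_ptn n q m) = m.
  move=> /andP[/hstrip_byP[strip_nm weight_n] /hstrip_byP[strip_mq weight_m]].
  rewrite reflect_ptnK // /hstrip_by; have /andP[-> ->] := reflect_ptn_hstrip strip_nm strip_mq.
  by have := weight_reflect_ptn strip_nm strip_mq; split=> //=; lia.
by apply: (reindex_bij_in (reflect_ptn n q) (reflect_ptn n q)) => m; auto.
Qed.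

(** * The Newton identity *)

Lemma last_differing_row n l : (forall i, l i <= n i) -> n != l ->
  exists i, l i < n i /\ n i.+1 = l i.+1.
Proof.
move=> le_ln ne_nl.
have differ : exists i, l i < n i.
  have [/existsP[i ?]|] := boolP [exists i : 'I_M, l i < n i]; first by exists i.
  rewrite negb_exists => /forallP eq_ln; case/eqP: ne_nl; apply: ptnP => i lt_iM.
  by apply/eqP; rewrite eqn_leq le_ln andbT leqNgt; exact: (eq_ln (Ordinal lt_iM)).
have bounded i : l i < n i -> i <= M.
  by case: (leqP i M) => // /ltnW/(prow_out n)->.
have [i lt_i i_max] := ex_maxnP differ bounded; exists i; split=> //.
apply/eqP; rewrite eqn_leq le_ln andbT leqNgt; apply/negP => /i_max.
by rewrite ltnn.
Qed.

Section ToggleRow.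
Variables (n l : P) (i : nat).
Hypotheses (lt_i : l i < n i) (eq_iS : n i.+1 = l i.+1).

Let lt_iM : i < M.
Proof. by rewrite ltnNge; apply/negP => /(prow_out n) ni; move: lt_i; rewrite ni. Qed.

Definition toggle_row m : P :=
  mkptn M (fun j => if j == i then (l i).*2.+1 - m i else m j).

Let pairs := [pred m | hstrip n m && vstrip m l].

Lemma toggle_rowE m : pairs m ->
  forall j, toggle_row m j = if j == i then (l i).*2.+1 - m i else m j.
Proof.
move=> /andP[/hstripP strip_nm /vstripP strip_ml]; apply: mkptnE; split=> [j||].
- have := strip_nm j; have := strip_nm j.+1; have := strip_ml j; have := strip_ml j.+1.
  have := prowS m j; have := prowS l j; have := strip_ml i; have := strip_nm i.
  move: lt_i eq_iS.
  by case: (j.+1 =P i) => [->|_]; case: (j =P i) => [->|_]; lia.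
- case: (0 =P i) => [_|_]; last exact: prow_max.
  by have := strip_ml i; have := prow_max n i; have := lt_i; lia.
by rewrite gtn_eqF // prow_out.
Qed.

Lemma toggle_row_pairs m : pairs m -> pairs (toggle_row m).
Proof.
move=> pairs_m; have toggleE := toggle_rowE pairs_m.
case/andP: pairs_m => /hstripP strip_nm /vstripP strip_ml.
apply/andP; split; [apply/hstripP|apply/vstripP] => j; rewrite toggleE;
  have := strip_nm j; have := strip_ml j; have := prowS l i; move: lt_i eq_iS;
  by case: (j =P i) => [->|_]; lia.
Qed.

Lemma toggle_rowK m : pairs m -> toggle_row (toggle_row m) = m.
Proof.
move=> pairs_m; apply: ptnP => j _; rewrite toggle_rowE ?toggle_row_pairs // !toggle_rowE // eqxx.
by case: (j =P i) => [->|//]; case/andP: pairs_m => _ /vstripP/(_ i); lia.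
Qed.

Lemma odd_weight_toggle_row m : pairs m -> odd (weight (toggle_row m)) = ~~ odd (weight m).
Proof.
move=> pairs_m; rewrite /weight (bigD1 (Ordinal lt_iM)) //=.
rewrite [in RHS](bigD1 (Ordinal lt_iM)) //= !oddD.
rewrite (eq_bigr (fun j : 'I_M => m j)) => [|j ne_ji]; last by rewrite toggle_rowE // ifN.
case/andP: (pairs_m) => _ /vstripP/(_ i) mi.
by rewrite toggle_rowE // eqxx -addNb; congr (_ (+) _); lia.
Qed.

End ToggleRow.

Lemma sum_sign_strips n l : n != l ->
  (\sum_(m | hstrip n m && vstrip m l) (-1) ^+ weight m = 0 :> int)%R.
Proof.
move=> ne_nl; case: (pickP [pred m | hstrip n m && vstrip m l]) => [m pairs_m|no_m]; last first.
  by rewrite big_pred0 // => m; exact: no_m.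
have le_ln i : l i <= n i.
  by case/andP: pairs_m => /hstrip_sub strip_nm /vstrip_sub strip_ml; exact: leq_trans (strip_nm i).
have [i [lt_i eq_iS]] := last_differing_row le_ln ne_nl.
set S := (X in X = 0%R); suff : S = (- S)%R by lia.
rewrite /S -sumrN; apply: (reindex_bij_in (toggle_row l i) (toggle_row l i)) => m' pairs_m'.
- by split; [exact: toggle_row_pairs | exact: (toggle_rowK lt_i eq_iS)].
- by split; [exact: toggle_row_pairs | exact: (toggle_rowK lt_i eq_iS)].
by rewrite -signr_odd -[in RHS]signr_odd (odd_weight_toggle_row lt_i eq_iS) //; case: odd.
Qed.

Lemma sum_hpieri_vpieri k u n :
  (\sum_(i < k.+1) hpieri (k - i) (vpieri i u) n * (-1) ^+ i
   = \sum_(l | weight n == weight l + k)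
       (\sum_(m | hstrip n m && vstrip m l) (-1) ^+ weight m) * ((-1) ^+ weight l * u l))%R.
Proof.
pose F m l : int := ((-1) ^+ weight m * ((-1) ^+ weight l * u l))%R.
transitivity (\sum_(i < k.+1) \sum_l
   \sum_(m | hstrip_by (k - i) n m && vstrip_by i m l) F m l)%R.
  apply: eq_bigr => i _; rewrite ffunE mulr_suml.
  under eq_bigr => m _ do rewrite ffunE mulr_suml.
  rewrite (exchange_big_dep xpredT) //=; apply: eq_bigr => l _; apply: eq_bigr => m.
  move=> /andP[_ /vstrip_byP[_ weight_m]]; rewrite /F weight_m mulrA -exprD addnAC addnn.
  by rewrite exprD -[((-1) ^+ _.*2)%R]signr_odd odd_double mul1r mulrC.
rewrite exchange_big big_mkcond [RHS]big_mkcond; apply: eq_bigr => l _ /=.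
have [weight_nl|ne_nl] := eqVneq; last first.
  rewrite big1 // => i _; rewrite big_pred0 // => m; apply/negP.
  move=> /andP[/hstrip_byP[_ weight_n] /vstrip_byP[_ weight_m]].
  by case/eqP: ne_nl; have := ltn_ord i; lia.
rewrite mulr_suml.
rewrite [RHS](partition_big (fun m => inord (weight m - weight l) : 'I_k.+1) xpredT) //=.
apply: eq_bigr => i _; apply: eq_bigl => m; rewrite /hstrip_by /vstrip_by.
case: (boolP (hstrip n m)) => //= strip_nm.
case: (boolP (vstrip m l)) => /=; rewrite ?andbF // => strip_ml.
have := hstrip_weight strip_nm; have := vstrip_weight strip_ml => le_lm le_mn.
by rewrite -val_eqE /= inordK; have := ltn_ord i; lia.
Qed.

Lemma newton k u :
  (\sum_(i < k.+1) hpieri (k - i) (vpieri i u) *~ (-1) ^+ i = if k == 0 then u else 0)%R.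
Proof.
apply/ffunP => n; rewrite schubert_coef_sum; under eq_bigr => i _ do rewrite schubert_coefMz.
rewrite sum_hpieri_vpieri big_mkcond (bigD1 n) //= [X in (_ + X)%R]big1 ?addr0 => [|l ne_ln].
  rewrite -[X in X == _]addn0 eqn_add2l eq_sym.
  case: eqP => _; last by rewrite ffunE.
  rewrite (big_pred1 n) => [|m]; first by rewrite mulrA -exprD addnn -signr_odd odd_double mul1r.
  apply/andP/eqP => [[/hstripP strip_nm /vstripP strip_mn]|->]; last by rewrite hstripxx vstripxx.
  by apply: ptnP => i _; have := strip_nm i; have := strip_mn i; lia.
by rewrite sum_sign_strips ?mul0r ?if_same // eq_sym.
Qed.

End PieriOperators.

(** * The local growth rule *)

Section LocalRule.
Variable M : nat.
Local Notation P := (ptn M).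
Local Notation R := (schubert_ring M).
Implicit Types (l m n q : P) (u v : R).

Lemma fits_square_sum (f : nat -> nat) :
  (forall i, f i.+1 <= f i) -> \sum_(i < M.+1) f i <= M -> fits_square M f.
Proof.
move=> f_dec sum_f; split=> //.
  by apply: leq_trans sum_f; rewrite big_ord_recl leq_addr.
apply/eqP; rewrite -leqn0 leqNgt; apply/negP => fM; move: sum_f; apply/negP.
rewrite -ltnNge -{1}(card_ord M.+1) -sum1_card; apply: leq_sum => i _.
by apply: leq_trans fM _; apply: nonincr_leq; rewrite // -ltnS.
Qed.

Definition meet_join l q (i : nat) : nat := maxn (l i.+1) (q i.+1) + minn (l i) (q i).

Definition local_up_fun l q (y : nat) m (i : nat) : nat :=
  if i is j.+1 then meet_join l q j - m j else maxn (l 0) (q 0) + y.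
Definition local_up l q y m : P := mkptn M (local_up_fun l q y m).
Definition local_down l q n : P := mkptn M (fun i => meet_join l q i - n i.+1).

Lemma hstrip_aboveP l q n :
  reflect (forall i, (maxn (l i) (q i) <= n i) && (n i.+1 <= minn (l i) (q i)))
          (hstrip n l && hstrip n q).
Proof.
apply: (iffP andP) => [[/hstripP strip_nl /hstripP strip_nq] i|bounds].
  by have := strip_nl i; have := strip_nq i; lia.
by split; apply/hstripP => i; have := bounds i; lia.
Qed.

Lemma hstrip_belowP l q m :
  reflect (forall i, maxn (l i.+1) (q i.+1) <= m i <= minn (l i) (q i))
          (hstrip l m && hstrip q m).
Proof.
apply: (iffP andP) => [[/hstripP strip_lm /hstripP strip_qm] i|bounds].
  by have := strip_lm i; have := strip_qm i; lia.
by split; apply/hstripP => i; have := bounds i; lia.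
Qed.

Lemma sum_meet_join l q :
  maxn (l 0) (q 0) + \sum_(i < M) meet_join l q i = weight l + weight q.
Proof.
rewrite big_split /= addnA -(sum_ord_recl M (fun i => maxn (l i) (q i))).
rewrite big_ord_recr /= !(prow_out _ (leqnn M)) addn0 /weight -!big_split /=.
by apply: eq_bigr => i _; lia.
Qed.

Section Up.
Variables (l q m : P) (y : nat).
Hypotheses (below : hstrip l m && hstrip q m) (fits : weight l + weight q + y <= weight m + M).

Let bounds := hstrip_belowP l q m below.

Let sum_local_up :
  \sum_(i < M.+1) local_up_fun l q y m i + weight m = weight l + weight q + y.
Proof.
rewrite sum_ord_recl /= -addnA -big_split -sum_meet_join [RHS]addnAC /=; congr (_ + _).
by apply: eq_bigr => i _; rewrite subnK // /meet_join; have := bounds i; lia.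
Qed.

Lemma local_upE i : local_up l q y m i = local_up_fun l q y m i.
Proof.
apply: mkptnE; apply: fits_square_sum => [{}i|]; last by have := sum_local_up; lia.
have := bounds i; rewrite /local_up_fun /meet_join; case: i => [|i]; first by lia.
by have := bounds i; lia.
Qed.

Lemma weight_local_up : weight (local_up l q y m) + weight m = weight l + weight q + y.
Proof.
rewrite -sum_local_up (@weight_widen _ _ M.+1) //; congr (_ + _).
by apply: eq_bigr => i _; rewrite local_upE.
Qed.

Lemma local_up_above : hstrip (local_up l q y m) l && hstrip (local_up l q y m) q.
Proof.
apply/hstrip_aboveP => i; rewrite !local_upE /= /meet_join; have := bounds i.
by case: i => [|i] /=; last have := bounds i; rewrite /meet_join; lia.
Qed.

End Up.

Section Down.
Variables (l q n : P).
Hypothesis above : hstrip n l && hstrip n q.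

Let bounds := hstrip_aboveP l q n above.

Lemma local_downE i : local_down l q n i = meet_join l q i - n i.+1.
Proof.
apply: mkptnE; rewrite /meet_join; split=> [{}i||].
- by have := bounds i; have := bounds i.+1; have := bounds i.+2; lia.
- by have := bounds 0; have := bounds 1; have := prow_max l 0; lia.
by have := prow_out l (leqnn M); have := prow_out l (leqnSn M);
   have := prow_out q (leqnSn M); lia.
Qed.

Lemma local_down_below : hstrip l (local_down l q n) && hstrip q (local_down l q n).
Proof.
apply/hstrip_belowP => i; rewrite local_downE /meet_join.
by have := bounds i; have := bounds i.+1; lia.
Qed.

Lemma weight_local_down :
  weight (local_down l q n) + weight n + maxn (l 0) (q 0) = weight l + weight q + n 0.
Proof.
rewrite -(sum_meet_join l q) (@weight_widen _ n M.+1) // sum_ord_recl.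
have -> : \sum_(i < M) meet_join l q i = weight (local_down l q n) + \sum_(i < M) n i.+1.
  rewrite /weight -big_split; apply: eq_bigr => i _ /=.
  by rewrite local_downE subnK // /meet_join; have := bounds i; have := bounds i.+1; lia.
by lia.
Qed.

End Down.

Lemma local_upK l q m y : hstrip l m && hstrip q m ->
  weight l + weight q + y <= weight m + M -> local_down l q (local_up l q y m) = m.
Proof.
move=> below fits; apply: ptnP => i _; rewrite local_downE ?local_up_above // local_upE //=.
by rewrite /meet_join; have /hstrip_belowP/(_ i) := below; lia.
Qed.

Lemma local_downK l q n (m := local_down l q n) :
  hstrip n l && hstrip n q -> weight l + weight q + (n 0 - maxn (l 0) (q 0)) <= weight m + M ->
  local_up l q (n 0 - maxn (l 0) (q 0)) m = n.
Proof.
move=> above fits; have bounds := hstrip_aboveP l q n above.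
apply: ptnP => -[|i] _; rewrite local_upE ?local_down_below //=.
  by have := bounds 0; lia.
by rewrite local_downE // /meet_join; have := bounds i; have := bounds i.+1; lia.
Qed.

Lemma hskew_hpieri_sum x k u q :
  hskew x (hpieri k u) q = (\sum_l \sum_(n | hstrip_by x n q && hstrip_by k n l) u l)%R.
Proof.
rewrite ffunE; under eq_bigr => n _ do rewrite ffunE.
by rewrite (exchange_big_dep xpredT).
Qed.

Lemma sum_hpieri_hskew x k u q :
  (\sum_(y < x.+1 | (y <= k)%N) hpieri (k - y) (hskew (x - y) u) q
   = \sum_l \sum_(m | [&& hstrip l m && hstrip q m, weight q + x == weight l + k
                         & weight q <= weight m + k]%N) u l)%R.
Proof.
under eq_bigr => y _ do [rewrite ffunE; under eq_bigr => m _ do rewrite ffunE].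
under eq_bigr => y _ do rewrite (exchange_big_dep xpredT) //=.
rewrite exchange_big; apply: eq_bigr => l _ /=; apply/esym.
pose y_of (m : P) : 'I_x.+1 := inord (k + weight m - weight q).
have y_of_val m : hstrip l m && hstrip q m -> weight q + x = weight l + k ->
    weight q <= weight m + k -> y_of m = k + weight m - weight q :> nat.
  move=> /andP[/hstrip_weight le_ml _] weight_qx le_q; rewrite /y_of inordK //; lia.
rewrite (partition_big y_of (fun y : 'I_x.+1 => y <= k)) /= => [|m]; last first.
  move=> /and3P[below /eqP weight_qx le_q].
  by rewrite y_of_val //; case/andP: below => _ /hstrip_weight; lia.
apply: eq_bigr => y le_yk; apply: eq_bigl => m; rewrite /hstrip_by -!andbA.
apply/and5P/and4P => [[strip_lm strip_qm]|[strip_qm]].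
  move=> /eqP weight_qx le_q /eqP y_eq.
  have := y_of_val m; rewrite strip_lm strip_qm y_eq => /(_ isT weight_qx le_q) y_val.
  by split=> //; apply/eqP; have := hstrip_weight strip_qm; have := ltn_ord y; lia.
move=> /eqP weight_q strip_lm /eqP weight_l.
have weight_qx : weight q + x = weight l + k by have := ltn_ord y; lia.
have le_q : weight q <= weight m + k by lia.
split=> //; first exact/eqP.
by apply/eqP/val_inj; rewrite /= y_of_val // ?strip_lm ?strip_qm //; lia.
Qed.

(* This commutation is the local growth rule of the Robinson-Schensted-Knuth
   correspondence: [y] is the growth of the first row. *)
Lemma hskew_hpieri x k u q : weight q + x <= M ->
  hskew x (hpieri k u) q
  = (\sum_(y < x.+1 | (y <= k)%N) hpieri (k - y) (hskew (x - y) u) q)%R.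
Proof.
move=> le_M; rewrite hskew_hpieri_sum sum_hpieri_hskew; apply: eq_bigr => l _.
apply: (reindex_bij_in (local_down l q) (fun m => local_up l q (k + weight m - weight q) m))
    => [n|m|//].
- move=> /andP[/hstrip_byP[strip_nq weight_q] /hstrip_byP[strip_nl weight_l]].
  have above : hstrip n l && hstrip n q by rewrite strip_nl.
  have weight_eq := weight_local_down above; have /hstrip_aboveP/(_ 0) := above => bound0.
  rewrite local_down_below //=; split; first by apply/andP; split; [apply/eqP|]; lia.
  rewrite (_ : _ - _ = n 0 - maxn (l 0) (q 0)); last by lia.
  by apply: local_downK => //; lia.
move=> /and3P[below /eqP weight_qx le_q].
have fits : weight l + weight q + (k + weight m - weight q) <= weight m + M.
  by case/andP: below => _ /hstrip_weight; lia.
have weight_eq := weight_local_up below fits.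
rewrite /hstrip_by; have /andP[-> ->] := local_up_above below fits; rewrite local_upK //.
by split=> //; apply/andP; split; apply/eqP; lia.
Qed.

End LocalRule.

(** * The cohomology ring *)

Section SchubertRing.
Variable M : nat.
Local Notation P := (ptn M).
Local Notation R := (schubert_ring M).
Implicit Types (l m n q : P) (u v w : R) (T S : R -> R).

Section PieriInduction.
Variable Q : R -> Prop.
Hypotheses (Q1 : Q (sigma ptn0)) (Q_hpieri : forall k u, Q u -> Q (hpieri k u)).
Hypothesis QB : forall u v, Q u -> Q v -> Q (u - v)%R.

Let Q0 : Q 0%R.
Proof. by rewrite -(subrr (sigma ptn0)); exact: QB. Qed.

Let QD u v : Q u -> Q v -> Q (u + v)%R.
Proof. by move=> Qu Qv; rewrite -[v]opprK -[(- v)%R]sub0r; do 2!apply: QB => //. Qed.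

Let Qmulz u (c : int) : Q u -> Q (u *~ c)%R.
Proof.
move=> Qu; elim/int_rect: c => [|k Qk|k Qk]; first by rewrite mulr0z.
  by rewrite -addn1 PoszD mulrzDr mulr1z; exact: QD.
by rewrite -addn1 PoszD opprD mulrzBr mulr1z; exact: QB.
Qed.

(* [hpieri (l 0)] applied to [l] without its first row is [l] plus partitions with a
   longer first row. *)
Lemma sigma_ind l : Q (sigma l).
Proof.
have Qsigma N D m : weight m = N -> weight m - m 0 = D -> Q (sigma m); last exact: Qsigma.
elim/ltn_ind: N D m => N IHN; elim/ltn_ind => D IHD {}l weight_lN gap_l.
have [/prow0_eq0 -> //|l0_gt0] := posnP (l 0).
have weight_l := weight_recl l; set m := drop_rows 1 l in weight_l.
have l_strip : hstrip_by (l 0) l m by apply/hstrip_byP; rewrite hstrip_drop1; split=> //; lia.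
have -> : sigma l = (hpieri (l 0%N) (sigma m)
    - \sum_(n | hstrip_by (l 0%N) n m && (n != l)) sigma n)%R.
  by rewrite hpieri_sigma (bigD1 l) //= addrK.
apply: QB; first by apply/Q_hpieri/(IHN (weight m)) => //; lia.
apply: (big_ind Q) => // n /andP[/hstrip_byP[strip weight_n] ne_nl].
have lt_l0 : l 0 < n 0.
  rewrite ltn_neqAle (hstrip_prow0 strip weight_n) andbT; apply: contra_neq ne_nl => eq_l0.
  have drop_n : m = drop_rows 1 n by apply: hstrip_full strip _; rewrite weight_n eq_l0.
  by apply: ptnP => -[|i] _ //; have := drop_rowsE 1 n i; rewrite -drop_n drop_rowsE => <-.
by apply: (IHD (weight n - n 0)) => //; have := prow0_leq_weight n; lia.
Qed.

Lemma pieri_ind u : Q u.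
Proof.
by rewrite (sigma_expand u); apply: (big_ind Q) => // l _; apply/Qmulz/sigma_ind.
Qed.

End PieriInduction.

Definition pieri_commutant T :=
  zmod_morphism T /\ forall k u, T (hpieri k u) = hpieri k (T u).

Lemma commutant_eq T S : pieri_commutant T -> pieri_commutant S ->
  T (sigma ptn0) = S (sigma ptn0) -> T =1 S.
Proof.
move=> [T_sub T_hpieri] [S_sub S_hpieri] eq0; apply: pieri_ind => // [k u eq_u|u v eq_u eq_v].
  by rewrite T_hpieri S_hpieri eq_u.
by rewrite T_sub S_sub eq_u eq_v.
Qed.

Lemma commutant_id : pieri_commutant id.
Proof. by []. Qed.

Lemma commutant_comp T S : pieri_commutant T -> pieri_commutant S -> pieri_commutant (T \o S).
Proof.
by move=> [T_sub T_hpieri] [S_sub S_hpieri]; split=> [u v|k u] /=; rewrite ?S_sub ?S_hpieri.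
Qed.

Lemma commutant_hpieri k : pieri_commutant (@hpieri M k).
Proof. by split=> [|j u]; [exact: raddfB | exact: hpieriC]. Qed.

Lemma commutant_sub T S : pieri_commutant T -> pieri_commutant S ->
  pieri_commutant (fun u => T u - S u)%R.
Proof.
move=> [T_sub T_hpieri] [S_sub S_hpieri]; split=> [u v|k u]; last first.
  by rewrite T_hpieri S_hpieri raddfB.
by rewrite T_sub S_sub !opprB [(S v - _)%R]addrC addrACA [(- T v + _)%R]addrC.
Qed.

Lemma vpieri_hpieriC j k u : vpieri j (hpieri k u) = hpieri k (vpieri j u).
Proof.
elim/ltn_ind: j => j IHj.
have : (\sum_(i < j.+1) hpieri (j - i) (vpieri i (hpieri k u)) *~ (-1) ^+ i
    = \sum_(i < j.+1) hpieri (j - i) (hpieri k (vpieri i u)) *~ (-1) ^+ i)%R.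
  rewrite newton; under eq_bigr => i _ do rewrite hpieriC -raddfMz.
  by rewrite -raddf_sum newton; case: (j == 0); rewrite ?raddf0.
rewrite !big_ord_recr /= subnn !hpieri0.
rewrite (eq_bigr (fun i : 'I_j => hpieri (j - i) (hpieri k (vpieri i u)) *~ (-1) ^+ i)%R) => [|i _].
  move/addrI/(congr1 (fun v => v *~ (-1) ^+ j)%R).
  by rewrite -!mulrzA -expr2 sqrr_sign !mulr1z.
by rewrite IHj.
Qed.

Lemma commutant_vpieri k : pieri_commutant (@vpieri M k).
Proof. by split=> [|j u]; [exact: raddfB | exact: vpieri_hpieriC]. Qed.

Lemma commutant_ex u : exists T, pieri_commutant T /\ T (sigma ptn0) = u.
Proof.
elim/pieri_ind: u => [|k u [T [T_comm T_one]]|u v [T [T_comm T_one]] [S [S_comm S_one]]].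
- by exists id; split; first exact: commutant_id.
- exists (hpieri k \o T); rewrite /= T_one; split=> //.
  exact: commutant_comp (commutant_hpieri k) T_comm.
by exists (fun u => T u - S u)%R; rewrite T_one S_one; split; first exact: commutant_sub.
Qed.

(* A class is determined by the operator multiplying by it, and multiplication operators
   are the endomorphisms commuting with the Pieri operators. *)
Definition smul u : R -> R := sval (constructive_indefinite_description _ (commutant_ex u)).

Lemma smul_commutant u : pieri_commutant (smul u).
Proof. by rewrite /smul; case: constructive_indefinite_description => T []. Qed.

Lemma smulr1 u : smul u (sigma ptn0) = u.
Proof. by rewrite /smul; case: constructive_indefinite_description => T []. Qed.

Lemma commutantE T u : pieri_commutant T -> T u = smul (T (sigma ptn0)) u.
Proof. by move=> T_comm; apply: commutant_eq (smul_commutant _) _ u; rewrite ?smulr1. Qed.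

Fact smul1r : left_id (sigma ptn0) smul.
Proof. by move=> u; exact/esym/(commutantE u commutant_id). Qed.

Fact smulC : commutative smul.
Proof.
move=> u; apply: pieri_ind => [|k v uv|v w uv uw].
- by rewrite smulr1 smul1r.
- have comm := commutant_comp (commutant_hpieri k) (smul_commutant v).
  rewrite (smul_commutant u).2 uv -[LHS]/((hpieri k \o smul v) u).
  by rewrite (commutantE _ comm) /= smulr1.
have comm := commutant_sub (smul_commutant v) (smul_commutant w).
by rewrite (smul_commutant u).1 uv uw (commutantE _ comm) !smulr1.
Qed.

Fact smulA : associative smul.
Proof.
move=> u v w; have comm := commutant_comp (smul_commutant u) (smul_commutant v).
by rewrite -[LHS]/((smul u \o smul v) w) (commutantE _ comm) /= smulr1.
Qed.

HB.instance Definition _ u := GRing.isZmodMorphism.Build R R (smul u) (smul_commutant u).1.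

Fact smulDl : left_distributive smul +%R.
Proof. by move=> u v w; rewrite !(smulC _ w) raddfD. Qed.

Fact sigma0_neq0 : sigma ptn0 != 0%R :> R.
Proof. by apply/eqP => /ffunP/(_ ptn0); rewrite !ffunE eqxx. Qed.

HB.instance Definition _ :=
  GRing.Zmodule_isComNzRing.Build R smulA smulC smul1r smulDl sigma0_neq0.

Lemma sigma0 : sigma ptn0 = 1%R :> R.
Proof. by []. Qed.

Lemma commutantM T u v : pieri_commutant T -> (T (u * v) = T u * v)%R.
Proof.
move=> T_comm; have := commutantE v (commutant_comp T_comm (smul_commutant u)).
by rewrite /= smulr1.
Qed.

Lemma hpieriM k u v : (hpieri k (u * v) = hpieri k u * v)%R.
Proof. exact: commutantM (commutant_hpieri k). Qed.

Lemma vpieriM k u v : (vpieri k (u * v) = vpieri k u * v)%R.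
Proof. exact: commutantM (commutant_vpieri k). Qed.

(** * The grading *)

Definition homogeneous (k : nat) u := forall n, u n != 0%R -> weight n = k.

(* Since [2 ^+ i] determines [i], the degree of a homogeneous class is read off from the
   ring endomorphism scaling the part of degree [i] by [2 ^+ i]. *)
Definition dilate u : R := [ffun n => u n * 2 ^+ weight n]%R.

Fact dilate_is_zmod_morphism : zmod_morphism dilate.
Proof. by move=> u v; apply/ffunP => n; rewrite !(schubert_coefB, ffunE) mulrBl. Qed.
HB.instance Definition _ := GRing.isZmodMorphism.Build R R dilate dilate_is_zmod_morphism.

Lemma dilate_hpieri k u : dilate (hpieri k u) = (hpieri k (dilate u) *~ 2 ^+ k)%R.
Proof.
apply/ffunP => n; rewrite schubert_coefMz !ffunE !mulr_suml.
by apply: eq_bigr => m /hstrip_byP[_ weight_n]; rewrite ffunE weight_n exprD mulrA.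
Qed.

Lemma dilateM u v : dilate (u * v)%R = (dilate u * dilate v)%R.
Proof.
elim/pieri_ind: u => [|k u IHu|u w IHu IHw].
- have dilate1 : dilate (sigma ptn0) = sigma ptn0.
    by apply/ffunP => n; rewrite !ffunE; case: eqP => [->|_]; rewrite ?weight0 ?mul0r.
  by rewrite dilate1 sigma0 !mul1r.
- by rewrite -hpieriM !dilate_hpieri IHu hpieriM mulrzAl.
by rewrite mulrBl !raddfB /= IHu IHw mulrBl.
Qed.

Lemma homogeneousP k u : homogeneous k u <-> dilate u = (u *~ 2 ^+ k)%R.
Proof.
split=> [homog|/ffunP dilate_u n un_neq0].
  apply/ffunP => n; rewrite schubert_coefMz ffunE; have [->|/homog-> //] := eqVneq (u n) 0%R.
  by rewrite !mul0r.
have := dilate_u n; rewrite schubert_coefMz ffunE => /(mulfI un_neq0).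
exact: ieexprIn.
Qed.

Lemma homogeneousM j k u v :
  homogeneous j u -> homogeneous k v -> homogeneous (j + k) (u * v)%R.
Proof.
move=> /homogeneousP dilate_u /homogeneousP dilate_v; apply/homogeneousP.
by rewrite dilateM dilate_u dilate_v mulrzAl mulrzAr -mulrzA -exprD addnC.
Qed.

Lemma homogeneous_sigma l : homogeneous (weight l) (sigma l).
Proof. by move=> n; rewrite ffunE; have [->|] := eqVneq n l. Qed.

Lemma homogeneous_prod (I : Type) (s : seq I) (f : I -> P) :
  homogeneous (\sum_(i <- s) weight (f i)) (\prod_(i <- s) sigma (f i))%R.
Proof.
elim: s => [|i s IHs].
  by rewrite !big_nil -(@weight0 M); exact: homogeneous_sigma.
by rewrite !big_cons; apply: homogeneousM IHs; exact: homogeneous_sigma.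
Qed.

End SchubertRing.
Global Opaque smul.

(** * The conjugation involution *)

Section Involution.
Variable M : nat.
Local Notation P := (ptn M).
Local Notation R := (schubert_ring M).
Implicit Types (l m n : P) (u v : R).

Definition omega u : R := [ffun n => u (conj n)].

Lemma omega_sigma l : omega (sigma l) = sigma (conj l).
Proof. by apply/ffunP => n; rewrite !ffunE -(inj_eq (can_inj (@conjK M))) conjK. Qed.

Lemma omega_hpieri k u : omega (hpieri k u) = vpieri k (omega u).
Proof.
apply/ffunP => n; rewrite !ffunE; apply: (reindex_bij_in (@conj M) (@conj M)) => m.
- by rewrite -hstrip_by_conj !conjK.
- by rewrite hstrip_by_conj conjK.
by rewrite ffunE conjK.
Qed.

Fact omega_is_zmod_morphism : zmod_morphism omega.
Proof. by move=> u v; apply/ffunP => n; rewrite !(schubert_coefB, ffunE). Qed.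
HB.instance Definition _ := GRing.isZmodMorphism.Build R R omega omega_is_zmod_morphism.

Fact omega_is_monoid_morphism : monoid_morphism omega.
Proof.
have omega1 : omega (sigma ptn0) = sigma ptn0 by rewrite omega_sigma conj0.
split=> // u v; elim/pieri_ind: u => [|k u IHu|u w IHu IHw].
- by rewrite omega1 sigma0 !mul1r.
- by rewrite -hpieriM !omega_hpieri IHu vpieriM.
by rewrite mulrBl !raddfB /= IHu IHw mulrBl.
Qed.
HB.instance Definition _ := GRing.isMonoidMorphism.Build R R omega omega_is_monoid_morphism.

Lemma prod_sigma_conj (I : Type) (s : seq I) (f : I -> P) n :
  (\prod_(i <- s) sigma (conj (f i)))%R n = (\prod_(i <- s) sigma (f i))%R (conj n).
Proof.
by under eq_bigr => i _ do rewrite -omega_sigma; rewrite -rmorph_prod ffunE.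
Qed.

End Involution.

(** * Duality in a box *)

Section BoxDuality.
Variables (M A B : nat).
Local Notation P := (ptn M).
Local Notation R := (schubert_ring M).
Implicit Types (l m n : P) (u v w : R).

Definition inbox l : bool := (l 0 <= B) && (l A == 0).
Definition box_ptn : P := mkptn M (fun i => if i < A then B else 0).
Definition compl l : P := mkptn M (fun i => if i < A then B - l (A - i.+1) else 0).

Lemma inboxP l : reflect (forall i, l i <= if i < A then B else 0) (inbox l).
Proof.
apply: (iffP andP) => [[le_lB /eqP short_l] i|bounds].
  case: ltnP => [_|le_Ai]; first exact: leq_trans (prow_leq l (leq0n i)) le_lB.
  by rewrite -short_l; exact: prow_leq.
split; last by rewrite -leqn0; have := bounds A; rewrite ltnn.
by have := bounds 0; case: (ltnP 0 A) => //; lia.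
Qed.

Lemma hstrip_inbox n m : hstrip n m -> inbox n -> inbox m.
Proof.
by move=> /hstrip_sub le_mn /inboxP bounds; apply/inboxP => i; exact: leq_trans (bounds i).
Qed.

Lemma inbox0 : inbox ptn0.
Proof. by apply/inboxP => i; rewrite ptn0E. Qed.

Hypotheses (leAM : A <= M) (leBM : B <= M).

Lemma box_ptnE i : box_ptn i = if i < A then B else 0.
Proof.
apply: mkptnE; split=> [j||]; first by case: ifP; case: ifP; lia.
  by case: ifP.
by rewrite ltnNge leAM.
Qed.

Lemma complE l i : compl l i = if i < A then B - l (A - i.+1) else 0.
Proof.
apply: mkptnE; split=> [j||].
- case: ifP => // lt_jA; rewrite ifT ?leq_sub2l //; last by lia.
  by apply: prow_leq; lia.
- by case: ifP => // _; lia.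
by rewrite ltnNge leAM.
Qed.

Lemma compl0 : compl ptn0 = box_ptn.
Proof. by apply: ptnP => i _; rewrite complE box_ptnE ptn0E subn0. Qed.

Lemma inbox_compl l : inbox (compl l).
Proof. by apply/inboxP => i; rewrite complE; case: ifP => // _; lia. Qed.

Lemma complK l : inbox l -> compl (compl l) = l.
Proof.
move=> /inboxP bounds; apply: ptnP => i _; rewrite complE; have := bounds i.
case: ltnP => [lt_iA le_lB|_]; last by lia.
by rewrite complE ifT; [rewrite (_ : A - _.+1 = i); lia | lia].
Qed.

Lemma weight_compl l : inbox l -> weight (compl l) + weight l = A * B.
Proof.
move=> /andP[le_lB /eqP short_l]; rewrite (weight_short short_l) (@weight_short _ A); last first.
  by rewrite complE ltnn.
rewrite /head_weight [X in _ + X](reindex_inj rev_ord_inj) mul_sum_ord -big_split /=.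
apply: eq_bigr => i _; rewrite complE ltn_ord subnK //.
exact: leq_trans (prow_leq l (leq0n _)) le_lB.
Qed.

Lemma weight_inbox l : inbox l -> weight l <= A * B.
Proof. by move/weight_compl => <-; exact: leq_addl. Qed.

Lemma weight_box_ptn : weight box_ptn = A * B.
Proof. by rewrite -compl0 -(weight_compl inbox0) weight0 addn0. Qed.

Lemma hstrip_compl n m : hstrip n m -> inbox n -> hstrip (compl m) (compl n).
Proof.
move=> /hstripP strip /inboxP bounds; apply/hstripP => i; rewrite !complE.
case: (ltnP i A) => lt_iA; last by rewrite ifN // -leqNgt ltnW.
case: (ltnP i.+1 A) => lt_SiA; last by have := strip (A - i.+1); lia.
have := strip (A - i.+2); have := strip (A - i.+1).
by rewrite (_ : (A - i.+2).+1 = A - i.+1); lia.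
Qed.

Lemma hstrip_by_compl k n m :
  hstrip_by k n m -> inbox n -> hstrip_by k (compl m) (compl n).
Proof.
move=> /hstrip_byP[strip weight_n] n_in; have m_in := hstrip_inbox strip n_in.
apply/hstrip_byP; split; first exact: hstrip_compl.
by have := weight_compl n_in; have := weight_compl m_in; lia.
Qed.

Definition box_pairing u v : int := (\sum_(l | inbox l) u l * v (compl l))%R.

Lemma box_pairing_hpieri k u v :
  box_pairing (hpieri k u) v = box_pairing u (hpieri k v).
Proof.
rewrite /box_pairing; under eq_bigr => l _ do rewrite ffunE mulr_suml.
rewrite (exchange_big_dep inbox) /= => [|n m n_in /andP[strip _]]; last exact: hstrip_inbox n_in.
apply: eq_bigr => m m_in; rewrite ffunE mulr_sumr.
apply: (reindex_bij_in compl compl) => [n|n|//].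
  by move=> /andP[n_in strip]; rewrite hstrip_by_compl // complK.
move=> strip; have n_in : inbox n.
  by case/hstrip_byP: strip => strip _; apply: hstrip_inbox strip (inbox_compl m).
rewrite inbox_compl complK // -{1}(complK m_in); split=> //.
by apply: hstrip_by_compl strip (inbox_compl m).
Qed.

Lemma box_pairing_mul u v w : box_pairing (u * w)%R v = box_pairing w (u * v)%R.
Proof.
elim/pieri_ind: u v w => [v w|k u IHu v w|u u' IHu IHu' v w]; first by rewrite sigma0 !mul1r.
  by rewrite -!hpieriM box_pairing_hpieri IHu [(u * _)%R]mulrC -hpieriM [(v * u)%R]mulrC.
transitivity (box_pairing (u * w)%R v - box_pairing (u' * w)%R v)%R.
  rewrite /box_pairing -sumrB; apply: eq_bigr => l _.
  by rewrite [((u - u') * w)%R]mulrBl schubert_coefB mulrBl.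
rewrite IHu IHu' /box_pairing -sumrB; apply: eq_bigr => l _.
by rewrite [((u - u') * v)%R]mulrBl schubert_coefB mulrBr.
Qed.

Lemma box_pairing1 v : box_pairing 1%R v = v box_ptn.
Proof.
rewrite /box_pairing (bigD1 ptn0) /=; last exact: inbox0.
rewrite big1 => [|l /andP[_ ne_l0]]; first by rewrite ffunE eqxx mul1r addr0 compl0.
by rewrite ffunE (negPf ne_l0) mul0r.
Qed.

Theorem box_duality u v :
  ((u * v) box_ptn = \sum_(l | inbox l) u l * v (compl l))%R.
Proof. by rewrite -box_pairing1 -box_pairing_mul mulr1. Qed.

End BoxDuality.
Global Opaque box_ptn compl.

(** * Polynomials as coefficient functions *)

Lemma subvecsP (m t : seq nat) : t \in subvecs m ->
  [/\ size t = size m, size (vsub m t) = size m & sumn t + sumn (vsub m t) = sumn m].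
Proof.
elim: m t => [|x m IHm] t; first by rewrite inE => /eqP->.
case/allpairsP => -[y s] /= [y_x s_m ->]; have [size_s size_sub sum_sub] := IHm s s_m.
move: y_x; rewrite -[0 :: _]/(iota 0 x.+1) mem_iota => le_yx.
by rewrite /vsub /= -/(vsub m s) size_s size_sub; split=> //; lia.
Qed.

Lemma subvecs_cons x m :
  subvecs (x :: m) = [seq y :: t | y <- index_iota 0 x.+1, t <- subvecs m].
Proof. by []. Qed.

Lemma polymul_cons f g x m :
  polymul f g (x :: m) =
  (\sum_(y < x.+1) polymul (fun t => f (nat_of_ord y :: t))
                           (fun t => g ((x - y)%N :: t)) m)%R.
Proof. by rewrite /polymul subvecs_cons big_allpairs_dep big_mkord. Qed.

Lemma eq_polymul f f' g g' m :
  (forall t, size t = size m -> sumn t <= sumn m -> f t = f' t) ->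
  (forall t, size t = size m -> sumn t <= sumn m -> g t = g' t) ->
  polymul f g m = polymul f' g' m.
Proof.
move=> eq_f eq_g; apply: eq_big_seq => t /subvecsP[size_t size_sub sum_t].
by rewrite eq_f ?eq_g //; lia.
Qed.

Lemma polymul_nil f g : polymul f g [::] = (f [::] * g [::])%R.
Proof. by rewrite /polymul big_seq1. Qed.

Lemma polymul0 g m : polymul (fun=> 0%R) g m = 0%R.
Proof. by rewrite /polymul big1 // => t _; rewrite mul0r. Qed.

Lemma polymul1 g m : polymul poly1 g m = g m.
Proof.
elim: m g => [|x m IHm] g; first by rewrite polymul_nil mul1r.
rewrite polymul_cons big_ord_recl /= big1 ?addr0 => [|i _]; last exact: polymul0.
by rewrite -[RHS](IHm (fun t => g (x :: t))) subn0; apply: eq_polymul.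
Qed.

Lemma polymul_suml (I : Type) (s : seq I) (Q : pred I) (f : I -> Defs.poly) g m :
  polymul (fun t => \sum_(i <- s | Q i) f i t)%R g m
  = (\sum_(i <- s | Q i) polymul (f i) g m)%R.
Proof.
by rewrite /polymul; under eq_bigr => t _ do rewrite mulr_suml; rewrite exchange_big.
Qed.

Lemma polymul_sumr (I : Type) (s : seq I) (Q : pred I) f (g : I -> Defs.poly) m :
  polymul f (fun t => \sum_(i <- s | Q i) g i t)%R m
  = (\sum_(i <- s | Q i) polymul f (g i) m)%R.
Proof.
by rewrite /polymul; under eq_bigr => t _ do rewrite mulr_sumr; rewrite exchange_big.
Qed.

Lemma polymul_subl f f' g m :
  polymul (fun t => f t - f' t)%R g m = (polymul f g m - polymul f' g m)%R.
Proof. by rewrite -sumrB; apply: eq_bigr => t _; rewrite mulrBl. Qed.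

Lemma sum_triangle (R : nmodType) (G : nat -> nat -> R) n :
  (\sum_(y < n.+1) \sum_(z < y.+1) G z y
   = \sum_(z < n.+1) \sum_(w < (n - z).+1) G z (z + w)%N)%R.
Proof.
elim: n => [|n IHn]; first by rewrite !big_ord1.
rewrite big_ord_recr IHn /= [X in (_ + X)%R = _]big_ord_recr [RHS]big_ord_recr /=.
rewrite addrA -big_split /=; congr (_ + _)%R; last by rewrite subnn big_ord1 addn0.
apply: eq_bigr => z _; have le_zn : z <= n by rewrite -ltnS.
by rewrite subSn // [RHS]big_ord_recr /= -subSn // subnKC // ltnW.
Qed.

Lemma polymulA f g h m :
  polymul (polymul f g) h m = polymul f (polymul g h) m.
Proof.
elim: m f g h => [|x m IHm] f g h; first by rewrite !polymul_nil mulrA.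
rewrite [LHS]polymul_cons [RHS]polymul_cons.
pose G z y := polymul (polymul (fun t => f (z :: t)) (fun t => g ((y - z)%N :: t)))
                      (fun t => h ((x - y)%N :: t)) m.
transitivity (\sum_(y < x.+1) \sum_(z < y.+1) G z y)%R.
  apply: eq_bigr => y _; rewrite -polymul_suml; apply: eq_polymul => // t _ _.
  exact: polymul_cons.
rewrite sum_triangle; apply: eq_bigr => z _; rewrite /G.
under eq_bigr => w _ do rewrite IHm.
rewrite -polymul_sumr; apply: eq_polymul => // t _ _; rewrite polymul_cons.
by apply: eq_bigr => w _; rewrite addKn subnDA.
Qed.

Lemma polymul_cat (f g : Defs.poly) (s t : seq nat) :
  polymul f g (s ++ t) = (\sum_(s1 <- subvecs s) \sum_(t1 <- subvecs t)
      f (s1 ++ t1) * g (vsub s s1 ++ vsub t t1))%R.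
Proof.
elim: s f g => [|x s IHs] f g; first by rewrite big_seq1.
rewrite subvecs_cons big_allpairs_dep big_mkord polymul_cons.
by apply: eq_bigr => y _; exact: IHs.
Qed.

Definition complete_poly (k : nat) : Defs.poly := fun m => (sumn m == k)%:R%R.

(** * Schur polynomials *)

Section SchurPolynomials.
Variable M : nat.
Local Notation P := (ptn M).
Local Notation R := (schubert_ring M).
Implicit Types (l m n q : P) (u v : R) (s t : seq nat).

(* Its coefficients in the Schubert basis are the Kostka numbers. *)
Definition hmonom s : R := (\prod_(k <- s) hpieri k 1)%R.

Lemma hmonom_cons k s : hmonom (k :: s) = hpieri k (hmonom s).
Proof. by rewrite /hmonom big_cons -hpieriM mul1r. Qed.

Lemma hmonom_nil : hmonom [::] = sigma ptn0.
Proof. by rewrite /hmonom big_nil. Qed.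

Lemma perm_hmonom s t : perm_eq s t -> hmonom s = hmonom t.
Proof. exact: perm_big. Qed.

Definition schur_poly l : Defs.poly := fun s => hmonom s l.
Definition to_poly u : Defs.poly := fun s => (\sum_l u l * schur_poly l s)%R.

Lemma schur_poly_cons l k s :
  schur_poly l (k :: s) = (\sum_(m | hstrip_by k l m) schur_poly m s)%R.
Proof. by rewrite /schur_poly hmonom_cons ffunE. Qed.

Lemma schur_poly_nil l : schur_poly l [::] = (l == ptn0)%:R%R.
Proof. by rewrite /schur_poly hmonom_nil ffunE. Qed.

Lemma schur_poly_weight l s : schur_poly l s != 0%R -> weight l = sumn s.
Proof.
elim: s l => [|k s IHs] l.
  by rewrite schur_poly_nil; have [->|] := eqVneq l ptn0; rewrite ?weight0.
apply: contraNeq => ne; rewrite schur_poly_cons big1 // => m /hstrip_byP[_ weight_l].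
by apply/eqP; apply: contraNT ne => /IHs weight_m; rewrite weight_l weight_m /= addnC.
Qed.

Lemma schur_poly_length l s : schur_poly l s != 0%R -> l (size s) = 0.
Proof.
elim: s l => [|k s IHs] l.
  by rewrite schur_poly_nil; have [->|] := eqVneq l ptn0; rewrite ?ptn0E.
apply: contraNeq => ne; rewrite schur_poly_cons big1 // => m /hstrip_byP[/hstripP strip _].
apply/eqP; apply: contraNT ne => /IHs m_out; rewrite -leqn0 /=.
by have := strip (size s); rewrite m_out; lia.
Qed.

Lemma schur_poly_dominance d l s : schur_poly l s != 0%R ->
  sumn (take d s) <= head_weight d l.
Proof.
elim: s d l => [|k s IHs] [|d] l //= ; apply: contraNT => lt_head.
rewrite schur_poly_cons big1 // => m /hstrip_byP[/hstripP strip weight_l].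
apply/eqP; apply: contraNT lt_head => /(IHs d) le_head.
have le_drop : weight (drop_rows d.+1 l) <= weight (drop_rows d m).
  by apply: leq_weight => i; rewrite !drop_rowsE; case/andP: (strip (d + i)).
by have := weight_split d.+1 l; have := weight_split d m; lia.
Qed.

Lemma schur_poly_ptn0 s : schur_poly ptn0 s = poly1 s.
Proof.
elim: s => [|k s IHs]; first by rewrite schur_poly_nil eqxx.
rewrite schur_poly_cons /poly1 /=; case: k => [|k].
  by rewrite (big_pred1 ptn0) => [|m]; [exact: IHs | rewrite hstrip_by0].
rewrite big_pred0 // => m; apply/negP => /hstrip_byP[_].
by rewrite weight0; lia.
Qed.

Lemma to_poly_sigma l s : to_poly (sigma l) s = schur_poly l s.
Proof.
rewrite /to_poly (bigD1 l) //= big1 ?addr0 => [|m ne_ml]; first by rewrite ffunE eqxx mul1r.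
by rewrite ffunE (negPf ne_ml) mul0r.
Qed.

Lemma to_poly_nil u : to_poly u [::] = u ptn0.
Proof.
rewrite /to_poly (bigD1 ptn0) //= big1 ?addr0 => [|l ne_l0]; rewrite schur_poly_nil.
  by rewrite eqxx mulr1.
by rewrite (negPf ne_l0) mulr0.
Qed.

Lemma to_poly_cons u k s : to_poly u (k :: s) = to_poly (hskew k u) s.
Proof.
rewrite /to_poly; under eq_bigr => l _ do rewrite schur_poly_cons mulr_sumr.
rewrite (exchange_big_dep xpredT) //=; apply: eq_bigr => m _.
by rewrite ffunE mulr_suml.
Qed.

Lemma to_poly_sub u v s : to_poly (u - v)%R s = (to_poly u s - to_poly v s)%R.
Proof. by rewrite -sumrB; apply: eq_bigr => l _; rewrite schubert_coefB mulrBl. Qed.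

Lemma hpieri_ptn0 k u : hpieri k u ptn0 = ((k == 0)%:R * u ptn0)%R.
Proof.
case: k => [|k]; first by rewrite hpieri0 mul1r.
rewrite mul0r ffunE big_pred0 // => m; apply/negP => /hstrip_byP[_].
by rewrite weight0; lia.
Qed.

Lemma to_poly_hskew_hpieri x k u s : sumn s + x <= M ->
  to_poly (hskew x (hpieri k u)) s
  = (\sum_(y < x.+1 | (y <= k)%N) to_poly (hpieri (k - y) (hskew (x - y) u)) s)%R.
Proof.
move=> leM; rewrite exchange_big; apply: eq_bigr => l _ /=.
have [->|/schur_poly_weight weight_l] := eqVneq (schur_poly l s) 0%R.
  by rewrite mulr0 big1 // => y _; rewrite mulr0.
by rewrite hskew_hpieri ?weight_l // mulr_suml.
Qed.

Lemma to_poly_hpieri k u s : sumn s <= M ->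
  to_poly (hpieri k u) s = polymul (complete_poly k) (to_poly u) s.
Proof.
elim: s k u => [|x s IHs] k u /= leM.
  by rewrite polymul_nil !to_poly_nil hpieri_ptn0 /complete_poly /= eq_sym.
rewrite polymul_cons to_poly_cons to_poly_hskew_hpieri 1?addnC // big_mkcond.
apply: eq_bigr => y _ /=; case: leqP => [le_yk|lt_ky].
  rewrite IHs; last by lia.
  apply: eq_polymul => t _ _; last by rewrite to_poly_cons.
  by rewrite /complete_poly /=; congr (nat_of_bool _)%:R%R; apply/eqP/eqP; lia.
rewrite -[LHS](polymul0 (fun t => to_poly u ((x - y)%N :: t)) s).
by apply: eq_polymul => // t _ _; rewrite /complete_poly /= (_ : _ == _ = false) //; lia.
Qed.

Lemma to_polyM u v s : sumn s <= M ->
  to_poly (u * v)%R s = polymul (to_poly u) (to_poly v) s.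
Proof.
elim/pieri_ind: u s => [|k u IHu|u w IHu IHw] s leM.
- rewrite sigma0 mul1r -[LHS]polymul1; apply: eq_polymul => // t _ _.
  by rewrite -sigma0 to_poly_sigma schur_poly_ptn0.
- rewrite -hpieriM to_poly_hpieri //.
  transitivity (polymul (complete_poly k) (polymul (to_poly u) (to_poly v)) s).
    by apply: eq_polymul => // t _ le_ts; apply: IHu; exact: leq_trans leM.
  rewrite -polymulA; apply: eq_polymul => // t _ le_ts.
  by rewrite to_poly_hpieri //; exact: leq_trans leM.
rewrite mulrBl to_poly_sub IHu // IHw // -polymul_subl.
by apply: eq_polymul => // t _ _; rewrite to_poly_sub.
Qed.

Lemma to_poly_prod (I : Type) (r : seq I) (f : I -> P) s : sumn s <= M ->
  to_poly (\prod_(i <- r) sigma (f i))%R s = polyprod [seq schur_poly (f i) | i <- r] s.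
Proof.
elim: r s => [|i r IHr] s leM.
  by rewrite big_nil -sigma0 to_poly_sigma schur_poly_ptn0.
rewrite big_cons to_polyM //=; apply: eq_polymul => t _ le_ts; first exact: to_poly_sigma.
by apply: IHr; exact: leq_trans leM.
Qed.

Lemma polyprod_homogeneous (I : Type) (r : seq I) (f : I -> P) s :
  polyprod [seq schur_poly (f i) | i <- r] s != 0%R -> sumn s = \sum_(i <- r) weight (f i).
Proof.
elim: r s => [|i r IHr] s /=.
  by rewrite big_nil /poly1; case: ifP; rewrite ?eqxx // => + _; elim: s => //= -[].
apply: contraNeq; rewrite big_cons => ne; rewrite /polymul big1_seq // => t.
move=> /andP[_ /subvecsP[_ _ sum_t]].
have [->|/schur_poly_weight weight_t] := eqVneq (schur_poly (f i) t) 0%R; first by rewrite mul0r.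
have [->|/IHr sum_rest] := eqVneq (polyprod [seq schur_poly (f i) | i <- r] (vsub s t)) 0%R.
  by rewrite mulr0.
by case/eqP: ne; rewrite weight_t -sum_rest.
Qed.

(** * Linear independence of Schur polynomials *)

Lemma schur_poly_head l s : schur_poly l (l 0 :: s) = schur_poly (drop_rows 1 l) s.
Proof.
rewrite schur_poly_cons (big_pred1 (drop_rows 1 l)) // => m.
apply/hstrip_byP/eqP => [[strip weight_l]|->]; first exact: hstrip_full.
by rewrite addnC; split; [exact: hstrip_drop1 | exact: weight_recl].
Qed.

Lemma schur_poly_mkseq l r : l r = 0 -> schur_poly l (mkseq l r) = 1%R.
Proof.
elim: r l => [|r IHr] l short_l; first by rewrite (prow0_eq0 short_l) schur_poly_nil eqxx.
have -> : mkseq l r.+1 = l 0 :: mkseq (drop_rows 1 l) r.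
  rewrite /mkseq /= -(addn0 1) iotaDl -map_comp; congr (_ :: _).
  by apply: eq_map => i /=; rewrite drop_rowsE.
by rewrite schur_poly_head IHr // drop_rowsE.
Qed.

Lemma sumn_take_mkseq l d r : d <= r -> sumn (take d (mkseq l r)) = head_weight d l.
Proof.
move=> le_dr; rewrite -map_take take_iota (minn_idPl le_dr) sumnE big_map.
by rewrite -[X in iota 0 X]subn0 big_mkord.
Qed.

Lemma sumn_mkseq l r : l r = 0 -> sumn (mkseq l r) = weight l.
Proof.
move=> short_l; rewrite (weight_short short_l) -(@sumn_take_mkseq l r r) //.
by rewrite take_oversize ?size_mkseq.
Qed.

(* A Kostka number [K_(n, l)] vanishes unless [n] dominates [l], so for [l] maximal in the
   dominance order [u l] is the coefficient of the monomial [l]. *)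
Lemma to_poly_eq0 r (Q : pred P) u : (forall l, Q l -> l r = 0) ->
    (forall l n, Q l -> schur_poly n (mkseq l r) != 0%R -> Q n) ->
    (forall l, Q l -> to_poly u (mkseq l r) = 0%R) ->
  forall l, Q l -> u l = 0%R.
Proof.
move=> Q_len Q_up Q0 l0 Ql0; apply/eqP; apply/negPn/negP => ul0_neq0.
pose height n := \sum_(d < r.+1) head_weight d n; pose support n := Q n && (u n != 0%R).
have Qul0 : support l0 by rewrite /support Ql0.
case: (arg_maxnP height Qul0) => l /andP[Ql ul_neq0] l_max; case/eqP: ul_neq0.
rewrite -[LHS]mulr1 -(schur_poly_mkseq (Q_len l Ql)) -[RHS](Q0 l Ql) /to_poly (bigD1 l) //=.
rewrite big1 ?addr0 // => n ne_nl.
have [->|Kn_neq0] := eqVneq (schur_poly n (mkseq l r)) 0%R; first by rewrite mulr0.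
have [->|un_neq0] := eqVneq (u n) 0%R; first by rewrite mul0r.
have Qn := Q_up _ _ Ql Kn_neq0; have := l_max n; rewrite /support Qn un_neq0 => /(_ isT) le_nl.
have head_le (d : 'I_r.+1) : head_weight d l <= head_weight d n.
  by rewrite -(@sumn_take_mkseq l d r) -1?ltnS //; exact: schur_poly_dominance.
have head_eq : \sum_(d < r.+1) head_weight d l = \sum_(d < r.+1) head_weight d n.
  by apply/eqP; rewrite eqn_leq; apply/andP; split; [exact: leq_sum | exact: le_nl].
have {}head_eq (d : 'I_r.+1) := eq_from_leq_sum head_le head_eq d.
case/eqP: ne_nl; apply: ptnP => i _; have [lt_ir|le_ri] := ltnP i r.
  have := head_eq (Ordinal (ltnW lt_ir : i < r.+1)).
  have := head_eq (Ordinal (lt_ir : i.+1 < r.+1)).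
  by rewrite /= /head_weight !big_ord_recr /=; lia.
by have := prow_leq l le_ri; have := prow_leq n le_ri; rewrite !Q_len //; lia.
Qed.

Lemma to_poly_inj r X u :
  (forall s, size s = r -> sumn s <= X -> to_poly u s = 0%R) ->
  forall l, weight l <= X -> l r = 0 -> u l = 0%R.
Proof.
move=> u0 l0 le_l0X l0r; pose Q l := (weight l <= X) && (l r == 0).
apply: (@to_poly_eq0 r Q) => [l /andP[_ /eqP]|l n|l|] //; last by rewrite /Q le_l0X l0r.
  move=> /andP[le_lX /eqP short_l] Kn_neq0; have := schur_poly_length Kn_neq0.
  by rewrite /Q (schur_poly_weight Kn_neq0) sumn_mkseq // size_mkseq => ->; rewrite le_lX.
by move=> /andP[le_lX /eqP short_l]; apply: u0; rewrite ?size_mkseq ?sumn_mkseq.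
Qed.

End SchurPolynomials.

(** * Leading forms *)

(* In the monomial [s ++ t], the exponents [t] are those of [d] distinguished variables. *)
Definition leading_form (d D : nat) (F G H : Defs.poly) : Prop :=
  [/\ forall s t, size t = d -> D < sumn t -> F (s ++ t) = 0%R,
      forall s t, size t = d -> sumn t = D -> F (s ++ t) = (G t * H s)%R &
      forall t, sumn t != D -> G t = 0%R].

Lemma leading_form1 d : leading_form d 0 poly1 poly1 poly1.
Proof.
have poly1_pos t : 0 < sumn t -> poly1 t = 0%R by rewrite /poly1; elim: t => //= -[].
have poly1_eq0 t : sumn t = 0 -> all (eq_op^~ 0) t by elim: t => //= -[].
split=> [s t _ t_gt0|s t _ t0|t].
- by rewrite poly1_pos // sumn_cat; lia.
- by rewrite /poly1 all_cat (poly1_eq0 t t0) andbT mul1r.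
by rewrite -lt0n; exact: poly1_pos.
Qed.

Lemma leading_form_mul d D D' F F' G G' H H' :
  leading_form d D F G H -> leading_form d D' F' G' H' ->
  leading_form d (D + D') (polymul F F') (polymul G G') (polymul H H').
Proof.
move=> [F0 FE G0] [F'0 F'E G'0]; split=> [s t size_t lt_t|s t size_t sum_t|t ne_t].
- rewrite polymul_cat big1 // => s1 _; rewrite big1_seq // => t1 /andP[_ /subvecsP[]].
  rewrite size_t => size_t1 size_t2 sum_t; have [lt_t1|le_t1] := ltnP D (sumn t1).
    by rewrite F0 ?mul0r.
  by rewrite F'0 ?mulr0 //; lia.
- rewrite polymul_cat exchange_big mulr_suml; apply: eq_big_seq => t1 /subvecsP[].
  rewrite size_t => size_t1 size_t2 sum_t1; rewrite mulr_sumr; apply: eq_bigr => s1 _.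
  have [lt_t1|lt_t1|eq_t1] := ltngtP D (sumn t1).
  + by rewrite F0 // G0 ?gtn_eqF // !mul0r.
  + by rewrite F'0 ?G0 ?ltn_eqF ?mulr0 ?mul0r //; lia.
  by rewrite FE ?F'E //; [ring | lia].
rewrite /polymul big1_seq // => t1 /andP[_ /subvecsP[_ _ sum_t]].
have [eq_t1|ne_t1] := eqVneq (sumn t1) D; last by rewrite G0 ?mul0r.
by rewrite G'0 ?mulr0 //; apply: contra_neq ne_t => <-; lia.
Qed.

Section ExtremalCoefficients.
Variables (M d : nat).
Local Notation P := (ptn M).
Local Notation R := (schubert_ring M).
Implicit Types (l m n q : P) (u v : R) (s t : seq nat).

Lemma schur_poly_cat_eq0 l s t :
  size t = d -> head_weight d l < sumn t -> schur_poly l (s ++ t) = 0%R.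
Proof.
move=> size_t; apply: contraTeq => Kl_neq0; rewrite -leqNgt.
have := @schur_poly_dominance M d l (t ++ s); rewrite -size_t take_size_cat //; apply.
by rewrite /schur_poly (perm_hmonom _ (t := s ++ t)) // perm_catC.
Qed.

Lemma hstrip_head_eq l m : hstrip l m -> head_weight d m = head_weight d l ->
  forall i, i < d -> m i = l i.
Proof.
move=> strip eq_head i lt_id.
exact: (eq_from_leq_sum (fun j : 'I_d => hstrip_sub strip j) eq_head (Ordinal lt_id)).
Qed.

Lemma hstrip_by_drop k l m : head_weight d m = head_weight d l ->
  hstrip_by k l m -> hstrip_by k (drop_rows d l) (drop_rows d m).
Proof.
move=> eq_head /hstrip_byP[/hstripP strip weight_l]; apply/hstrip_byP; split.
  by apply/hstripP => i; rewrite !drop_rowsE addnS.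
by move: weight_l; rewrite (weight_split d l) (weight_split d m) eq_head; lia.
Qed.

Lemma hstrip_by_stack k l m : hstrip_by k (drop_rows d l) m ->
  [/\ hstrip_by k l (stack d l m), head_weight d (stack d l m) = head_weight d l
    & drop_rows d (stack d l m) = m].
Proof.
move=> /hstrip_byP[/hstripP strip weight_drop].
have le_ml i : m i <= l (d + i) by have /andP[_] := strip i; rewrite drop_rowsE.
have le_m0 i : i < d -> m 0 <= l i.
  move=> /ltnW/(prow_leq l); have := le_ml 0; rewrite addn0; exact: leq_trans.
have m_out : m (M - d) = 0.
  have := le_ml (M - d); rewrite (@prow_out _ l); last by lia.
  by rewrite leqn0 => /eqP.
have stack_E := stackE le_m0 m_out; have dropE := drop_stack le_m0 m_out.
have headE : head_weight d (stack d l m) = head_weight d l.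
  by apply: eq_bigr => i _; rewrite stack_E ltn_ord.
split=> //; apply/hstrip_byP; split.
  apply/hstripP => i; rewrite stack_E; case: ltnP => [_|le_di]; first by rewrite prowS leqnn.
  by have := strip (i - d); rewrite !drop_rowsE addnS subnKC.
by rewrite (weight_split d l) (weight_split d (stack d l m)) headE dropE; lia.
Qed.

Lemma schur_poly_cat l s t : size t = d -> sumn t = head_weight d l ->
  schur_poly l (s ++ t) = (schur_poly (take_rows d l) t * schur_poly (drop_rows d l) s)%R.
Proof.
move=> size_t; elim: s l => [|k s IHs] l sum_t /=.
  rewrite schur_poly_nil; have weight_l := weight_split d l.
  have [drop0|drop_neq0] := eqVneq (drop_rows d l) ptn0.
    rewrite mulr1; congr schur_poly; apply/esym/eq_from_weight => [i|].
      by rewrite take_rowsE; case: ifP.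
    by rewrite weight_take weight_l drop0 weight0 addn0.
  rewrite mulr0; apply/eqP; apply: contra_neqT drop_neq0 => /schur_poly_weight weight_t.
  by apply: weight_eq0; lia.
rewrite !schur_poly_cons mulr_sumr (bigID (fun m => head_weight d m == head_weight d l)) /=.
rewrite [X in (_ + X)%R]big1 ?addr0 => [|m /andP[/hstrip_byP[strip _] ne_head]]; last first.
  rewrite schur_poly_cat_eq0 // sum_t ltn_neqAle ne_head.
  by apply: leq_sum => i _; exact: hstrip_sub.
apply: (reindex_bij_in (@drop_rows M d) (stack d l)) => m.
- move=> /andP[strip /eqP eq_head]; have strip_drop := hstrip_by_drop eq_head strip.
  have [_ eq_head' dropE] := hstrip_by_stack strip_drop; split=> //.
  apply: (eq_from_rows (d := d)) => //; apply: eq_take_rows => i lt_id.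
  have [/hstrip_byP[stack_strip _] _ _] := hstrip_by_stack strip_drop.
  case/hstrip_byP: strip => strip _.
  by rewrite (hstrip_head_eq stack_strip eq_head') // (hstrip_head_eq strip eq_head).
- by move=> /hstrip_by_stack[-> -> ->]; rewrite eqxx.
move=> /andP[/hstrip_byP[strip _] /eqP eq_head]; rewrite IHs ?eq_head //.
by congr (schur_poly _ _ * _)%R; apply: eq_take_rows; exact: hstrip_head_eq.
Qed.

Lemma leading_form_schur l :
  leading_form d (head_weight d l) (schur_poly l) (schur_poly (take_rows d l))
               (schur_poly (drop_rows d l)).
Proof.
split=> [s t|s t|t]; [exact: schur_poly_cat_eq0 | exact: schur_poly_cat |].
by apply: contraNeq => /schur_poly_weight; rewrite weight_take => ->.
Qed.

Lemma leading_form_polyprod (I : Type) (r : seq I) (f : I -> P) :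
  leading_form d (\sum_(i <- r) head_weight d (f i))
    (polyprod [seq schur_poly (f i) | i <- r])
    (polyprod [seq schur_poly (take_rows d (f i)) | i <- r])
    (polyprod [seq schur_poly (drop_rows d (f i)) | i <- r]).
Proof.
elim: r => [|i r IHr]; first by rewrite big_nil; exact: leading_form1.
by rewrite big_cons; exact: leading_form_mul (leading_form_schur (f i)) IHr.
Qed.

Lemma to_poly2_inj (w : P -> P -> int) :
  (forall s t, size t = d -> size s = M -> sumn t + sumn s <= M ->
     (\sum_q \sum_n w q n * (schur_poly q t * schur_poly n s) = 0)%R) ->
  forall q n, q d = 0 -> weight q + weight n <= M -> w q n = 0%R.
Proof.
move=> w0 q n short_q le_qn; pose row q' : R := [ffun n' => w q' n'].
suff : row q n = 0%R by rewrite ffunE.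
apply: (@to_poly_inj M M (M - weight q)) => [s size_s le_s||]; [|by lia|exact: prow_out].
pose column : R := [ffun q' => to_poly (row q') s].
suff : column q = 0%R by rewrite ffunE.
apply: (@to_poly_inj M d (M - sumn s)) => [t size_t le_t||] //; last by lia.
rewrite -[RHS](w0 s t) //; last by lia.
apply: eq_bigr => q' _; rewrite ffunE mulr_suml; apply: eq_bigr => n' _.
by rewrite ffunE mulrAC -mulrA.
Qed.

Lemma sum_take_drop (Q : pred P) (F : P -> int) (G : P -> P -> int) :
  (\sum_q \sum_m (\sum_(l | Q l && ((take_rows d l == q) && (drop_rows d l == m))) F l) * G q m
   = \sum_(l | Q l) F l * G (take_rows d l) (drop_rows d l))%R.
Proof.
rewrite [RHS](partition_big (fun l => (take_rows d l, drop_rows d l)) xpredT) // pair_big /=.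
apply: eq_bigr => -[q m] _ /=; rewrite mulr_suml; apply: eq_big => [l|l].
  by rewrite xpair_eqE.
by move=> /andP[_ /andP[/eqP-> /eqP->]].
Qed.

Section Product.
Variables (I : Type) (r : seq I) (f : I -> P).

Let D := \sum_(i <- r) head_weight d (f i).
Let u : R := (\prod_(i <- r) sigma (f i))%R.

Lemma prod_sigma_head n : weight n <= M -> D < head_weight d n -> u n = 0%R.
Proof.
move=> le_nM lt_Dn; pose Q l := (weight l <= M) && (D < head_weight d l).
apply: (@to_poly_eq0 _ (d + M) Q) => [l _|l m|l|]; last by rewrite /Q le_nM.
- by rewrite prow_out ?leq_addl.
- move=> /andP[le_lM lt_Dl] Km_neq0; rewrite /Q (schur_poly_weight Km_neq0).
  rewrite sumn_mkseq ?prow_out ?leq_addl //.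
  rewrite le_lM (leq_trans lt_Dl) // -(@sumn_take_mkseq _ _ d (d + M)) ?leq_addr //.
  exact: schur_poly_dominance.
move=> /andP[le_lM lt_Dl]; set s := mkseq l (d + M).
have sum_s : sumn s = weight l by rewrite sumn_mkseq ?prow_out ?leq_addl.
transitivity (to_poly u (drop d s ++ take d s)).
  apply: eq_bigr => m _; congr (_ * (_ : R) _)%R; apply: perm_hmonom.
  by rewrite -[s in perm_eq s _](cat_take_drop d) perm_catC.
have [prod0 _ _] := leading_form_polyprod r f.
rewrite to_poly_prod ?prod0 // ?sumn_cat ?size_take ?size_mkseq.
- by case: ltnP => //; lia.
- by rewrite sumn_take_mkseq ?leq_addr.
by rewrite addnC -sumn_cat cat_take_drop sum_s.
Qed.

Lemma to_poly_prod_cat s t : size t = d -> sumn t + sumn s <= M ->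
  (\sum_(l | (head_weight d l == D) && (weight l <= M)%N)
     u l * (schur_poly (take_rows d l) t * schur_poly (drop_rows d l) s)
   = polyprod [seq schur_poly (take_rows d (f i)) | i <- r] t
     * polyprod [seq schur_poly (drop_rows d (f i)) | i <- r] s)%R.
Proof.
move=> size_t le_st; have [_ prodE prod_take0] := leading_form_polyprod r f.
have [sum_t|ne_t] := eqVneq (sumn t) D; last first.
  rewrite prod_take0 // mul0r big1 // => l /andP[/eqP head_l _].
  have [->|/schur_poly_weight] := eqVneq (schur_poly (take_rows d l) t) 0%R.
    by rewrite mul0r mulr0.
  by rewrite weight_take head_l => eq_Dt; rewrite eq_Dt eqxx in ne_t.
rewrite -prodE // -to_poly_prod ?sumn_cat 1?addnC // /to_poly -/u big_mkcond.
apply: eq_bigr => l _ /=.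
case: ifP => [/andP[/eqP head_l _]|]; first by rewrite schur_poly_cat // head_l.
have [->|Kl_neq0] := eqVneq (schur_poly l (s ++ t)) 0%R; first by rewrite mulr0.
have -> : weight l <= M by rewrite (schur_poly_weight Kl_neq0) sumn_cat addnC.
rewrite andbT => /eqP ne_lD; rewrite prod_sigma_head ?mul0r //.
  by rewrite (schur_poly_weight Kl_neq0) sumn_cat addnC.
rewrite ltn_neqAle eq_sym; apply/andP; split; first exact/eqP.
by rewrite -sum_t leqNgt; apply: contra_neqN Kl_neq0 => /(schur_poly_cat_eq0 _ size_t).
Qed.

(* Both sides are the coefficients of the part of highest degree in the [d] variables. *)
Lemma prod_sigma_top n : weight n <= M -> head_weight d n = D ->
  u n = ((\prod_(i <- r) sigma (take_rows d (f i))) (take_rows d n)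
         * (\prod_(i <- r) sigma (drop_rows d (f i))) (drop_rows d n))%R.
Proof.
move=> le_nM head_n; pose Q l := (head_weight d l == D) && (weight l <= M).
pose A : R := (\prod_(i <- r) sigma (take_rows d (f i)))%R.
pose B : R := (\prod_(i <- r) sigma (drop_rows d (f i)))%R.
pose w q m := (\sum_(l | Q l && ((take_rows d l == q) && (drop_rows d l == m))) u l - A q * B m)%R.
have : w (take_rows d n) (drop_rows d n) = 0%R; last first.
  rewrite /w (big_pred1 n) => [/eqP|l]; first by rewrite subr_eq0 => /eqP.
  apply/andP/eqP => [[_ /andP[/eqP eq_take /eqP eq_drop]]|->].
    exact: eq_from_rows eq_take eq_drop.
  by rewrite /Q head_n !eqxx le_nM.
apply: to_poly2_inj => [s t size_t size_s le_st||]; last by rewrite weight_take -weight_split.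
  transitivity (\sum_(l | Q l) u l * (schur_poly (take_rows d l) t * schur_poly (drop_rows d l) s)
                - to_poly A t * to_poly B s : int)%R; last first.
    by rewrite to_poly_prod_cat // !to_poly_prod ?subrr //; lia.
  rewrite -(sum_take_drop Q u (fun q m => schur_poly q t * schur_poly m s)%R) mulr_suml -sumrB.
  apply: eq_bigr => q _; rewrite mulr_sumr -sumrB; apply: eq_bigr => m _.
  by rewrite mulrBl; congr (_ - _)%R; ring.
by rewrite take_rowsE ltnn.
Qed.

End Product.
End ExtremalCoefficients.

(** * Dominance *)

Section Dominance.
Variable M : nat.
Local Notation P := (ptn M).
Implicit Types (l n : P).

Definition excess t l : nat := \sum_(j < M) (l j - t).

Lemma weight_excess t l : weight l = head_weight t (conj l) + excess t l.
Proof. by rewrite head_weight_conj -big_split; apply: eq_bigr => j _ /=; lia. Qed.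

Lemma head_weight_excess x t l : head_weight x l <= x * t + excess t l.
Proof.
apply: (@leq_trans (\sum_(i < x) (t + (l i - t)))); first by apply: leq_sum => i _; lia.
rewrite big_split /= -mul_sum_ord leq_add2l.
by apply: (@leq_sum_support M x (fun j => l j - t)) => i /(prow_out l)->.
Qed.

Lemma excess_head_weight a n : a * n a + excess (n a) n <= head_weight a n.
Proof.
apply: (@leq_trans (a * n a + \sum_(j < a) (n j - n a))).
  rewrite leq_add2l; apply: (@leq_sum_support a M (fun j => n j - n a)) => i /(prow_leq n).
  by lia.
rewrite mul_sum_ord -big_split; apply: leq_sum => i _ /=.
by have := prow_leq n (ltnW (ltn_ord i)); lia.
Qed.

(* The bound of [prod_sigma_head] on the first columns, taken at column [n a], turns into a
   bound on the first [a] rows. *)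
Lemma prod_sigma_dominance (I : Type) (r : seq I) (x : I -> nat) (f : I -> P) n
    (a := \sum_(i <- r) x i) :
  weight n <= M -> (\prod_(i <- r) sigma (f i))%R n != 0%R ->
  \sum_(i <- r) head_weight (x i) (f i) <= head_weight a n.
Proof.
move=> leM un_neq0; set t := n a.
have sum_weight : \sum_(i <- r) weight (f i) = weight n by rewrite -(homogeneous_prod un_neq0).
have le_t : head_weight t (conj n) <= \sum_(i <- r) head_weight t (conj (f i)).
  rewrite leqNgt; apply: contra_neqN un_neq0 => lt_t.
  by rewrite -[n]conjK -prod_sigma_conj (prod_sigma_head _ lt_t) ?weight_conj.
apply: leq_trans (excess_head_weight a n); rewrite -/t.
apply: (@leq_trans (\sum_(i <- r) (x i * t + excess t (f i)))).
  by apply: leq_sum => i _; exact: head_weight_excess.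
rewrite big_split /= -big_distrl /= -/a leq_add2l; move: sum_weight.
by under eq_bigr => i _ do rewrite (weight_excess t); rewrite big_split (weight_excess t n) /=; lia.
Qed.

End Dominance.

(** * Removing full columns *)

Section Columns.
Variables M d : nat.
Hypothesis le_dM : d <= M.
Local Notation P := (ptn M).
Local Notation R := (schubert_ring M).
Implicit Types (l m n : P) (u v w : R).

(* Congruence modulo the ideal spanned by the partitions with more than [d] rows. *)
Definition short_eq u v := forall n, n d = 0 -> u n = v n.

Lemma short_eq_mul w u v : short_eq u v -> short_eq (w * u)%R (w * v)%R.
Proof.
move=> eq_uv; elim/pieri_ind: w => [|k w IHw|w w' IHw IHw'] n short_n.
- by rewrite sigma0 !mul1r eq_uv.
- rewrite -!hpieriM !ffunE; apply: eq_bigr => m /hstrip_byP[/hstrip_sub le_mn _].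
  by apply: IHw; have := le_mn d; rewrite short_n leqn0 => /eqP.
by rewrite !mulrBl !schubert_coefB IHw ?IHw'.
Qed.

Lemma short_eqM u u' v v' : short_eq u u' -> short_eq v v' -> short_eq (u * v)%R (u' * v')%R.
Proof.
move=> eq_u eq_v n short_n; rewrite (short_eq_mul u eq_v short_n) mulrC [in RHS]mulrC.
exact: short_eq_mul short_n.
Qed.

Definition add_columns k l : P := mkptn M (fun i => if i < d then l i + k else 0).

Lemma add_columnsE k l i : l 0 + k <= M -> add_columns k l i = if i < d then l i + k else 0.
Proof.
move=> leM; apply: mkptnE; split=> [j||].
- by have := prowS l j; case: ifP; case: ifP; lia.
- by case: ifP => // _; lia.
by rewrite ltnNge le_dM.
Qed.

Lemma weight_add_columns k l :
  l 0 + k <= M -> l d = 0 -> weight (add_columns k l) = weight l + d * k.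
Proof.
move=> leM short_l; rewrite (@weight_short _ d) ?add_columnsE ?ltnn // (weight_short short_l).
rewrite mul_sum_ord -big_split; apply: eq_bigr => i _ /=.
by rewrite add_columnsE // ltn_ord.
Qed.

Lemma add_columns0 l : l d = 0 -> add_columns 0 l = l.
Proof.
move=> short_l; apply: ptnP => i _; rewrite add_columnsE ?addn0 ?prow_max //.
by case: ltnP => // /(prow_leq l); lia.
Qed.

Lemma add_columnsS k l : l 0 + k.+1 <= M ->
  add_columns k.+1 l = add_columns 1 (add_columns k l).
Proof.
move=> leM; have le_kM : l 0 + k <= M by lia.
have first_row : add_columns k l 0 + 1 <= M by rewrite add_columnsE //; case: ifP; lia.
apply: ptnP => i _; rewrite (add_columnsE _ first_row) !add_columnsE //.
by case: ifP; lia.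
Qed.

Lemma vstrip_by_add_column l n : l 0 < M -> l d = 0 -> n d = 0 ->
  vstrip_by d n l = (n == add_columns 1 l).
Proof.
move=> l0 short_l short_n; have leM : l 0 + 1 <= M by lia.
apply/vstrip_byP/eqP => [[/vstripP strip weight_n]|->].
  apply: eq_from_weight; last by rewrite weight_add_columns // muln1.
  by move=> i; rewrite add_columnsE //; case: ltnP => [_|/(prow_leq n)]; have := strip i; lia.
split; last by rewrite weight_add_columns // muln1.
by apply/vstripP => i; rewrite add_columnsE //; case: ltnP => [_|/(prow_leq l)]; lia.
Qed.

Lemma vpieri_add_column u l : l 0 < M -> l d = 0 -> vpieri d u (add_columns 1 l) = u l.
Proof.
move=> l0 short_l; have leM : l 0 + 1 <= M by lia.
rewrite ffunE (big_pred1 l) // => m; apply/vstrip_byP/eqP => [[/vstripP strip]|->].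
  rewrite weight_add_columns // muln1 => weight_m; apply/esym/eq_from_weight; last by lia.
  by move=> i; have := strip i; rewrite add_columnsE //; case: ltnP => [_|/(prow_leq l)]; lia.
rewrite weight_add_columns // muln1; split=> //; apply/vstripP => i; rewrite add_columnsE //.
by case: ltnP => [_|/(prow_leq l)]; lia.
Qed.

Lemma vpieri_sigma_short l : l 0 < M -> l d = 0 ->
  short_eq (vpieri d (sigma l)) (sigma (add_columns 1 l)).
Proof.
move=> l0 short_l n short_n; rewrite [RHS]ffunE -vstrip_by_add_column // ffunE.
rewrite big_mkcond (bigD1 l) //=.
rewrite big1 ?addr0 => [|m ne_ml]; rewrite ffunE; first by rewrite eqxx; case: vstrip_by.
by rewrite (negPf ne_ml) if_same.
Qed.

Lemma sigma_add_columns k l : l 0 + k <= M -> l d = 0 ->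
  short_eq (sigma (add_columns k l)) (vpieri d 1 ^+ k * sigma l)%R.
Proof.
move=> + short_l; elim: k => [|k IHk] leM; first by rewrite add_columns0 // expr0 mul1r.
have le_kM : l 0 + k <= M by lia.
move=> n short_n; rewrite add_columnsS // -vpieri_sigma_short //; last first.
- by rewrite add_columnsE // ltnn.
- by rewrite add_columnsE //; case: ifP; lia.
rewrite -[sigma _]mul1r vpieriM exprS -mulrA; apply: short_eq_mul short_n; exact: IHk.
Qed.

Lemma vpieri_exp_add_columns k u n : n d = 0 -> n 0 + k <= M ->
  (vpieri d 1 ^+ k * u)%R (add_columns k n) = u n.
Proof.
move=> short_n; elim: k => [|k IHk] leM; first by rewrite add_columns0 // expr0 mul1r.
have le_kM : n 0 + k <= M by lia.
rewrite exprS -mulrA -vpieriM mul1r add_columnsS // vpieri_add_column ?IHk //.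
  by rewrite add_columnsE //; case: ifP; lia.
by rewrite add_columnsE // ltnn.
Qed.

Lemma prod_sigma_add_columns (I : eqType) (r : seq I) (k : I -> nat) (f : I -> P) n
    (K := \sum_(i <- r) k i) :
  (forall i, i \in r -> f i 0 + k i <= M /\ f i d = 0) -> n d = 0 -> n 0 + K <= M ->
  (\prod_(i <- r) sigma (add_columns (k i) (f i)))%R (add_columns K n)
  = (\prod_(i <- r) sigma (f i))%R n.
Proof.
move=> fP short_n leM; rewrite -(vpieri_exp_add_columns _ short_n leM).
have : add_columns K n d = 0 by rewrite add_columnsE // ltnn.
move: (add_columns K n) => {leM}; rewrite {}/K; elim: r fP => [|i r IHr] fP m short_m.
  by rewrite !big_nil expr0 mul1r.
have [leM short_f] := fP i (mem_head _ _).
rewrite !big_cons exprD mulrACA; apply: short_eqM short_m; first exact: sigma_add_columns.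
by move=> q; apply: IHr => j r_j; apply: fP; rewrite in_cons r_j orbT.
Qed.

End Columns.
Global Opaque add_columns.

(** * Corners *)

Section Corners.
Variable M : nat.
Local Notation P := (ptn M).
Implicit Types (l m n : P).

(* Both kinds of composed conditions have this shape: the [x] by [e] rectangle with
   [m] attached on its right and [l] below it. *)
Definition corner (x e : nat) m l : P := stack x (add_columns x e m) l.

Definition fits_corner (x e : nat) m l :=
  [/\ x <= M, e + m 0 <= M, l 0 <= e, l (M - x) = 0 & m x = 0].

Section FitsCorner.
Variables (x e : nat) (m l : P).
Hypothesis fits : fits_corner x e m l.

Let add_columns_corner i : add_columns x e m i = if i < x then e + m i else 0.
Proof. by case: fits => le_xM le_eM _ _ _; rewrite add_columnsE 1?addnC // addnC. Qed.

Let lower_row i : i < x -> l 0 <= add_columns x e m i.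
Proof. by case: fits => _ _ le_le _ _ lt_ix; rewrite add_columns_corner lt_ix; lia. Qed.

Lemma cornerE i : corner x e m l i = if i < x then e + m i else l (i - x).
Proof.
case: fits => _ _ _ l_out _; rewrite (stackE lower_row l_out) add_columns_corner.
by case: (i < x).
Qed.

Lemma take_corner : take_rows x (corner x e m l) = add_columns x e m.
Proof.
case: fits => _ _ _ l_out _; rewrite take_stack //; apply: ptnP => i _.
by rewrite take_rowsE add_columns_corner; case: (i < x).
Qed.

Lemma drop_corner : drop_rows x (corner x e m l) = l.
Proof. by case: fits => _ _ _ l_out _; rewrite drop_stack. Qed.

Lemma head_weight_corner : head_weight x (corner x e m l) = weight m + x * e.
Proof.
case: fits => le_xM le_eM _ _ short_m.
by rewrite -weight_take take_corner weight_add_columns // addnC.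
Qed.

Lemma weight_corner : weight (corner x e m l) = weight m + x * e + weight l.
Proof. by rewrite (weight_split x) head_weight_corner drop_corner. Qed.

Lemma fits_corner_conj : fits_corner e x (conj l) (conj m).
Proof.
case: fits => le_xM le_eM le_le l_out short_m.
have : conj l 0 <= M - x by rewrite leq_conj l_out.
split; rewrite ?leq_conj ?short_m //; try lia; last by apply/eqP; rewrite conj_eq0.
by apply/eqP; rewrite conj_eq0; lia.
Qed.

End FitsCorner.

Lemma conj_corner x e m l : fits_corner x e m l ->
  conj (corner x e m l) = corner e x (conj l) (conj m).
Proof.
move=> fits; have [_ _ le_le _ short_m] := fits.
apply: ptnP => i _; rewrite (cornerE (fits_corner_conj fits)); apply: eq_ltn => k.
rewrite ltn_conj (cornerE fits).
case: (ltnP k x) => [lt_kx|le_xk]; case: (ltnP i e) => [lt_ie|le_ei].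
- by rewrite !ltn_addr.
- by rewrite ltn_conj; lia.
- by have := ltn_conj l (k - x) i; lia.
rewrite ltn_conj; have := prow_leq m le_xk; have := prow_leq l (leq0n (k - x)); lia.
Qed.

Lemma prod_sigma_corner (I : eqType) (r : seq I) x (e : I -> nat) (f g : I -> P) m l
    (E := \sum_(i <- r) e i) :
  (forall i, i \in r -> fits_corner x (e i) (f i) (g i)) -> fits_corner x E m l ->
  weight (corner x E m l) <= M -> \sum_(i <- r) weight (f i) <= weight m ->
  (\prod_(i <- r) sigma (corner x (e i) (f i) (g i)))%R (corner x E m l)
  = ((\prod_(i <- r) sigma (f i))%R m * (\prod_(i <- r) sigma (g i))%R l)%R.
Proof.
move=> fits_r fits leM; have [le_xM le_EM _ _ short_m] := fits.
have head_r : \sum_(i <- r) head_weight x (corner x (e i) (f i) (g i))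
    = \sum_(i <- r) weight (f i) + x * E.
  by rewrite -sum_nat_distr; apply: eq_big_seq => i /fits_r/head_weight_corner.
rewrite leq_eqVlt => /predU1P[weight_m|lt_m]; last first.
  rewrite (prod_sigma_head (d := x)) // ?head_r ?head_weight_corner ?ltn_add2r //.
  have [->|/(@homogeneous_prod M I r f)] := eqVneq ((\prod_(i <- r) sigma (f i))%R m) 0%R.
    by rewrite mul0r.
  by lia.
rewrite (prod_sigma_top (d := x)) // ?head_r ?head_weight_corner ?weight_m //.
rewrite take_corner // drop_corner //; congr (_ * _)%R.
  have fits_columns i : i \in r -> f i 0 + e i <= M /\ f i x = 0.
    by move=> /fits_r[_ ? _ _ ?]; rewrite addnC.
  transitivity ((\prod_(i <- r) sigma (add_columns x (e i) (f i)))%R (add_columns x E m)).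
    by congr (fun_of_fin _ _); apply: eq_big_seq => i /fits_r/take_corner->.
  by apply: prod_sigma_add_columns; rewrite // addnC.
by congr (fun_of_fin _ _); apply: eq_big_seq => i /fits_r/drop_corner->.
Qed.

Lemma prod_sigma_corner_conj (I : eqType) (r : seq I) e (x : I -> nat) (f g : I -> P) m l
    (X := \sum_(i <- r) x i) :
  (forall i, i \in r -> fits_corner (x i) e (f i) (g i)) -> fits_corner X e m l ->
  weight (corner X e m l) <= M -> \sum_(i <- r) weight (g i) <= weight l ->
  (\prod_(i <- r) sigma (corner (x i) e (f i) (g i)))%R (corner X e m l)
  = ((\prod_(i <- r) sigma (f i))%R m * (\prod_(i <- r) sigma (g i))%R l)%R.
Proof.
move=> fits_r fits leM le_l; rewrite -[corner X e m l]conjK -prod_sigma_conj conj_corner //.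
transitivity ((\prod_(i <- r) sigma (corner e (x i) (conj (g i)) (conj (f i))))%R
                (corner e X (conj l) (conj m))).
  by congr (fun_of_fin _ _); apply: eq_big_seq => i /fits_r/conj_corner->.
transitivity ((\prod_(i <- r) sigma (conj (g i)))%R (conj l)
              * (\prod_(i <- r) sigma (conj (f i)))%R (conj m))%R; last first.
  by rewrite mulrC; congr (_ * _)%R; rewrite prod_sigma_conj conjK.
apply: prod_sigma_corner => [i /fits_r/fits_corner_conj //|||].
- exact: fits_corner_conj.
- by rewrite -conj_corner // weight_conj.
by rewrite weight_conj; under eq_bigr => i _ do rewrite weight_conj.
Qed.

Lemma inbox_fits_corner x e b c m l : inbox x b m -> inbox c e l ->
  x + c <= M -> b + e <= M -> fits_corner x e m l.
Proof.
move=> /andP[le_mb /eqP short_m] /andP[le_le /eqP short_l] le_xcM le_beM; split=> //; try lia.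
by have : l (M - x) <= l c; [apply: prow_leq; lia | lia].
Qed.

Lemma inbox_corner x e b c m l : inbox x b m -> inbox c e l ->
  x + c <= M -> b + e <= M -> inbox (x + c) (b + e) (corner x e m l).
Proof.
move=> m_in l_in le_xcM le_beM; have fits := inbox_fits_corner m_in l_in le_xcM le_beM.
apply/inboxP => i; rewrite (cornerE fits).
have /inboxP/(_ i) := m_in; have /inboxP/(_ (i - x)) := l_in.
by case: (ltnP i x) => [lt_ix|le_xi]; case: ifP; case: ifP; lia.
Qed.

Lemma compl_corner a b c d m l : inbox a b m -> inbox c d l -> a + c <= M -> b + d <= M ->
  compl (a + c) (b + d) (corner a d m l) = corner c b (compl c d l) (compl a b m).
Proof.
move=> m_in l_in le_acM le_bdM; have [le_aM le_bM] : a <= M /\ b <= M by lia.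
have [le_cM le_dM] : c <= M /\ d <= M by lia.
have fits := inbox_fits_corner m_in l_in le_acM le_bdM.
have fits_compl : fits_corner c b (compl c d l) (compl a b m).
  by apply: inbox_fits_corner (inbox_compl le_cM le_dM l) (inbox_compl le_aM le_bM m) _ _;
     rewrite addnC.
apply: ptnP => i _; rewrite (complE le_acM le_bdM) (cornerE fits_compl) (cornerE fits).
rewrite (complE le_cM le_dM l) (complE le_aM le_bM m).
have /inboxP/(_ (a - (i - c).+1)) := m_in; have /inboxP/(_ (c - i.+1)) := l_in.
case: (ltnP i c) => [lt_ic|le_ci] l_bound m_bound; last first.
  case: (ltnP i (a + c)) => [lt_iac|le_aci]; last by rewrite ifN // -leqNgt; lia.
  rewrite !ifT; try lia.
  by rewrite (_ : a + c - i.+1 = a - (i - c).+1); lia.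
rewrite ifT ?ifN -?leqNgt; try lia.
by rewrite (_ : a + c - i.+1 - a = c - i.+1); [move: l_bound; rewrite ifT|]; lia.
Qed.

Definition corner_shaped (a d : nat) n : bool := [forall i : 'I_a, d <= n i] && (n a <= d).

Lemma corner_shapedP a d n :
  reflect ((forall i, i < a -> d <= n i) /\ n a <= d) (corner_shaped a d n).
Proof.
apply: (iffP andP) => [[/forallP ge_d le_d]|[ge_d le_d]]; split=> //.
  by move=> i lt_ia; exact: (ge_d (Ordinal lt_ia)).
by apply/forallP => i; exact: ge_d.
Qed.

Lemma corner_corner_shaped a d m l : fits_corner a d m l -> corner_shaped a d (corner a d m l).
Proof.
move=> fits; have [_ _ le_ld _ _] := fits; apply/corner_shapedP; split=> [i lt_ia|].
  by rewrite (cornerE fits) lt_ia leq_addr.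
by rewrite (cornerE fits) ltnn subnn.
Qed.

Definition drop_columns (d : nat) n : P := mkptn M (fun i => n i - d).

Lemma drop_columnsE d n i : drop_columns d n i = n i - d.
Proof.
apply: mkptnE; split=> [j||]; first by have := prowS n j; lia.
  by have := prow_max n 0; lia.
by rewrite prow_out.
Qed.

Opaque drop_columns.

Lemma drop_columns_corner a d m l : fits_corner a d m l ->
  drop_columns d (corner a d m l) = m.
Proof.
move=> fits; have [_ _ le_ld _ ma] := fits; apply: ptnP => i _.
rewrite drop_columnsE (cornerE fits); case: ltnP => [lt_ia|le_ai]; first by rewrite addKn.
by have := prow_leq m le_ai; have := prow_leq l (leq0n (i - a)); lia.
Qed.

Lemma corner_shaped_inbox a b c d n : corner_shaped a d n -> inbox (a + c) (b + d) n ->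
  inbox a b (drop_columns d n) && inbox c d (drop_rows a n).
Proof.
move=> /corner_shapedP[_ le_na] /andP[n0 n_out].
rewrite /inbox (drop_columnsE d n 0) (drop_columnsE d n a) (drop_rowsE a n 0) (drop_rowsE a n c).
rewrite addn0 le_na n_out andbT.
by apply/andP; split=> //; apply/andP; split; [|apply/eqP]; lia.
Qed.

Lemma corner_of_shaped a b c d n : corner_shaped a d n -> inbox (a + c) (b + d) n ->
  a + c <= M -> b + d <= M -> corner a d (drop_columns d n) (drop_rows a n) = n.
Proof.
move=> shaped n_in le_acM le_bdM; have /andP[m_in l_in] := corner_shaped_inbox shaped n_in.
have fits := inbox_fits_corner m_in l_in le_acM le_bdM.
have /corner_shapedP[ge_d le_na] := shaped.
apply: ptnP => i _; rewrite (cornerE fits) drop_columnsE drop_rowsE.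
by case: ltnP => [/ge_d|le_ai]; [lia | rewrite subnKC].
Qed.

Lemma sum_corner_shaped a b c d (G : P -> int) : a + c <= M -> b + d <= M ->
    (forall n, inbox (a + c) (b + d) n -> ~~ corner_shaped a d n -> G n = 0%R) ->
  (\sum_(n | inbox (a + c) (b + d) n) G n
   = \sum_(m | inbox a b m) \sum_(l | inbox c d l) G (corner a d m l))%R.
Proof.
move=> le_acM le_bdM G0; rewrite (bigID (corner_shaped a d)) /=.
rewrite [X in (_ + X)%R]big1 ?addr0; last first.
  by move=> n /andP[]; exact: G0.
rewrite pair_big /=.
apply: (reindex_bij_in (fun n => (drop_columns d n, drop_rows a n))
          (fun p => corner a d p.1 p.2)) => /= [n|[m l] /=|n].
- move=> /andP[n_in shaped]; rewrite (corner_shaped_inbox shaped n_in).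
  by rewrite (corner_of_shaped shaped n_in).
- move=> /andP[m_in l_in]; have fits := inbox_fits_corner m_in l_in le_acM le_bdM.
  by rewrite inbox_corner // corner_corner_shaped // drop_columns_corner // drop_corner.
by move=> /andP[n_in shaped]; rewrite (corner_of_shaped shaped n_in).
Qed.

Lemma corner_shaped_weight a d A n : a < A ->
  \sum_(i < A) (n i - d) + a * d <= head_weight a n -> corner_shaped a d n.
Proof.
pose f i := n i - d; rewrite -/(\sum_(i < A) f i) => lt_aA le_head.
have le_A := @leq_sum_ord a.+1 A f lt_aA; rewrite big_ord_recr /= in le_A.
have le_n (i : 'I_a) : n i <= d + f i by rewrite /f; lia.
have sum_f : \sum_(i < a) (d + f i) = a * d + \sum_(i < a) f i.
  by rewrite big_split /= -mul_sum_ord.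
have head_le : head_weight a n <= \sum_(i < a) (d + f i) by apply: leq_sum => i _.
have head_eq : head_weight a n = \sum_(i < a) (d + f i).
  apply/eqP; rewrite eqn_leq head_le sum_f (leq_trans _ le_head) // addnC leq_add2r.
  exact: leq_sum_ord (ltnW lt_aA).
have fa : f a = 0.
  have := leq_trans le_head head_le; rewrite sum_f addnC leq_add2l => /(leq_trans le_A).
  by rewrite -[leqRHS]addn0 leq_add2l leqn0 => /eqP.
apply/corner_shapedP; split=> [i lt_ia|]; last by rewrite /f in fa; lia.
by have /= := eq_from_leq_sum le_n head_eq (Ordinal lt_ia); rewrite /f; lia.
Qed.

End Corners.

(** * Composition *)

Section Composition.
Variables (M a b c d : nat).
Hypotheses (c_gt0 : 0 < c) (le_acM : a + c <= M) (le_bdM : b + d <= M).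
Hypothesis leM : (a + c) * (b + d) <= M.
Local Notation P := (ptn M).
Local Notation R := (schubert_ring M).
Implicit Types (l m n : P).

Variables (I J : eqType) (r : seq I) (s : seq J).
Variables (x : I -> nat) (mu alpha : I -> P) (y : J -> nat) (nu beta : J -> P).
Hypotheses (muP : forall i, i \in r -> inbox (x i) b (mu i))
           (alphaP : forall i, i \in r -> inbox c d (alpha i))
           (nuP : forall j, j \in s -> inbox a (y j) (nu j))
           (betaP : forall j, j \in s -> inbox c d (beta j)).
Hypotheses (sum_x : \sum_(i <- r) x i = a) (sum_y : \sum_(j <- s) y j = b).
Hypothesis weight_mu_nu :
  \sum_(i <- r) weight (mu i) + \sum_(j <- s) weight (nu j) = a * b.
Hypothesis weight_alpha_beta :
  \sum_(i <- r) weight (alpha i) + \sum_(j <- s) weight (beta j) = c * d.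

Let above : R := (\prod_(i <- r) sigma (corner (x i) d (mu i) (alpha i)))%R.
Let left : R := (\prod_(j <- s) sigma (corner c (y j) (beta j) (nu j)))%R.

Let fits_above i : i \in r -> fits_corner (x i) d (mu i) (alpha i).
Proof.
move=> r_i; apply: inbox_fits_corner (muP r_i) (alphaP r_i) _ le_bdM.
by have := leq_big_seq x r_i; rewrite sum_x; lia.
Qed.

Let fits_left j : j \in s -> fits_corner c (y j) (beta j) (nu j).
Proof.
move=> s_j; apply: inbox_fits_corner (betaP s_j) (nuP s_j) _ _; first by lia.
by have := leq_big_seq y s_j; rewrite sum_y; lia.
Qed.

Let weight_inboxM n : inbox (a + c) (b + d) n -> weight n <= M.
Proof. by move=> n_in; apply: leq_trans leM; exact: weight_inbox n_in. Qed.

Lemma head_weight_above n : weight n <= M -> above n != 0%R ->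
  \sum_(i <- r) weight (mu i) + d * a <= head_weight a n.
Proof.
move=> le_nM above_n_neq0; have := prod_sigma_dominance x le_nM above_n_neq0.
rewrite sum_x; apply: leq_trans.
rewrite -sum_x -sum_nat_distr; apply: eq_leq; apply: eq_big_seq => i /fits_above fits.
by rewrite head_weight_corner // mulnC.
Qed.

Lemma head_weight_conj_left n : weight n <= M -> left n != 0%R ->
  \sum_(j <- s) weight (nu j) + c * b <= head_weight b (conj n).
Proof.
move=> le_nM; rewrite -[n in left n]conjK -[left _]prod_sigma_conj -weight_conj in le_nM *.
move=> /(prod_sigma_dominance y le_nM); rewrite sum_y; apply: leq_trans.
rewrite -sum_y -sum_nat_distr; apply: eq_leq; apply: eq_big_seq => j /fits_left fits.
rewrite conj_corner // head_weight_corner ?weight_conj 1?mulnC //.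
exact: fits_corner_conj.
Qed.

Lemma head_weight_conj_compl n : inbox (a + c) (b + d) n ->
  head_weight b (conj (compl (a + c) (b + d) n)) + \sum_(i < a + c) (n i - d) <= (a + c) * b.
Proof.
move=> /inboxP n_in; set n' := compl _ _ n.
apply: (@leq_trans (\sum_(i < a + c) minn (b + d - n i) b + \sum_(i < a + c) (n i - d))).
  rewrite leq_add2r head_weight_conj.
  apply: leq_trans (@leq_sum_support (a + c) M (fun i => minn (n' i) b) _) _.
    by move=> i le_i; rewrite complE // ltnNge le_i min0n.
  rewrite [leqRHS](reindex_inj rev_ord_inj) /=; apply: eq_leq; apply: eq_bigr => i _.
  by rewrite complE // ltn_ord.
rewrite -big_split mul_sum_ord; apply: leq_sum => i _ /=.
by have := n_in i; rewrite ltn_ord; lia.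
Qed.

Lemma corner_shaped_support n : inbox (a + c) (b + d) n ->
  above n != 0%R -> left (compl (a + c) (b + d) n) != 0%R -> corner_shaped a d n.
Proof.
move=> n_in above_n_neq0 left_n_neq0; apply: (@corner_shaped_weight _ a d (a + c)); first by lia.
have := head_weight_above (weight_inboxM n_in) above_n_neq0.
have := head_weight_conj_left (weight_inboxM (inbox_compl le_acM le_bdM n)) left_n_neq0.
have := head_weight_conj_compl n_in; move: weight_mu_nu.
by rewrite mulnDl [d * a]mulnC; lia.
Qed.

Lemma above_coef m l : inbox a b m -> inbox c d l ->
  \sum_(i <- r) weight (alpha i) <= weight l ->
  above (corner a d m l)
  = ((\prod_(i <- r) sigma (mu i))%R m * (\prod_(i <- r) sigma (alpha i))%R l)%R.
Proof.
move=> m_in l_in le_l; rewrite /above -[in corner a]sum_x; apply: prod_sigma_corner_conj => //.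
  by rewrite sum_x; exact: inbox_fits_corner m_in l_in le_acM le_bdM.
by rewrite sum_x; apply/weight_inboxM/inbox_corner.
Qed.

Lemma left_coef m l : inbox a b m -> inbox c d l ->
  \sum_(j <- s) weight (beta j) <= weight l ->
  left (corner c b l m)
  = ((\prod_(j <- s) sigma (beta j))%R l * (\prod_(j <- s) sigma (nu j))%R m)%R.
Proof.
move=> m_in l_in le_l; have [le_caM le_dbM] : c + a <= M /\ d + b <= M by lia.
rewrite /left -[in corner c b]sum_y; apply: prod_sigma_corner; rewrite ?sum_y //.
  exact: inbox_fits_corner l_in m_in le_caM le_dbM.
by apply: weight_inboxM; rewrite (addnC a) (addnC b); exact: inbox_corner.
Qed.

Lemma above_left_coef m l : inbox a b m -> inbox c d l ->
  (above (corner a d m l) * left (corner c b (compl c d l) (compl a b m))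
   = (\prod_(i <- r) sigma (mu i)) m * (\prod_(j <- s) sigma (nu j)) (compl a b m)
     * ((\prod_(i <- r) sigma (alpha i)) l * (\prod_(j <- s) sigma (beta j)) (compl c d l)))%R.
Proof.
move=> m_in l_in; have [le_aM le_bM] : a <= M /\ b <= M by lia.
have [le_cM le_dM] : c <= M /\ d <= M by lia.
have weight_l := weight_compl le_cM le_dM l_in.
have left_coef_l := left_coef (inbox_compl le_aM le_bM m) (inbox_compl le_cM le_dM l).
have [le_l|lt_l] := leqP (\sum_(i <- r) weight (alpha i)) (weight l).
  rewrite above_coef //; have [->|/(@homogeneous_prod _ _ r alpha) weight_l_alpha] :=
    eqVneq ((\prod_(i <- r) sigma (alpha i))%R l) 0%R; first by ring.
  by rewrite left_coef_l; [ring | lia].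
have -> : (\prod_(i <- r) sigma (alpha i))%R l = 0%R.
  by apply/eqP; apply: contraTT lt_l => /(@homogeneous_prod _ _ r alpha)->; rewrite -leqNgt.
rewrite left_coef_l; last by lia.
have [->|/(@homogeneous_prod _ _ s beta)] :=
  eqVneq ((\prod_(j <- s) sigma (beta j))%R (compl c d l)) 0%R; first by ring.
by lia.
Qed.

Theorem prod_sigma_compose :
  ((above * left) (box_ptn M (a + c) (b + d))
   = (\prod_(i <- r) sigma (mu i) * \prod_(j <- s) sigma (nu j)) (box_ptn M a b)
     * (\prod_(i <- r) sigma (alpha i) * \prod_(j <- s) sigma (beta j)) (box_ptn M c d))%R.
Proof.
have [le_aM le_bM] : a <= M /\ b <= M by lia.
have [le_cM le_dM] : c <= M /\ d <= M by lia.
rewrite !box_duality // sum_corner_shaped // => [|n n_in]; last first.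
  apply: contraNeq; rewrite mulf_eq0 negb_or => /andP[].
  exact: corner_shaped_support.
rewrite mulr_suml; apply: eq_bigr => m m_in; rewrite mulr_sumr; apply: eq_bigr => l l_in.
by rewrite compl_corner // above_left_coef.
Qed.

End Composition.

(** * Semistandard tableaux *)

Lemma mem_seqs_below len N t : (t \in seqs_below len N) = (size t == len) && all (gtn N) t.
Proof.
elim: len t => [|len IHlen] t; first by case: t.
apply/allpairsP/idP => [[[x s] /= [x_N s_in ->]]|].
  move: s_in; rewrite IHlen /= eqSS => /andP[-> ->].
  by rewrite mem_iota add0n /= in x_N; rewrite x_N.
case: t => // x s; rewrite /= eqSS => /and3P[size_s x_N s_N]; exists (x, s) => /=.
by rewrite mem_iota IHlen size_s.
Qed.

Lemma seqs_below_uniq len N : uniq (seqs_below len N).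
Proof.
elim: len => //= len IHlen; apply: allpairs_uniq; rewrite ?iota_uniq //.
by move=> [x s] [y t] _ _ /= [-> ->].
Qed.

Lemma mem_fillings sh N (T : seq (seq nat)) :
  (T \in fillings sh N) = (map size T == sh) && all (all (gtn N)) T.
Proof.
elim: sh T => [|r sh IHsh] T; first by case: T.
apply/allpairsP/idP => [[[x s] /= [x_N s_in ->]]|].
  move: s_in x_N; rewrite IHsh mem_seqs_below /= eqseq_cons.
  by move=> /andP[-> ->] /andP[-> ->].
case: T => // x s; rewrite /= eqseq_cons => /andP[/andP[size_x size_s] /andP[x_N s_N]].
by exists (x, s) => /=; rewrite mem_seqs_below IHsh size_x x_N size_s.
Qed.

Lemma fillings_uniq sh N : uniq (fillings sh N).
Proof.
elim: sh => //= r sh IHsh; apply: allpairs_uniq; rewrite ?seqs_below_uniq //.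
by move=> [x s] [y t] _ _ /= [-> ->].
Qed.

Lemma is_ssytP (T : seq (seq nat)) :
  reflect ((forall i, sorted leq (nth [::] T i)) /\
           (forall i j, j < size (nth [::] T i.+1) ->
              nth 0 (nth [::] T i) j < nth 0 (nth [::] T i.+1) j)) (is_ssyt T).
Proof.
apply: (iffP andP) => -[rows columns]; split.
- move=> i; case: (ltnP i (size T)) => lt_iT; last by rewrite nth_default.
  by apply: (allP rows); exact: mem_nth.
- move=> i j lt_j; case: (ltnP i.+1 (size T)) => lt_iT; last by rewrite nth_default in lt_j.
  have /allP/(_ i) := columns; rewrite mem_iota; case: (size T) lt_iT => // r lt_ir.
  by move=> /(_ lt_ir)/allP/(_ j); rewrite mem_iota; exact.
- by apply/allP => r /(nthP [::])[i _ <-].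
by apply/allP => i _; apply/allP => j; rewrite mem_iota; exact: columns.
Qed.

Lemma size_nth_nil (T : seq (seq nat)) i : size (nth [::] T i) = nth 0 (map size T) i.
Proof.
case: (ltnP i (size T)) => lt_iT; first by rewrite (nth_map [::]).
by rewrite !nth_default ?size_map.
Qed.

Lemma all_nth_nil (p : pred nat) (T : seq (seq nat)) i : all (all p) T -> all p (nth [::] T i).
Proof.
move=> T_p; case: (ltnP i (size T)) => lt_iT; last by rewrite nth_default.
by apply: (allP T_p); exact: mem_nth.
Qed.

Definition tableau (sh : seq nat) (N : nat) (T : seq (seq nat)) : bool :=
  (T \in fillings sh N) && is_ssyt T.

Lemma tableauP sh N T :
  reflect [/\ map size T = sh, all (all (gtn N)) T, forall i, sorted leq (nth [::] T i)
            & forall i j, j < nth 0 sh i.+1 ->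
                nth 0 (nth [::] T i) j < nth 0 (nth [::] T i.+1) j]
          (tableau sh N T).
Proof.
rewrite /tableau mem_fillings; apply: (iffP andP).
  move=> [/andP[/eqP shape_T T_N] /is_ssytP[rows columns]]; split=> // i j.
  by rewrite -shape_T -size_nth_nil; exact: columns.
move=> [shape_T T_N rows columns]; rewrite shape_T eqxx T_N; split=> //; apply/is_ssytP.
by split=> // i j; rewrite size_nth_nil shape_T; exact: columns.
Qed.

Lemma kostka_tableau N sh m :
  kostka N sh m = count (fun T => tableau sh N T && (content N T == m)) (fillings sh N).
Proof. by apply: eq_in_count => T T_in; rewrite /tableau T_in. Qed.

Lemma sorted_filter_ltn N (s : seq nat) : sorted leq s -> all (gtn N.+1) s ->
  s = [seq x <- s | x < N] ++ nseq (size s - size [seq x <- s | x < N]) N.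
Proof.
elim: s => //= x s IHs sorted_s /andP[x_N s_N].
have {}IHs := IHs (path_sorted sorted_s) s_N.
case: ltnP => [_|le_Nx] /=; first by rewrite subSS -IHs.
have eq_xN : x = N by lia.
have s_eqN : all (pred1 N) s.
  apply/allP => y s_y /=; have := allP s_N y s_y => /=.
  by have := allP (order_path_min leq_trans sorted_s) y s_y => /=; lia.
have -> : [seq x <- s | x < N] = [::].
  rewrite (eq_in_filter (a2 := pred0)) ?filter_pred0 // => y s_y /=.
  by have /eqP -> := allP s_eqN y s_y; rewrite ltnn.
by rewrite eq_xN /=; congr (_ :: _); apply/all_pred1P.
Qed.

Definition restrict N (T : seq (seq nat)) : seq (seq nat) :=
  [seq [seq x <- r | x < N] | r <- T].
Definition extend N (sh : seq nat) (T : seq (seq nat)) : seq (seq nat) :=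
  mkseq (fun i => nth [::] T i ++ nseq (nth 0 sh i - size (nth [::] T i)) N) (size sh).

Lemma nth_restrict N T i : nth [::] (restrict N T) i = [seq x <- nth [::] T i | x < N].
Proof.
case: (ltnP i (size T)) => lt_iT; first by rewrite (nth_map [::]).
by rewrite !nth_default ?size_map.
Qed.

Lemma flatten_restrict N T : flatten (restrict N T) = [seq x <- flatten T | x < N].
Proof. by rewrite filter_flatten. Qed.

Lemma content_restrict N T :
  content N.+1 T = rcons (content N (restrict N T)) (count_mem N (flatten T)).
Proof.
rewrite /content -addn1 iotaD map_cat cats1 add0n; congr (rcons _ _).
apply/eq_in_map => i; rewrite mem_iota flatten_restrict count_filter => lt_iN.
by apply: eq_count => x /=; case: eqP => // ->; rewrite lt_iN.
Qed.

Lemma sumn_shape_restrict N T : all (all (gtn N.+1)) T ->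
  sumn (map size T) = sumn (map size (restrict N T)) + count_mem N (flatten T).
Proof.
move=> T_N; rewrite -[map size T]/(shape T) -[map size _]/(shape (restrict N T)).
rewrite -!size_flatten flatten_restrict size_filter -(count_predC (fun x => x < N)).
congr (_ + _); apply: eq_in_count => x /flattenP[r /(allP T_N) r_N r_x] /=.
by have := allP r_N x r_x => /=; lia.
Qed.

Definition interlaces (sh rh : seq nat) : Prop :=
  size rh = size sh /\ forall i, nth 0 sh i.+1 <= nth 0 rh i <= nth 0 sh i.

Section Restrict.
Variables (N : nat) (sh : seq nat) (T : seq (seq nat)).
Hypotheses (sh_nonincr : forall i, nth 0 sh i.+1 <= nth 0 sh i).
Hypothesis T_tableau : tableau sh N.+1 T.

Let rh := map size (restrict N T).

Let shape_T : map size T = sh. Proof. by case/tableauP: T_tableau. Qed.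
Let T_N : all (all (gtn N.+1)) T. Proof. by case/tableauP: T_tableau. Qed.

Let size_row i : size (nth [::] T i) = nth 0 sh i.
Proof. by rewrite size_nth_nil shape_T. Qed.

Let rhE i : nth 0 rh i = size [seq x <- nth [::] T i | x < N].
Proof. by rewrite -size_nth_nil nth_restrict. Qed.

Let row_split i : nth [::] T i
  = [seq x <- nth [::] T i | x < N] ++ nseq (nth 0 sh i - nth 0 rh i) N.
Proof.
rewrite rhE -size_row; apply: sorted_filter_ltn; last exact: all_nth_nil.
by case/tableauP: T_tableau.
Qed.

Lemma restrict_interlaces : interlaces sh rh.
Proof.
split=> [|i]; first by rewrite /rh /restrict !size_map -shape_T size_map.
apply/andP; split; last by rewrite rhE size_filter -size_row count_size.
rewrite leqNgt; apply/negP => lt_rh; have [_ _ _ columns] := tableauP _ _ _ T_tableau.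
have := columns i _ lt_rh; rewrite {1}row_split nth_cat -rhE ltnn subnn nth_nseq.
rewrite ifT; last by have := sh_nonincr i; lia.
have : nth 0 (nth [::] T i.+1) (nth 0 rh i) < N.+1.
  by apply: (allP (all_nth_nil i.+1 T_N)); apply: mem_nth; rewrite size_row.
by rewrite ltnS leqNgt => /negP.
Qed.

Lemma restrict_tableau : tableau rh N (restrict N T).
Proof.
have [_ _ rows columns] := tableauP _ _ _ T_tableau.
have [_ rh_sh] := restrict_interlaces.
have nth_row i j : j < nth 0 rh i ->
    nth 0 (nth [::] (restrict N T) i) j = nth 0 (nth [::] T i) j.
  by rewrite nth_restrict rhE => lt_j; rewrite [in RHS]row_split nth_cat lt_j.
apply/tableauP; split=> // [|i|i j lt_j].
- by apply/allP => _ /mapP[r _ ->]; exact: filter_all.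
- by rewrite nth_restrict; apply: sorted_filter => //; exact: leq_trans.
have := rh_sh i; have := rh_sh i.+1 => bound_S bound.
by rewrite !nth_row //; [apply: columns|]; lia.
Qed.

Lemma restrictK : extend N sh (restrict N T) = T.
Proof.
apply: (@eq_from_nth _ [::]) => [|i]; rewrite size_mkseq; first by rewrite -shape_T size_map.
by move=> lt_i; rewrite nth_mkseq // nth_restrict -rhE -row_split.
Qed.

End Restrict.

Section Extend.
Variables (N : nat) (sh rh : seq nat) (T : seq (seq nat)).
Hypotheses (rh_sh : interlaces sh rh) (T_tableau : tableau rh N T).

Let bounds i : nth 0 sh i.+1 <= nth 0 rh i <= nth 0 sh i. Proof. exact: rh_sh.2. Qed.
Let shape_T : map size T = rh. Proof. by case/tableauP: T_tableau. Qed.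
Let T_N : all (all (gtn N)) T. Proof. by case/tableauP: T_tableau. Qed.

Let size_row i : size (nth [::] T i) = nth 0 rh i.
Proof. by rewrite size_nth_nil shape_T. Qed.

Lemma nth_extend i :
  nth [::] (extend N sh T) i = nth [::] T i ++ nseq (nth 0 sh i - nth 0 rh i) N.
Proof.
case: (ltnP i (size sh)) => le_i; first by rewrite nth_mkseq // size_row.
rewrite [LHS]nth_default ?size_mkseq // [nth 0 sh i]nth_default // sub0n cats0.
by rewrite nth_default // -(size_map size) shape_T rh_sh.1.
Qed.

Lemma extend_sorted i : sorted leq (nth [::] (extend N sh T) i).
Proof.
have [_ _ rows _] := tableauP _ _ _ T_tableau.
rewrite nth_extend (sorted_pairwise leq_trans) pairwise_cat -(sorted_pairwise leq_trans) rows /=.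
rewrite -(sorted_pairwise leq_trans); apply/andP; split; last first.
  by elim: (_ - _) => // -[|r] //= IHr; rewrite leqnn.
apply/allrelP => x y T_x; rewrite mem_nseq => /andP[_ /eqP->].
by have := allP (all_nth_nil i T_N) x T_x => /=; lia.
Qed.

Lemma extend_tableau : tableau sh N.+1 (extend N sh T).
Proof.
have [_ _ _ columns] := tableauP _ _ _ T_tableau.
apply/tableauP; split=> [||i|i j lt_j]; last 2 first.
- exact: extend_sorted.
- have := bounds i; have := bounds i.+1 => bound_S bound.
  rewrite !nth_extend !nth_cat !size_row ifT; last by lia.
  case: (ltnP j (nth 0 rh i.+1)) => le_j; first exact: columns.
  rewrite nth_nseq ifT; last by lia.
  by apply: (allP (all_nth_nil i T_N)); apply: mem_nth; rewrite size_row; lia.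
- apply: (@eq_from_nth _ 0) => [|i]; rewrite size_map size_mkseq // => lt_i.
  rewrite (nth_map [::]) ?size_mkseq // nth_extend size_cat size_nseq size_row.
  by have := bounds i; lia.
apply/allP => _ /(nthP [::])[i _ <-]; rewrite nth_extend all_cat all_nseq /= ltnSn orbT andbT.
by apply: sub_all (all_nth_nil i T_N) => x /=; lia.
Qed.

Lemma extendK : restrict N (extend N sh T) = T.
Proof.
apply: (@eq_from_nth _ [::]).
  by rewrite !size_map size_iota -rh_sh.1 -shape_T size_map.
move=> i _; rewrite nth_restrict nth_extend filter_cat [X in _ ++ X](_ : _ = [::]) ?cats0.
  by apply/all_filterP; exact: all_nth_nil.
by elim: (_ - _) => //= r IHr; rewrite ltnn.
Qed.

End Extend.

Lemma count_leq_inj (T U : eqType) (s : seq T) (t : seq U) (p : pred T) (q : pred U)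
    (f : T -> U) (g : U -> T) : uniq s ->
  (forall x, x \in s -> p x -> [/\ f x \in t, q (f x) & g (f x) = x]) ->
  count p s <= count q t.
Proof.
move=> uniq_s f_inj; rewrite -!size_filter -(size_map f); apply: uniq_leq_size.
  rewrite map_inj_in_uniq ?filter_uniq // => x y; rewrite !mem_filter.
  move=> /andP[px s_x] /andP[py s_y] eq_f.
  by have [_ _ <-] := f_inj x s_x px; have [_ _ <-] := f_inj y s_y py; rewrite eq_f.
move=> y /mapP[x]; rewrite mem_filter => /andP[px s_x] ->.
by have [t_fx q_fx _] := f_inj x s_x px; rewrite mem_filter q_fx.
Qed.

Lemma count_bij (T U : eqType) (s : seq T) (t : seq U) (p : pred T) (q : pred U)
    (f : T -> U) (g : U -> T) : uniq s -> uniq t ->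
  (forall x, x \in s -> p x -> [/\ f x \in t, q (f x) & g (f x) = x]) ->
  (forall y, y \in t -> q y -> [/\ g y \in s, p (g y) & f (g y) = y]) ->
  count p s = count q t.
Proof.
move=> uniq_s uniq_t fP gP; apply/eqP; rewrite eqn_leq (count_leq_inj uniq_s fP).
exact: count_leq_inj uniq_t gP.
Qed.

Section Kostka.
Variable M : nat.
Local Notation P := (ptn M).

Definition ptn_of_seq (s : seq nat) : P := mkptn M (nth 0 s).

Definition seq_fits (s : seq nat) : Prop :=
  [/\ forall i, nth 0 s i.+1 <= nth 0 s i, nth 0 s 0 <= M & size s <= M].

Lemma ptn_of_seqE s i : seq_fits s -> ptn_of_seq s i = nth 0 s i.
Proof. by case=> nonincr_s s0 size_s; apply: mkptnE; split=> //; rewrite nth_default. Qed.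

Lemma weight_ptn_of_seq s : seq_fits s -> weight (ptn_of_seq s) = sumn s.
Proof.
move=> fits; have [_ _ size_s] := fits; rewrite sumnE (big_nth 0) big_mkord.
transitivity (\sum_(i < M) nth 0 s i); first by apply: eq_bigr => i _; rewrite ptn_of_seqE.
by apply: eq_sum_support => i le_i; rewrite nth_default //; exact: leq_trans le_i.
Qed.

Lemma seq_fits_mkseq (mu : P) r : r <= M -> (forall i, r <= i -> mu i = 0) ->
  seq_fits (mkseq mu r) /\ ptn_of_seq (mkseq mu r) = mu.
Proof.
move=> le_rM mu0.
have muE i : nth 0 (mkseq mu r) i = mu i.
  by case: (ltnP i r) => le_i; [rewrite nth_mkseq | rewrite nth_default ?size_mkseq ?mu0].
have fits : seq_fits (mkseq mu r).
  by split=> [i||]; rewrite ?muE ?prowS ?prow_max ?size_mkseq.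
by split=> //; apply: ptnP => i _; rewrite ptn_of_seqE.
Qed.

Section Shape.
Variables (N : nat) (sh : seq nat).
Hypothesis sh_fits : seq_fits sh.

Let sh_nonincr i : nth 0 sh i.+1 <= nth 0 sh i. Proof. by case: sh_fits. Qed.

Lemma interlaces_fits rh : interlaces sh rh -> seq_fits rh.
Proof.
move=> [size_rh bounds]; have [_ sh0 size_sh] := sh_fits.
split=> [i||]; last by rewrite size_rh.
  by have := bounds i; have := bounds i.+1; lia.
by have := bounds 0; lia.
Qed.

Lemma interlaces_hstrip rh : interlaces sh rh ->
  hstrip (ptn_of_seq sh) (ptn_of_seq rh) /\ mkseq (ptn_of_seq rh) (size sh) = rh.
Proof.
move=> rh_sh; have rh_fits := interlaces_fits rh_sh; have [size_rh bounds] := rh_sh.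
split; first by apply/hstripP => i; rewrite !ptn_of_seqE.
apply: (@eq_from_nth _ 0) => [|i]; rewrite size_mkseq // => lt_i.
by rewrite nth_mkseq // ptn_of_seqE.
Qed.

Lemma hstrip_interlaces (mu : P) : hstrip (ptn_of_seq sh) mu ->
  interlaces sh (mkseq mu (size sh)) /\ ptn_of_seq (mkseq mu (size sh)) = mu.
Proof.
move=> /hstripP strip; have [_ _ size_sh] := sh_fits.
have mu0 i : size sh <= i -> mu i = 0.
  by move=> le_i; have := strip i; rewrite !ptn_of_seqE // [nth 0 sh i]nth_default //; lia.
have [fits muK] := seq_fits_mkseq size_sh mu0; split=> //; split=> [|i].
  by rewrite size_mkseq.
by rewrite -(ptn_of_seqE i fits) muK; have := strip i; rewrite !ptn_of_seqE.
Qed.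

Lemma kostka_fiber m k (mu : P) : hstrip_by k (ptn_of_seq sh) mu ->
  count (fun T => (tableau sh N.+1 T && (content N.+1 T == rcons m k))
                  && (map size (restrict N T) == mkseq mu (size sh))) (fillings sh N.+1)
  = kostka N (mkseq mu (size sh)) m.
Proof.
move=> /hstrip_byP[strip weight_sh]; have [interlace muK] := hstrip_interlaces strip.
have mu_fits := interlaces_fits interlace; set rh := mkseq mu _ in interlace muK mu_fits *.
have sum_sh : sumn sh = sumn rh + k by rewrite -!weight_ptn_of_seq // muK.
rewrite kostka_tableau; apply: (@count_bij _ _ _ _ _ _ (restrict N) (extend N sh));
  rewrite ?fillings_uniq // => T _.
  move=> /andP[/andP[T_tab /eqP content_T] /eqP shape_T].
  have := restrict_tableau sh_nonincr T_tab; rewrite shape_T => restrict_tab.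
  split; [by case/andP: restrict_tab | | exact: restrictK].
  by rewrite restrict_tab /=; move: content_T; rewrite content_restrict => /rcons_inj[->].
move=> /andP[T_tab /eqP content_T]; have extend_tab := extend_tableau interlace T_tab.
have [shape_T _ _ _] := tableauP _ _ _ T_tab.
have TK := extendK interlace T_tab.
split=> //; first by case/andP: extend_tab.
rewrite extend_tab TK shape_T eqxx andbT content_restrict TK content_T /=.
have [shape_ext ext_N _ _] := tableauP _ _ _ extend_tab.
have := sumn_shape_restrict ext_N; rewrite TK shape_ext shape_T sum_sh => /addnI ->.
exact: eqxx.
Qed.

Lemma restrict_hstrip T m k (rh := map size (restrict N T)) : tableau sh N.+1 T ->
  content N.+1 T = rcons m k ->
  hstrip_by k (ptn_of_seq sh) (ptn_of_seq rh) /\ mkseq (ptn_of_seq rh) (size sh) = rh.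
Proof.
move=> T_tab content_T; have interlace := restrict_interlaces sh_nonincr T_tab.
have [strip rhK] := interlaces_hstrip interlace; split=> //; apply/hstrip_byP; split=> //.
rewrite !weight_ptn_of_seq //; last exact: interlaces_fits.
have [shape_T T_N _ _] := tableauP _ _ _ T_tab.
have := sumn_shape_restrict T_N; move: content_T; rewrite content_restrict shape_T.
by move=> /rcons_inj[_ ->].
Qed.

Lemma kostka_rec m k :
  kostka N.+1 sh (rcons m k) =
  \sum_(mu : P | hstrip_by k (ptn_of_seq sh) mu) kostka N (mkseq mu (size sh)) m.
Proof.
rewrite {1}kostka_tableau -sum1_count.
rewrite (partition_big (fun T => ptn_of_seq (map size (restrict N T)))
   (hstrip_by k (ptn_of_seq sh))) /=; last first.
  by move=> T /andP[T_tab /eqP content_T]; case: (restrict_hstrip T_tab content_T).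
apply: eq_bigr => mu strip; rewrite -(kostka_fiber _ strip) -sum1_count; apply: eq_bigl => T.
case: (boolP (tableau sh N.+1 T)) => //= T_tab; case: eqP => //= content_T.
have [_ rhK] := restrict_hstrip T_tab content_T.
case/hstrip_byP: strip => /hstrip_interlaces[_ muK] _.
by apply/eqP/eqP => [<-|->].
Qed.

End Shape.

Lemma kostka0 sh : seq_fits sh -> kostka 0 sh [::] = (ptn_of_seq sh == ptn0).
Proof.
move=> fits; rewrite /kostka; case: eqP => [shE|ne_sh] /=.
  have sh0 i : nth 0 sh i = 0 by rewrite -(ptn_of_seqE i fits) shE ptn0E.
  have -> : sh = nseq (size sh) 0.
    apply: (@eq_from_nth _ 0); first by rewrite size_nseq.
    by move=> i _; rewrite sh0 nth_nseq if_same.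
  have fillings0 r : fillings (nseq r 0) 0 = [:: nseq r [::]] by elim: r => //= r ->.
  rewrite fillings0 /= addn0 andbT (_ : is_ssyt _ = true) //.
  by apply/is_ssytP; split=> [i|i j]; rewrite !nth_nseq !if_same.
apply/eqP; rewrite -leqn0 leqNgt -has_count; apply/negP => /hasP[T].
rewrite mem_fillings => /andP[/eqP shape_T T_0] _; apply: ne_sh.
apply: ptnP => i _; rewrite ptn_of_seqE // ptn0E -shape_T -size_nth_nil.
by have := all_nth_nil i T_0; case: (nth [::] T i).
Qed.

Lemma kostka_schur_poly N sh m : seq_fits sh -> size m = N ->
  Posz (kostka N sh m) = schur_poly (ptn_of_seq sh) m.
Proof.
move=> fits size_m; rewrite /schur_poly -(perm_hmonom _ (s := rev m)) ?perm_rev //.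
rewrite -/(schur_poly _ (rev m)).
elim: N sh m fits size_m => [|N IHN] sh m fits.
  by move=> /size0nil->; rewrite kostka0 // schur_poly_nil; case: eqP.
case/lastP: m => // m k; rewrite size_rcons => -[size_m].
rewrite kostka_rec // rev_rcons schur_poly_cons (big_morph Posz PoszD (erefl _)).
apply: eq_bigr => mu /hstrip_byP[/(hstrip_interlaces fits)[interlace muK] _].
by rewrite IHN ?muK //; exact: interlaces_fits interlace.
Qed.

End Kostka.

(** * The intersection number *)

Lemma mem_comps_f f n t : n <= f ->
  (t \in comps_f f n) = all (fun x => 0 < x) t && (sumn t == n).
Proof.
elim: f n t => [|f IHf] n t le_nf /=.
  have -> : n = 0 by lia.
  by rewrite inE; case: t => [|[|x] t] //=; rewrite andbF.
case: eqP => [->|/eqP n0].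
  by rewrite inE; case: t => [|[|x] t] //=; rewrite andbF.
apply/allpairsPdep/idP => [[i [s []]]|].
  rewrite mem_iota => le_i; rewrite IHf; last by lia.
  move=> /andP[s_pos /eqP sum_s] ->; rewrite /= s_pos sum_s.
  by apply/andP; split; [|apply/eqP]; lia.
case: t => [|x t] /=; first by rewrite eq_sym (negPf n0).
move=> /andP[/andP[x_pos t_pos] /eqP sum_t]; exists x, t; split=> //.
  by rewrite mem_iota; lia.
by rewrite IHf; [rewrite t_pos; apply/eqP|]; lia.
Qed.

Lemma comps_f_uniq f n : uniq (comps_f f n).
Proof.
elim: f n => [|f IHf] n /=; case: eqP => // _.
apply: allpairs_uniq_dep => [|i _|]; [exact: iota_uniq | exact: IHf |].
by move=> [i s] [j t] _ _ /= [-> ->].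
Qed.

Lemma mem_partitions_of k t : (t \in partitions_of k) = is_partition t && (sumn t == k).
Proof.
rewrite mem_filter mem_comps_f // /is_partition.
by case: sorted => //=; case: all.
Qed.

Lemma partitions_of_uniq k : uniq (partitions_of k).
Proof. exact/filter_uniq/comps_f_uniq. Qed.

Lemma is_partitionP s :
  reflect ((forall i, nth 0 s i.+1 <= nth 0 s i) /\ (forall i, i < size s -> 0 < nth 0 s i))
          (is_partition s).
Proof.
apply: (iffP andP) => [[/(sortedP 0) sorted_s /(all_nthP 0) pos_s]|[sorted_s pos_s]].
  split=> // i; case: (ltnP i.+1 (size s)) => [lt_i|le_i]; first exact: sorted_s.
  by rewrite nth_default.
by split; [apply/(sortedP 0) => i _; exact: sorted_s | exact/(all_nthP 0)].
Qed.

Lemma nth_box a b i : nth 0 (box a b) i = if i < a then b else 0.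
Proof.
rewrite /box; case: eqP => [->|_]; first by rewrite nth_nil if_same.
by rewrite nth_nseq.
Qed.

Lemma box_partition a b : is_partition (box a b).
Proof.
apply/is_partitionP; split=> i; rewrite !nth_box; first by case: ifP; case: ifP; lia.
by rewrite /box; case: eqP => // b0; rewrite size_nseq => ->; lia.
Qed.

Definition is_condition (a b : nat) (s : seq nat) : bool :=
  is_partition s && subp s (box a b).

Lemma is_conditionP a b s :
  reflect [/\ is_partition s, size s <= a & nth 0 s 0 <= b] (is_condition a b s).
Proof.
apply: (iffP andP) => [[s_part /allP s_box]|[s_part size_s s0]].
  have s_le i : i < size s -> nth 0 s i <= if i < a then b else 0.
    by move=> lt_i; rewrite -nth_box; apply: s_box; rewrite mem_iota.
  have /is_partitionP[_ s_pos] := s_part; split=> //.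
    rewrite leqNgt; apply/negP => lt_a; have := s_le a lt_a; rewrite ltnn.
    by have := s_pos a lt_a; lia.
  have [lt_0|le_0] := ltnP 0 (size s); last by rewrite nth_default.
  by have := s_le 0 lt_0; case: ifP => //; lia.
split=> //; apply/allP => i; rewrite mem_iota nth_box => lt_i; rewrite ifT; last by lia.
have /is_partitionP[s_nonincr _] := s_part.
by apply: leq_trans s0; exact: (nonincr_leq s_nonincr).
Qed.

Lemma is_condition_leq a b a' b' s :
  is_condition a b s -> a <= a' -> b <= b' -> is_condition a' b' s.
Proof. by move=> /is_conditionP[s_part ? ?] ? ?; apply/is_conditionP; split=> //; lia. Qed.

Lemma is_condition_nil a b : is_condition a b [::].
Proof. exact/is_conditionP. Qed.

Lemma schubert_problemP a b ls :
  reflect ((forall s, s \in ls -> is_condition a b s) /\ sumn (map psize ls) = a * b)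
          (schubert_problem a b ls).
Proof. by apply: (iffP andP) => -[/allP conds /eqP sum_ls]. Qed.

Section Delta.
Variable M : nat.
Local Notation P := (ptn M).
Local Notation R := (schubert_ring M).
Implicit Types (l : P) (u : R).

Definition seq_of_ptn l : seq nat := mkseq l (conj l 0).

Lemma nth_seq_of_ptn l i : nth 0 (seq_of_ptn l) i = l i.
Proof.
case: (ltnP i (conj l 0)) => le_i; first by rewrite nth_mkseq.
by rewrite nth_default ?size_mkseq //; move: le_i; rewrite leq_conj; lia.
Qed.

Lemma seq_of_ptn_partition l : is_partition (seq_of_ptn l).
Proof.
apply/is_partitionP; split=> i; rewrite !nth_seq_of_ptn ?prowS //.
by rewrite size_mkseq ltn_conj.
Qed.

Lemma seq_fits_seq_of_ptn l : seq_fits M (seq_of_ptn l).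
Proof.
split=> [i||]; rewrite ?nth_seq_of_ptn ?prowS ?prow_max // size_mkseq; exact: prow_max.
Qed.

Lemma seq_of_ptnK l : ptn_of_seq M (seq_of_ptn l) = l.
Proof.
by apply: ptnP => i _; rewrite ptn_of_seqE ?nth_seq_of_ptn //; exact: seq_fits_seq_of_ptn.
Qed.

Lemma ptn_of_seqK s : is_partition s -> seq_fits M s -> seq_of_ptn (ptn_of_seq M s) = s.
Proof.
move=> /is_partitionP[_ s_pos] fits.
have size_s : conj (ptn_of_seq M s) 0 = size s.
  apply: eq_ltn => i; rewrite ltn_conj ptn_of_seqE //.
  by case: (ltnP i (size s)) => le_i; [rewrite s_pos | rewrite nth_default].
apply: (@eq_from_nth _ 0); first by rewrite size_mkseq.
by move=> i _; rewrite nth_seq_of_ptn ptn_of_seqE.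
Qed.

Lemma partition_fits s : is_partition s -> sumn s <= M -> seq_fits M s.
Proof.
move=> /is_partitionP[s_nonincr s_pos] leM; split=> //.
  apply: leq_trans leM; case: s {s_nonincr s_pos} => //= x s; exact: leq_addr.
apply: leq_trans leM; rewrite sumnE (big_nth 0) big_mkord -{1}(card_ord (size s)).
by rewrite -sum1_card; apply: leq_sum => i _; exact: s_pos.
Qed.

Lemma is_condition_fits a b s : is_condition a b s -> a <= M -> b <= M -> seq_fits M s.
Proof.
move=> /is_conditionP[/is_partitionP[s_nonincr _] size_s s0] le_aM le_bM.
by split=> //; lia.
Qed.

Lemma inbox_ptn_of_seq a b s : is_condition a b s -> a <= M -> b <= M ->
  inbox a b (ptn_of_seq M s).
Proof.
move=> s_cond le_aM le_bM; have fits := is_condition_fits s_cond le_aM le_bM.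
have /is_conditionP[_ size_s s0] := s_cond.
by rewrite /inbox !ptn_of_seqE // s0 nth_default.
Qed.

Lemma box_condition a b : is_condition a b (box a b).
Proof.
apply/is_conditionP; rewrite box_partition nth_box; split=> //; last by case: ifP.
by rewrite /box; case: eqP => //; rewrite size_nseq.
Qed.

Lemma ptn_of_seq_box a b : a <= M -> b <= M -> ptn_of_seq M (box a b) = box_ptn M a b.
Proof.
move=> le_aM le_bM; have fits := is_condition_fits (box_condition a b) le_aM le_bM.
by apply: ptnP => i _; rewrite box_ptnE // ptn_of_seqE // nth_box.
Qed.

Lemma sum_partitions_of (V : nmodType) k (F : seq nat -> V) : k <= M ->
  (\sum_(s <- partitions_of k) F s = \sum_(l | weight l == k) F (seq_of_ptn l))%R.
Proof.
move=> leM; rewrite -[RHS]big_filter -[RHS](big_map seq_of_ptn xpredT F); apply: perm_big.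
apply: uniq_perm; first exact: partitions_of_uniq.
  rewrite map_inj_uniq ?filter_uniq ?index_enum_uniq //; exact: can_inj seq_of_ptnK.
move=> s; rewrite mem_partitions_of; apply/andP/mapP => [[s_part /eqP sum_s]|[l]].
  have fits : seq_fits M s by apply: partition_fits; rewrite ?sum_s.
  exists (ptn_of_seq M s); last by rewrite ptn_of_seqK.
  by rewrite mem_filter mem_index_enum weight_ptn_of_seq ?sum_s ?eqxx.
rewrite mem_filter => /andP[/eqP weight_l _] ->; split; first exact: seq_of_ptn_partition.
by rewrite -(@weight_ptn_of_seq M) ?seq_of_ptnK ?weight_l //; exact: seq_fits_seq_of_ptn.
Qed.

Definition class_of_coefs k (c : seq nat -> int) : R :=
  [ffun l => if weight l == k then c (seq_of_ptn l) else 0%R].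

Lemma schur_expansionP N k (F : Defs.poly) c : k <= M ->
  schur_expansion N k F c <->
  forall m, size m = N -> F m = to_poly (class_of_coefs k c) m.
Proof.
move=> leM; suff sumE m : size m = N ->
    (\sum_(s <- partitions_of k) c s * Posz (kostka N s m))%R = to_poly (class_of_coefs k c) m.
  by split=> expand m size_m; rewrite expand // sumE.
move=> size_m; rewrite sum_partitions_of // big_mkcond; apply: eq_bigr => l _ /=.
rewrite ffunE (@kostka_schur_poly M) ?seq_of_ptnK //; last exact: seq_fits_seq_of_ptn.
by case: ifP; rewrite ?mul0r.
Qed.

Lemma schur_expansion_inj N k (F : Defs.poly) c c' s : k <= M ->
  schur_expansion N k F c -> schur_expansion N k F c' ->
  is_partition s -> sumn s = k -> size s <= N -> c s = c' s.
Proof.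
move=> leM /(schur_expansionP _ _ _ leM) expand /(schur_expansionP _ _ _ leM) expand'.
move=> s_part sum_s size_s; have fits : seq_fits M s by apply: partition_fits; rewrite ?sum_s.
have weight_s : weight (ptn_of_seq M s) = k by rewrite weight_ptn_of_seq.
have : (class_of_coefs k c - class_of_coefs k c')%R (ptn_of_seq M s) = 0%R.
  apply: (@to_poly_inj M N k) => [m size_m _||]; rewrite ?weight_s //.
    by rewrite to_poly_sub -expand // -expand' // subrr.
  by rewrite ptn_of_seqE // nth_default.
by rewrite schubert_coefB !ffunE weight_s eqxx ptn_of_seqK // => /eqP; rewrite subr_eq0 => /eqP.
Qed.

Lemma polyprod_schur N (ls : seq (seq nat)) (m : seq nat) :
  (forall s, s \in ls -> seq_fits M s) -> size m = N ->
  polyprod [seq schur N s | s <- ls] m = polyprod [seq schur_poly (ptn_of_seq M s) | s <- ls] m.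
Proof.
elim: ls m => [|s ls IHls] m fits size_m //=; apply: eq_polymul => t size_t _.
  by rewrite /schur (@kostka_schur_poly M) ?size_t //; apply: fits; rewrite mem_head.
by apply: IHls; rewrite ?size_t // => s' ls_s'; apply: fits; rewrite in_cons ls_s' orbT.
Qed.

Lemma to_poly_homogeneous k u s : homogeneous k u -> to_poly u s != 0%R -> sumn s = k.
Proof.
move=> homog; apply: contraNeq => ne_k; rewrite /to_poly big1 // => l _.
have [->|/homog weight_l] := eqVneq (u l) 0%R; first by rewrite mul0r.
have [->|/schur_poly_weight weight_s] := eqVneq (schur_poly l s) 0%R; first by rewrite mulr0.
by rewrite -weight_s weight_l eqxx in ne_k.
Qed.

Lemma polyprod_schur_expansion N k (ls : seq (seq nat)) :
  (forall s, s \in ls -> seq_fits M s) -> sumn (map psize ls) = k -> k <= M ->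
  schur_expansion N k (polyprod [seq schur N s | s <- ls])
    (fun s => (\prod_(s' <- ls) sigma (ptn_of_seq M s'))%R (ptn_of_seq M s)).
Proof.
move=> fits sum_ls leM; set u := (\prod_(s' <- ls) _)%R; apply/schur_expansionP => // m size_m.
have weight_ls : \sum_(s <- ls) weight (ptn_of_seq M s) = k.
  by rewrite -sum_ls sumnE big_map; apply: eq_big_seq => s /fits; exact: weight_ptn_of_seq.
have u_homog : homogeneous k u by rewrite -weight_ls; exact: homogeneous_prod.
have -> : class_of_coefs k (fun s => u (ptn_of_seq M s)) = u.
  apply/ffunP => l; rewrite ffunE seq_of_ptnK; case: eqP => // ne_lk.
  by apply/esym/eqP; apply: contra_notT ne_lk => /u_homog.
rewrite polyprod_schur //; have [sum_m|ne_m] := eqVneq (sumn m) k.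
  by rewrite -to_poly_prod ?sum_m.
have -> : to_poly u m = 0%R by apply/eqP; apply: contraNT ne_m => /(to_poly_homogeneous u_homog)->.
by apply/eqP; apply: contraNT ne_m => /polyprod_homogeneous->; rewrite weight_ls.
Qed.

Lemma delta_prod_sigma a b (ls : seq (seq nat)) :
  a <= M -> b <= M -> a * b <= M -> schubert_problem a b ls ->
  delta a b ls = (\prod_(s <- ls) sigma (ptn_of_seq M s))%R (box_ptn M a b).
Proof.
move=> le_aM le_bM leM /schubert_problemP[conds sum_ls].
have fits s : s \in ls -> seq_fits M s by move=> /conds/is_condition_fits; exact.
have expand := @polyprod_schur_expansion (a * b) _ ls fits sum_ls leM.
rewrite -ptn_of_seq_box // /delta sum_ls.
set coef_box := (X in epsilon _ X).
have coef_box_ex : exists x, coef_box x by do 2!eexists; split; first exact: expand.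
have [cf [cf_expand <-]] := epsilon_spec (inhabits 0%R) coef_box coef_box_ex.
have fits_box := is_condition_fits (box_condition a b) le_aM le_bM.
have sum_box : sumn (box a b) = a * b.
  by rewrite -(weight_ptn_of_seq fits_box) ptn_of_seq_box // weight_box_ptn.
apply: (schur_expansion_inj leM cf_expand expand) => //; first exact: box_partition.
by rewrite /box; case: eqP => // b0; rewrite size_nseq leq_pmulr //; lia.
Qed.

End Delta.

(** * Composed conditions *)

Lemma nth_padd m n i : nth 0 (padd m n) i = nth 0 m i + nth 0 n i.
Proof.
rewrite /padd; case: (ltnP i (maxn (size m) (size n))) => le_i.
  by rewrite (nth_map 0) ?size_iota // nth_iota.
by rewrite !nth_default ?size_map ?size_iota //; lia.
Qed.

Lemma size_padd m n : size (padd m n) = maxn (size m) (size n).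
Proof. by rewrite /padd size_map size_iota. Qed.

Lemma padd0 s : padd [::] s = s.
Proof.
apply: (@eq_from_nth _ 0) => [|i _]; first by rewrite size_padd max0n.
by rewrite nth_padd nth_nil.
Qed.

Lemma padd_partition m n : is_partition m -> is_partition n -> is_partition (padd m n).
Proof.
move=> /is_partitionP[m_nonincr m_pos] /is_partitionP[n_nonincr n_pos].
apply/is_partitionP; split=> i; rewrite !nth_padd; first exact: leq_add.
rewrite size_padd leq_max => /orP[/m_pos|/n_pos]; lia.
Qed.

Lemma pjoin_cat m n : is_partition m -> is_partition n ->
  (forall i, i < size m -> nth 0 n 0 <= nth 0 m i) ->
  pjoin m n = m ++ n /\ is_partition (m ++ n).
Proof.
move=> /is_partitionP[m_nonincr m_pos] /is_partitionP[n_nonincr n_pos] le_nm.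
have mn_part : is_partition (m ++ n).
  apply/is_partitionP; split=> i.
    rewrite !nth_cat; case: (ltnP i (size m)) => lt_i; case: (ltnP i.+1 (size m)) => lt_Si //.
    - by rewrite (_ : i.+1 - size m = 0) ?le_nm //; lia.
    - by lia.
    by rewrite subSn.
  rewrite size_cat nth_cat; case: (ltnP i (size m)) => [lt_i _|le_i lt_i]; first exact: m_pos.
  by apply: n_pos; lia.
split=> //; apply: (sorted_sort (leT := geq)); last by case/andP: mn_part.
by move=> x y z /=; lia.
Qed.

Section CornerCondition.
Variables (x e b c : nat) (m l : seq nat).
Hypotheses (m_cond : is_condition x b m) (l_cond : is_condition c e l).

Definition corner_row (i : nat) : nat := if i < x then e + nth 0 m i else nth 0 l (i - x).

Lemma is_condition_corner_row s : is_partition s -> size s <= x + c ->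
  nth 0 s =1 corner_row -> is_condition (x + c) (b + e) s.
Proof.
move=> s_part size_s sE; apply/is_conditionP; split=> //; rewrite sE /corner_row sub0n.
by have /is_conditionP[_ _ m0] := m_cond; have /is_conditionP[_ _ l0] := l_cond; case: ifP; lia.
Qed.

Lemma pjoin_padd_box (s := pjoin (padd (box x e) m) l) : 0 < e ->
  is_condition (x + c) (b + e) s /\ nth 0 s =1 corner_row.
Proof.
move=> e_gt0; have /is_conditionP[m_part size_m _] := m_cond.
have /is_conditionP[l_part size_l l0] := l_cond.
have size_top : size (padd (box x e) m) = x.
  by rewrite size_padd /box gtn_eqF // size_nseq; apply/maxn_idPl.
have [|join_cat s_part] := pjoin_cat (padd_partition (box_partition x e) m_part) l_part.
  by move=> i; rewrite size_top nth_padd nth_box => ->; lia.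
have sE : nth 0 s =1 corner_row.
  move=> i; rewrite /s join_cat nth_cat size_top nth_padd nth_box /corner_row.
  by case: ltnP.
split=> //; apply: is_condition_corner_row => //; rewrite /s join_cat //.
by rewrite size_cat size_top leq_add2l.
Qed.

Lemma padd_pjoin_box (s := padd (pjoin (box x e) l) m) :
  is_condition (x + c) (b + e) s /\ nth 0 s =1 corner_row.
Proof.
have /is_conditionP[m_part size_m _] := m_cond.
have /is_conditionP[l_part size_l l0] := l_cond.
have [|join_cat left_part] := pjoin_cat (box_partition x e) l_part.
  by rewrite /box; case: eqP => [//|_] i; rewrite size_nseq => lt_ix; rewrite nth_nseq lt_ix.
have size_box : size (box x e) <= x by have /is_conditionP[] := box_condition x e.
have nth_left i : nth 0 (box x e ++ l) i = if i < x then e else nth 0 l (i - x).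
  rewrite nth_cat nth_box /box; case: eqP => [e0|_]; last by rewrite size_nseq; case: ltnP.
  have l_nil : l = [::].
    have /is_partitionP[_ l_pos] := l_part; apply: size0nil; apply/eqP; rewrite -leqn0 leqNgt.
    by apply/negP => /l_pos; lia.
  by rewrite l_nil e0 !nth_nil !if_same.
have sE : nth 0 s =1 corner_row.
  move=> i; rewrite /s join_cat nth_padd nth_left /corner_row; case: ltnP => // le_xi.
  by rewrite [nth 0 m i]nth_default ?addn0 //; exact: leq_trans le_xi.
split=> //; apply: is_condition_corner_row => //; rewrite /s join_cat ?padd_partition //.
by rewrite size_padd size_cat; lia.
Qed.

Lemma ptn_of_seq_corner M s : x + c <= M -> b + e <= M ->
  is_condition (x + c) (b + e) s -> nth 0 s =1 corner_row ->
  ptn_of_seq M s = corner x e (ptn_of_seq M m) (ptn_of_seq M l).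
Proof.
move=> le_xcM le_beM s_cond sE.
have [[le_xM le_bM] [le_cM le_eM]] : (x <= M /\ b <= M) /\ (c <= M /\ e <= M) by lia.
have fits : fits_corner x e (ptn_of_seq M m) (ptn_of_seq M l).
  by apply: inbox_fits_corner le_xcM le_beM; exact: inbox_ptn_of_seq.
have s_fits := is_condition_fits s_cond le_xcM le_beM.
apply: ptnP => i _; rewrite (cornerE fits) (ptn_of_seqE _ s_fits) sE /corner_row.
rewrite !ptn_of_seqE //; first exact: is_condition_fits l_cond _ _.
exact: is_condition_fits m_cond _ _.
Qed.

Lemma sumn_corner s : is_condition (x + c) (b + e) s -> nth 0 s =1 corner_row ->
  sumn s = sumn m + x * e + sumn l.
Proof.
move=> s_cond sE; pose M := maxn (x + c) (b + e).
have [le_xcM le_beM] : x + c <= M /\ b + e <= M by rewrite leq_maxl leq_maxr.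
have [[le_xM le_bM] [le_cM le_eM]] : (x <= M /\ b <= M) /\ (c <= M /\ e <= M) by lia.
rewrite -!(@weight_ptn_of_seq M); [|exact: is_condition_fits l_cond _ _
  |exact: is_condition_fits m_cond _ _|exact: is_condition_fits s_cond _ _].
rewrite (ptn_of_seq_corner le_xcM le_beM s_cond sE) weight_corner //.
by apply: inbox_fits_corner le_xcM le_beM; exact: inbox_ptn_of_seq.
Qed.

End CornerCondition.

(** * The composition of Schubert problems *)

Lemma map_zip3 (S T U : Type) (s : seq S) (t : seq T) (u : seq U) :
  size s = size t -> size u = size t ->
  [/\ [seq x.1.1 | x <- zip (zip s t) u] = s, [seq x.1.2 | x <- zip (zip s t) u] = t &
      [seq x.2 | x <- zip (zip s t) u] = u].
Proof.
move=> size_s size_u; have size_st : size (zip s t) = size u by rewrite size_zip size_s minnn.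
rewrite (map_comp fst fst) (map_comp snd fst) -/(unzip1 (zip _ u)) -/(unzip2 (zip _ u)).
rewrite unzip1_zip ?size_st // unzip2_zip ?size_st //.
by rewrite -/(unzip1 _) -/(unzip2 _) unzip1_zip ?unzip2_zip ?size_s.
Qed.

Lemma mem_zip3 (S T U : eqType) (x0 : S) (y0 : T) (s : seq S) (t : seq T) (u : seq U) x :
  size s = size t -> size u = size t -> x \in zip (zip s t) u ->
  [/\ x.1.2 \in t, x.2 \in u & exists2 i, i < size t & x.1 = (nth x0 s i, nth y0 t i)].
Proof.
move=> size_s size_u x_zip; have [_ mapt mapu] := map_zip3 size_s size_u; split.
- by rewrite -mapt; apply/mapP; exists x.
- by rewrite -mapu; apply/mapP; exists x.
have : x.1 \in unzip1 (zip (zip s t) u) by apply/mapP; exists x.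
rewrite unzip1_zip ?size_zip ?size_s ?size_u ?minnn // => /(nthP (x0, y0))[i].
by rewrite size_zip size_s minnn => lt_i <-; exists i; rewrite // nth_zip.
Qed.

Definition condition_above (d : nat) (x : nat * seq nat * seq nat) : seq nat :=
  pjoin (padd (box x.1.1 d) x.1.2) x.2.
Definition condition_left (c : nat) (x : nat * seq nat * seq nat) : seq nat :=
  padd (pjoin (box c x.1.1) x.1.2) x.2.
Definition conditions_above (d : nat) (as_ : seq nat) (mu alpha : seq (seq nat)) :=
  map (condition_above d) (zip (zip as_ mu) alpha).
Definition conditions_left (c : nat) (bs : seq nat) (nu beta : seq (seq nat)) :=
  map (condition_left c) (zip (zip bs nu) beta).

Lemma conditions_left_cat c bs bs' nu nu' beta beta' : size bs = size nu -> size beta = size nu ->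
  conditions_left c (bs ++ bs') (nu ++ nu') (beta ++ beta')
  = conditions_left c bs nu beta ++ conditions_left c bs' nu' beta'.
Proof.
move=> size_bs size_beta; rewrite /conditions_left zip_cat // zip_cat ?map_cat //.
by rewrite size_zip size_bs size_beta minnn.
Qed.

Lemma conditions_left_empty c gamma :
  conditions_left c (nseq (size gamma) 0) (nseq (size gamma) [::]) gamma = gamma.
Proof.
elim: gamma => //= s gamma IHgamma; congr (_ :: _); last exact: IHgamma.
exact: padd0.
Qed.

(* A condition of [gamma] is a condition of [beta] composed with an empty condition. *)
Lemma compose_gamma c d as_ bs mu nu alpha beta gamma :
  size bs = size nu -> size beta = size nu ->
  compose c d as_ bs mu nu alpha beta gamma
  = conditions_above d as_ mu alpha ++ conditions_left c
      (bs ++ nseq (size gamma) 0) (nu ++ nseq (size gamma) [::]) (beta ++ gamma).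
Proof. by move=> size_bs size_beta; rewrite conditions_left_cat // conditions_left_empty. Qed.

Lemma schubert_problem_empty a b ls t :
  schubert_problem a b ls -> schubert_problem a b (ls ++ nseq t [::]).
Proof.
move=> /schubert_problemP[conds sum_ls]; apply/schubert_problemP; split=> [s|].
  by rewrite mem_cat mem_nseq => /orP[/conds//|/andP[_ /eqP->]]; exact: is_condition_nil.
by rewrite map_cat sumn_cat sum_ls map_nseq sumn_nseq mul0n addn0.
Qed.

Lemma delta_empty a b ls t :
  schubert_problem a b ls -> delta a b (ls ++ nseq t [::]) = delta a b ls.
Proof.
move=> problem; pose M := maxn (a * b) (maxn a b).
have [[le_aM le_bM] leM] : (a <= M /\ b <= M) /\ a * b <= M by rewrite /M; lia.
rewrite !(@delta_prod_sigma M) //; last exact: schubert_problem_empty.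
have sigma_nil : sigma (ptn_of_seq M [::]) = 1%R :> schubert_ring M.
  rewrite -sigma0; congr sigma; apply: ptnP => i _.
  by rewrite (ptn_of_seqE _ (is_condition_fits (is_condition_nil a b) le_aM le_bM)) nth_nil ptn0E.
by rewrite big_cat /= big_nseq sigma_nil; elim: t => [|t IHt]; rewrite /= ?mulr1 // mul1r.
Qed.

Lemma composable_empty a b lam mu nu as_ bs t : composable a b lam mu nu as_ bs ->
  composable a b (lam ++ nseq t [::]) mu (nu ++ nseq t [::]) as_ (bs ++ nseq t 0).
Proof.
move=> [perm_lam [size_as [size_bs [sum_as [sum_bs [len_mu fst_nu]]]]]].
split; first by rewrite catA perm_cat2r.
split; first by []; split; first by rewrite !size_cat !size_nseq size_bs.
split; first by []; split; first by rewrite sumn_cat sumn_nseq mul0n addn0.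
split=> // j _; rewrite !nth_cat size_bs; case: ltnP => [/fst_nu//|_].
by rewrite nth_nseq if_same.
Qed.

Section SchubertComposition.
Variables (a b c d : nat) (lam mu nu alpha beta : seq (seq nat)) (as_ bs : seq nat).
Hypotheses (c_gt0 : 0 < c) (d_gt0 : 0 < d).
Hypotheses (lam_problem : schubert_problem a b lam)
           (lam_composable : composable a b lam mu nu as_ bs).
Hypotheses (rho_problem : schubert_problem c d (alpha ++ beta))
           (size_alpha : size alpha = size mu) (size_beta : size beta = size nu).

Let mu_triples := zip (zip as_ mu) alpha.
Let nu_triples := zip (zip bs nu) beta.
Let above := conditions_above d as_ mu alpha.
Let left := conditions_left c bs nu beta.

Let perm_lam : perm_eq lam (mu ++ nu). Proof. by case: lam_composable. Qed.
Let map_mu_triples :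
  [/\ [seq x.1.1 | x <- mu_triples] = as_, [seq x.1.2 | x <- mu_triples] = mu
    & [seq x.2 | x <- mu_triples] = alpha].
Proof. by apply: map_zip3 => //; case: lam_composable => _ []. Qed.
Let map_nu_triples :
  [/\ [seq x.1.1 | x <- nu_triples] = bs, [seq x.1.2 | x <- nu_triples] = nu
    & [seq x.2 | x <- nu_triples] = beta].
Proof. by apply: map_zip3 => //; case: lam_composable => _ [_ []]. Qed.

Let sum_as : \sum_(x <- mu_triples) x.1.1 = a.
Proof.
have [as_E _ _] := map_mu_triples; have [_ [_ [_ [<- _]]]] := lam_composable.
by rewrite sumnE -[in RHS]as_E big_map.
Qed.
Let sum_bs : \sum_(x <- nu_triples) x.1.1 = b.
Proof.
have [bs_E _ _] := map_nu_triples; have [_ [_ [_ [_ [<- _]]]]] := lam_composable.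
by rewrite sumnE -[in RHS]bs_E big_map.
Qed.

Let sum_mu_nu : \sum_(x <- mu_triples) sumn x.1.2 + \sum_(x <- nu_triples) sumn x.1.2 = a * b.
Proof.
have [_ muE _] := map_mu_triples; have [_ nuE _] := map_nu_triples.
have /schubert_problemP[_ <-] := lam_problem.
rewrite (perm_sumn (perm_map psize perm_lam)) map_cat sumn_cat !sumnE !big_map.
by rewrite -[in RHS]muE -[in RHS]nuE !big_map.
Qed.
Let sum_alpha_beta : \sum_(x <- mu_triples) sumn x.2 + \sum_(x <- nu_triples) sumn x.2 = c * d.
Proof.
have [_ _ alphaE] := map_mu_triples; have [_ _ betaE] := map_nu_triples.
have /schubert_problemP[_ <-] := rho_problem; rewrite map_cat sumn_cat !sumnE !big_map.
by rewrite -[in RHS]alphaE -[in RHS]betaE !big_map.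
Qed.

Let lam_cond s : s \in mu ++ nu -> is_condition a b s.
Proof. by rewrite -(perm_mem perm_lam); case/schubert_problemP: lam_problem => + _; exact. Qed.
Let rho_cond s : s \in alpha ++ beta -> is_condition c d s.
Proof. by case/schubert_problemP: rho_problem => + _; exact. Qed.

Let mu_triple_cond x : x \in mu_triples -> is_condition x.1.1 b x.1.2 /\ is_condition c d x.2.
Proof.
have [_ [size_as [_ [_ [_ [len_mu _]]]]]] := lam_composable.
move=> /(mem_zip3 0 [::] size_as size_alpha)[mu_x alpha_x [i lt_i x_eq]].
split; last by apply: rho_cond; rewrite mem_cat alpha_x.
have /is_conditionP[part_x _ x0] : is_condition a b x.1.2 by apply: lam_cond; rewrite mem_cat mu_x.
by apply/is_conditionP; split=> //; rewrite x_eq; exact: len_mu.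
Qed.

Let nu_triple_cond x : x \in nu_triples -> is_condition a x.1.1 x.1.2 /\ is_condition c d x.2.
Proof.
have [_ [_ [size_bs [_ [_ [_ fst_nu]]]]]] := lam_composable.
move=> /(mem_zip3 0 [::] size_bs size_beta)[nu_x beta_x [i lt_i x_eq]].
split; last by apply: rho_cond; rewrite mem_cat beta_x orbT.
have /is_conditionP[part_x size_x _] : is_condition a b x.1.2.
  by apply: lam_cond; rewrite mem_cat nu_x orbT.
by apply/is_conditionP; split=> //; rewrite x_eq; exact: fst_nu.
Qed.

Let condition_aboveP x : x \in mu_triples ->
  is_condition (x.1.1 + c) (b + d) (condition_above d x)
  /\ nth 0 (condition_above d x) =1 corner_row x.1.1 d x.1.2 x.2.
Proof. by move=> /mu_triple_cond[mu_cond alpha_cond]; exact: pjoin_padd_box. Qed.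

Let condition_leftP x : x \in nu_triples ->
  is_condition (c + a) (d + x.1.1) (condition_left c x)
  /\ nth 0 (condition_left c x) =1 corner_row c x.1.1 x.2 x.1.2.
Proof. by move=> /nu_triple_cond[nu_cond beta_cond]; exact: padd_pjoin_box. Qed.

Let le_as x : x \in mu_triples -> x.1.1 <= a.
Proof. by move=> x_in; rewrite -sum_as (leq_big_seq (fun y => y.1.1)). Qed.
Let le_bs x : x \in nu_triples -> x.1.1 <= b.
Proof. by move=> x_in; rewrite -sum_bs (leq_big_seq (fun y => y.1.1)). Qed.

Lemma schubert_problem_compose : schubert_problem (a + c) (b + d) (above ++ left).
Proof.
apply/schubert_problemP; split=> [s|].
  rewrite mem_cat => /orP[/mapP[x x_in ->]|/mapP[x x_in ->]].
    have [cond _] := condition_aboveP x_in; apply: is_condition_leq cond _ _ => //.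
    by rewrite leq_add2r le_as.
  have [cond _] := condition_leftP x_in; apply: is_condition_leq cond _ _; rewrite addnC //.
  by rewrite leq_add2r le_bs.
have sum_above : sumn (map psize above)
    = \sum_(x <- mu_triples) sumn x.1.2 + d * a + \sum_(x <- mu_triples) sumn x.2.
  rewrite sumnE !big_map -sum_as -sum_nat_distr -big_split; apply: eq_big_seq => x x_in.
  have [cond sE] := condition_aboveP x_in; have [mu_cond alpha_cond] := mu_triple_cond x_in.
  by rewrite /= /psize (sumn_corner mu_cond alpha_cond cond sE) [d * _]mulnC.
have sum_left : sumn (map psize left)
    = \sum_(x <- nu_triples) sumn x.2 + c * b + \sum_(x <- nu_triples) sumn x.1.2.
  rewrite sumnE !big_map -sum_bs -sum_nat_distr -big_split; apply: eq_big_seq => x x_in.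
  have [cond sE] := condition_leftP x_in; have [nu_cond beta_cond] := nu_triple_cond x_in.
  by rewrite /= /psize (sumn_corner beta_cond nu_cond cond sE).
by rewrite map_cat sumn_cat sum_above sum_left; move: sum_mu_nu sum_alpha_beta; lia.
Qed.

Let M := (a + c) * (b + d).
Let le_acM : a + c <= M. Proof. by rewrite leq_pmulr //; lia. Qed.
Let le_bdM : b + d <= M. Proof. by rewrite leq_pmull //; lia. Qed.
Let le_aM : a <= M. Proof. by lia. Qed.
Let le_bM : b <= M. Proof. by lia. Qed.
Let le_cM : c <= M. Proof. by lia. Qed.
Let le_dM : d <= M. Proof. by lia. Qed.
Let to_ptn := ptn_of_seq M.

Let weightE x y s : is_condition x y s -> x <= M -> y <= M -> weight (to_ptn s) = sumn s.
Proof.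
by move=> cond le_xM le_yM; rewrite weight_ptn_of_seq //; exact: is_condition_fits cond _ _.
Qed.

Let above_corner x : x \in mu_triples ->
  to_ptn (condition_above d x) = corner x.1.1 d (to_ptn x.1.2) (to_ptn x.2).
Proof.
move=> x_in; have [cond sE] := condition_aboveP x_in.
have [mu_cond alpha_cond] := mu_triple_cond x_in.
apply: (ptn_of_seq_corner mu_cond alpha_cond _ le_bdM cond sE).
by apply: leq_trans le_acM; rewrite leq_add2r le_as.
Qed.

Let left_corner x : x \in nu_triples ->
  to_ptn (condition_left c x) = corner c x.1.1 (to_ptn x.2) (to_ptn x.1.2).
Proof.
move=> x_in; have [cond sE] := condition_leftP x_in.
have [nu_cond beta_cond] := nu_triple_cond x_in.
apply: (ptn_of_seq_corner beta_cond nu_cond _ _ cond sE); first by rewrite addnC.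
by rewrite addnC; apply: leq_trans le_bdM; rewrite leq_add2r le_bs.
Qed.

Lemma delta_compose :
  delta (a + c) (b + d) (above ++ left) = (delta a b lam * delta c d (alpha ++ beta))%R.
Proof.
rewrite !(@delta_prod_sigma M) //; try nia; last exact: schubert_problem_compose.
rewrite (perm_big _ perm_lam) !big_cat /=.
have [_ <- <-] := map_mu_triples; have [_ <- <-] := map_nu_triples; rewrite !big_map.
rewrite (eq_big_seq _ (fun x x_in => congr1 (@sigma M) (above_corner x_in))).
rewrite (eq_big_seq _ (fun x x_in => congr1 (@sigma M) (left_corner x_in))).
apply: prod_sigma_compose => //.
- move=> x x_in; have [cond _] := mu_triple_cond x_in.
  by apply: inbox_ptn_of_seq cond _ le_bM; exact: leq_trans (le_as x_in) le_aM.
- by move=> x /mu_triple_cond[_ cond]; exact: inbox_ptn_of_seq.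
- move=> x x_in; have [cond _] := nu_triple_cond x_in.
  by apply: inbox_ptn_of_seq cond le_aM _; exact: leq_trans (le_bs x_in) le_bM.
- by move=> x /nu_triple_cond[_ cond]; exact: inbox_ptn_of_seq.
- rewrite -sum_mu_nu; congr (_ + _); apply: eq_big_seq => x.
    move=> x_in; have [cond _] := mu_triple_cond x_in.
    by rewrite (weightE cond) // (leq_trans (le_as x_in)).
  move=> x_in; have [cond _] := nu_triple_cond x_in.
  by rewrite (weightE cond) // (leq_trans (le_bs x_in)).
rewrite -sum_alpha_beta; congr (_ + _); apply: eq_big_seq => x.
  by move=> /mu_triple_cond[_ cond]; rewrite (weightE cond).
by move=> /nu_triple_cond[_ cond]; rewrite (weightE cond).
Qed.

End SchubertComposition.

Theorem theorem2p9 (a b c d : nat) (lam mu nu : seq (seq nat)) (as_ bs : seq nat)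
  (alpha beta gamma : seq (seq nat)) :
  schubert_problem a b lam ->
  composable a b lam mu nu as_ bs ->
  0 < c -> 0 < d ->
  size alpha = size mu -> size beta = size nu ->
  schubert_problem c d (alpha ++ beta ++ gamma) ->
  schubert_problem (a + c) (b + d) (compose c d as_ bs mu nu alpha beta gamma) /\
  delta (a + c) (b + d) (compose c d as_ bs mu nu alpha beta gamma)
    = (delta a b lam * delta c d (alpha ++ beta ++ gamma))%R.
Proof.
move=> lam_problem lam_comp c_gt0 d_gt0 size_alpha size_beta rho_problem.
have [_ [_ [size_bs _]]] := lam_comp.
have size_beta_gamma : size (beta ++ gamma) = size (nu ++ nseq (size gamma) [::]).
  by rewrite !size_cat size_nseq size_beta.
have lam_problem' := schubert_problem_empty (size gamma) lam_problem.
have lam_comp' := composable_empty (size gamma) lam_comp.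
rewrite compose_gamma // -(delta_empty (size gamma) lam_problem); split.
  exact: schubert_problem_compose lam_problem' lam_comp' rho_problem size_alpha size_beta_gamma.
exact: delta_compose lam_problem' lam_comp' rho_problem size_alpha size_beta_gamma.
Qed.
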